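(* For every $p$ with $1<p<\infty$, the group $\mathrm{SL}(3,\mathbb{R})$ does not have the $p$-approximation property ($p$-AP).
   Context: Let $G$ be a locally compact group with a left Haar measure, $1<p<\infty$, $p'$ with $\frac1p+\frac1{p'}=1$. $\lambda_p(s)f(t)=f(s^{-1}t)$ is the left regular representation on $L_p(G)$. The Figà-Talamanca–Herz algebra $A_p(G)$ is the image of the map $\Lambda_p:L_{p'}(G)\hat\otimes L_p(G)\to C_0(G)$ (projective tensor product), $\Lambda_p(g\otimes f)(s)=\langle g,\lambda_p(s)f\rangle=\int_G g(t)f(s^{-1}t)\,dt$, with the quotient norm of $L_{p'}(G)\hat\otimes L_p(G)/\ker\Lambda_p$. $SQ_p$ is the class of (complex) Banach spaces that are quotients of closed subspaces (equivalently, subspaces of quotients) of $L_p$ spaces. $M_{p\text{-}cb}(G)$ is the space of functions $\varphi:G\to\mathbb{C}$ for which there exist $E\in SQ_p$ and continuous bounded maps $\alpha:G\to E$, $\beta:G\to E^*$ with $\varphi(st^{-1})=\langle\beta(s),\alpha(t)\rangle$ for all $s,t\in G$; its norm is the infimum of $\sup_t\|\alpha(t)\|\,\sup_s\|\beta(s)\|$ over all such $E,\alpha,\beta$. There are contractive inclusions $A_p(G)\hookrightarrow M_{p\text{-}cb}(G)\hookrightarrow C_b(G)$. $L_1(G)$ embeds in $M_{p\text{-}cb}(G)^*$ via $\langle f,\varphi\rangle=\int_G f\varphi$, and $Q_{p\text{-}cb}(G)$ denotes its norm closure in $M_{p\text{-}cb}(G)^*$; one has $M_{p\text{-}cb}(G)=Q_{p\text{-}cb}(G)^*$.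 $G$ has the $p$-AP if there is a net $(\varphi_i)$ in $A_p(G)$ such that $\varphi_i\to1$ in the weak* topology $\sigma(M_{p\text{-}cb}(G),Q_{p\text{-}cb}(G))$. *)

(* Defs.v *)
From HB Require Import structures.
From mathcomp Require Import all_boot all_order perm all_algebra.
From mathcomp Require Import complex.
From mathcomp Require Import all_classical all_reals all_analysis.

Set Implicit Arguments.
Unset Strict Implicit.
Unset Printing Implicit Defensive.
Import Order.TTheory GRing.Theory Num.Theory.
Import numFieldNormedType.Exports.
Local Open Scope classical_set_scope.
Local Open Scope ring_scope.

HB.mixin Record isLocallyCompactGroup G & Group G & PointedTopological G := {
  mulg_continuous : continuous (fun xy : G * G => (xy.1 * xy.2)%g);
  invg_continuous : continuous (fun x : G => (x^-1)%g);
  lcgroup_hausdorff : hausdorff_space G;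
  lcgroup_locally_compact : locally_compact [set: G]
}.

#[short(type="lcGroupType")]
HB.structure Definition LocallyCompactGroup :=
  {G of isLocallyCompactGroup G & Group G & PointedTopological G}.

Record SL (n : nat) (R : comUnitRingType) :=
  MkSL { SLval :> 'M[R]_n; SLval_det : \det SLval == 1 }.

Section SL_group.
Variables (n : nat) (R : comUnitRingType).
Implicit Types A B D : SL n R.

HB.instance Definition _ := [isSub for @SLval n R].
HB.instance Definition _ := [Choice of SL n R by <:].

Lemma SL_unitmx A : SLval A \in unitmx.
Proof. by rewrite unitmxE (eqP (SLval_det A)) unitr1. Qed.

Fact SL1_subproof : \det (1%:M : 'M[R]_n) == 1.
Proof. by rewrite det1. Qed.
Definition SL1 := MkSL SL1_subproof.

Fact SLM_subproof A B : \det (SLval A *m SLval B) == 1.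
Proof. by rewrite det_mulmx (eqP (SLval_det A)) (eqP (SLval_det B)) mul1r. Qed.
Definition SLM A B := MkSL (SLM_subproof A B).

Fact SLV_subproof A : \det (invmx (SLval A)) == 1.
Proof. by rewrite det_inv (eqP (SLval_det A)) invr1. Qed.
Definition SLV A := MkSL (SLV_subproof A).

Fact SLMA : associative SLM.
Proof. by move=> A B D; apply/val_inj; rewrite /= mulmxA. Qed.
Fact SL1M : left_id SL1 SLM.
Proof. by move=> A; apply/val_inj; rewrite /= mul1mx. Qed.
Fact SLM1 : right_id SL1 SLM.
Proof. by move=> A; apply/val_inj; rewrite /= mulmx1. Qed.
Fact SLVM : left_inverse SL1 SLV SLM.
Proof. by move=> A; apply/val_inj; rewrite /= mulVmx ?SL_unitmx. Qed.
Fact SLMV : right_inverse SL1 SLV SLM.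
Proof. by move=> A; apply/val_inj; rewrite /= mulmxV ?SL_unitmx. Qed.

HB.instance Definition _ := isGroup.Build (SL n R) SLMA SL1M SLM1 SLVM SLMV.
HB.instance Definition _ := isPointed.Build (SL n R) SL1.

End SL_group.

Section SL_topology.
Variables (n : nat) (R : realType).

HB.instance Definition _ :=
  Topological.copy (SL n R) (initial_topology (@SLval n R)).
HB.instance Definition _ := PointedTopological.on (SL n R).

Lemma SLval_continuous : continuous (@SLval n R : SL n R -> 'M[R]_n).
Proof. exact: initial_continuous. Qed.

Lemma continuous_mx (T : topologicalType) (m k : nat) (f : T -> 'M[R]_(m, k)) :
  (forall i j, continuous (fun x => f x i j)) -> continuous f.
Proof.
move=> fc x U [P PU UP]; apply: filterS UP _.
by apply: filter_forall => i; apply: filter_forall => j; exact: fc (PU i j).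
Qed.

Lemma continuous_bigop (T : topologicalType) (I : Type) (r : seq I) (P : pred I)
    (op : R -> R -> R) (idx : R) (F : I -> T -> R) :
  (forall f g : T -> R, continuous f -> continuous g ->
    continuous (fun x => op (f x) (g x))) ->
  (forall i, continuous (F i)) ->
  continuous (fun x => \big[op/idx]_(i <- r | P i) F i x).
Proof.
move=> opc Fc; elim: r => [|i r ih].
  have -> : (fun x => \big[op/idx]_(i <- [::] | P i) F i x) = cst idx.
    by apply/funext => x; rewrite big_nil.
  exact: cst_continuous.
have -> : (fun x => \big[op/idx]_(j <- i :: r | P j) F j x) =
    (if P i then (fun x => op (F i x) (\big[op/idx]_(j <- r | P j) F j x))
     else (fun x => \big[op/idx]_(j <- r | P j) F j x)).
  by apply/funext => x; rewrite big_cons; case: ifP.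
by case: (P i) => //; exact: opc.
Qed.

Lemma continuous_big_sum (T : topologicalType) (I : Type) (r : seq I) (P : pred I)
    (F : I -> T -> R) :
  (forall i, continuous (F i)) ->
  continuous (fun x => \sum_(i <- r | P i) F i x).
Proof.
move=> Fc; apply: continuous_bigop => // f g fc gc x.
by apply: continuousD; [exact: fc|exact: gc].
Qed.

Lemma continuous_big_prod (T : topologicalType) (I : Type) (r : seq I) (P : pred I)
    (F : I -> T -> R) :
  (forall i, continuous (F i)) ->
  continuous (fun x => \prod_(i <- r | P i) F i x).
Proof.
move=> Fc; apply: continuous_bigop => // f g fc gc x.
by apply: continuousM; [exact: fc|exact: gc].
Qed.

Lemma continuous_det (T : topologicalType) (k : nat) (f : T -> 'M[R]_k) :
  (forall i j, continuous (fun x => f x i j)) ->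
  continuous (fun x => \det (f x)).
Proof.
move=> fc; apply: continuous_big_sum => s x.
apply: (@continuousM R T (cst ((-1) ^+ s)) (fun x => \prod_i f x i (s i))).
  exact: cst_continuous.
by move: x; apply: continuous_big_prod.
Qed.

Lemma SL_entry_continuous (i j : 'I_n) :
  continuous (fun A : SL n R => SLval A i j).
Proof.
move=> A; apply: (@continuous_comp _ _ _ (@SLval n R)
  (fun M : 'M[R]_n => M i j) A); first exact: SLval_continuous.
exact: coord_continuous.
Qed.

Fact SL_mulg_continuous :
  continuous (fun AB : SL n R * SL n R => (AB.1 * AB.2)%g).
Proof.
apply: continuous_comp_initial; apply: continuous_mx => i j.
have -> : (fun AB : SL n R * SL n R =>
    (@SLval n R \o (fun AB => (AB.1 * AB.2)%g)) AB i j) =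
    (fun AB => \sum_k SLval AB.1 i k * SLval AB.2 k j).
  by apply/funext => AB; rewrite /= mxE.
apply: continuous_big_sum => k AB; apply: continuousM.
  apply: (@continuous_comp _ _ _ fst (fun A : SL n R => SLval A i k)).
    exact: cvg_fst.
  exact: SL_entry_continuous.
apply: (@continuous_comp _ _ _ snd (fun A : SL n R => SLval A k j)).
  exact: cvg_snd.
exact: SL_entry_continuous.
Qed.

Fact SL_invg_continuous : continuous (fun A : SL n R => (A^-1)%g).
Proof.
apply: continuous_comp_initial; apply: continuous_mx => i j.
have -> : (fun A : SL n R => (@SLval n R \o (fun A => (A^-1)%g)) A i j) =
    (fun A => (-1) ^+ (j + i) * \det (row' j (col' i (SLval A)))).
  apply/funext => A /=.
  by rewrite /invmx SL_unitmx (eqP (SLval_det A)) invr1 scale1r mxE.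
move=> A; apply: (@continuousM R _ (cst ((-1) ^+ (j + i)))
  (fun A : SL n R => \det (row' j (col' i (SLval A))))).
  exact: cst_continuous.
move: A; apply: continuous_det => k l.
have -> : (fun A : SL n R => row' j (col' i (SLval A)) k l) =
    (fun A => SLval A (lift j k) (lift i l)).
  by apply/funext => A; rewrite !mxE.
exact: SL_entry_continuous.
Qed.

Fact SL_hausdorff : hausdorff_space (SL n R).
Proof.
move=> A B AB; apply/val_inj; apply: (@norm_hausdorff _ 'M[R]_n) => U V UA VB.
have [D [UD VD]] := AB _ _ (SLval_continuous UA) (SLval_continuous VB).
by exists (SLval D).
Qed.

Lemma mx_box_compact (m k : nat) (M : R) :
  compact [set A : 'M[R]_(m, k) | forall i j, A i j \in `[(- M), M]].
Proof.
have bc : compact [set v : 'rV[R]_(m * k) | forall i, v ord0 i \in `[(- M), M]].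
  apply: (@rV_compact _ _ (fun=> `[(- M), M]%classic)).
  by move=> _; exact: segment_compact.
have vc : continuous (vec_mx : 'rV[R]_(m * k) -> 'M[R]_(m, k)).
  apply: continuous_mx => i j.
  have -> : (fun v : 'rV[R]_(m * k) => vec_mx v i j) =
     (fun v => v ord0 (mxvec_index i j)) by apply/funext => v; rewrite mxE.
  exact: coord_continuous.
have -> : [set A : 'M[R]_(m, k) | forall i j, A i j \in `[(- M), M]] =
   vec_mx @` [set v : 'rV[R]_(m * k) | forall i, v ord0 i \in `[(- M), M]].
  apply/seteqP; split => [A AM|_ [v vM <-] i j]; last by rewrite mxE.
  exists (mxvec A); last exact: mxvecK.
  by move=> l; case/mxvec_indexP: l => i j; rewrite mxvecE.
by apply: continuous_compact => //; exact: continuous_subspaceT.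
Qed.

Lemma SL_box_compact (M : R) :
  compact [set A : SL n R | forall i j, SLval A i j \in `[(- M), M]].
Proof.
move=> F FF FM.
pose K := [set B : 'M[R]_n | forall i j, B i j \in `[(- M), M]]
  `&` [set B | \det B = 1].
have Kc : compact K.
  apply: compact_closedI; first exact: mx_box_compact.
  rewrite (_ : [set B | _] = (fun B : 'M[R]_n => \det B) @^-1` [set 1]) //.
  apply: closed_comp; last exact: closed_eq.
  by move=> B _; move: B; apply: continuous_det => i j; exact: coord_continuous.
have FK : F (@SLval n R @^-1` K).
  by apply: filterS FM => A AM; split; [exact: AM|exact: (eqP (SLval_det A))].
have [B [[BM detB] clB]] := Kc (@SLval n R @ F) _ FK.
have B1 : \det B == 1 by exact/eqP.
exists (MkSL B1); split => //= P Q FP [V [[W oW <-] /= WB] WQ].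
have FP' : F (@SLval n R @^-1` (@SLval n R @` P)).
  by apply: filterS FP => A PA; exists A.
have [_ [[A PA <-] WA]] := clB _ _ FP' (open_nbhs_nbhs (conj oW WB)).
by exists A; split => //; exact: WQ.
Qed.

Fact SL_locally_compact : locally_compact [set: SL n R].
Proof.
move=> A _; pose M := `|SLval A| + 1.
have MA : nbhs A [set B : SL n R | forall i j, SLval B i j \in `[(- M), M]].
  have : nbhs A (@SLval n R @^-1` ball (SLval A) 1).
    by apply: SLval_continuous; exact: nbhsx_ballx.
  apply: filterS => B [_ AB] i j; rewrite in_itv/= -ler_norml.
  rewrite -[SLval B i j](subrK (SLval A i j)).
  rewrite (le_trans (ler_normD _ _))// addrC lerD//.
    rewrite [leRHS]/Num.Def.normr/= mx_normrE.
    by apply/bigmax_geP; right => /=; exists (i, j).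
  by rewrite distrC ltW//; exact: AB.
exists [set B : SL n R | forall i j, SLval B i j \in `[(- M), M]].
  by apply: filterS MA => B BM _.
split; first exact: SL_box_compact.
exact: compact_closed SL_hausdorff (@SL_box_compact M).
Qed.

HB.instance Definition _ := isLocallyCompactGroup.Build (SL n R)
  SL_mulg_continuous SL_invg_continuous SL_hausdorff SL_locally_compact.

End SL_topology.

Section complex_Lp.
Context {R : realType} {d : measure_display} {X : measurableType d}.
Variable mu : {measure set X -> \bar R}.
Implicit Types (p : \bar R) (f : X -> R[i]).

Definition measurable_funC f : Prop :=
  measurable_fun [set: X] (fun x => complex.Re (f x)) /\
  measurable_fun [set: X] (fun x => complex.Im (f x)).

Definition Lp_norm p f : \bar R := Lnorm mu p (fun x => (Normc.normc (f x))%:E).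

(* Functions are not identified when they agree almost everywhere: Lp p is the
   seminormed space whose quotient by the functions of seminorm 0 is the usual
   L_p space. *)
Definition Lp p : set (X -> R[i]) :=
  [set f | measurable_funC f /\ (Lp_norm p f < +oo)%E].

Definition integralC f : R[i] :=
  Complex (\int[mu]_x complex.Re (f x)) (\int[mu]_x complex.Im (f x)).

End complex_Lp.

Section banach.
Context {R : realType} {E : completeNormedModType R[i]}.

(* The library norm `|x| is a real nonnegative element of R[i]. *)
Definition rnorm (x : E) : R := complex.Re `|x|.

Definition dual_norm (l : E -> R[i]) : \bar R :=
  ereal_sup [set (Normc.normc (l x))%:E | x in [set x | rnorm x <= 1]].

End banach.

(* E is (isometrically) the quotient S / ker q of a closed subspace S of an
   L_p space, q : S -> E being the quotient map. By the norm formula q vanishes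
   on the functions of seminorm 0, hence factors through classes modulo almost
   everywhere equality; S is stable under such equality because it is closed. *)
Definition SQp {R : realType} (p : R) (E : completeNormedModType R[i]) : Prop :=
  exists (d : measure_display) (X : measurableType d)
    (mu : {measure set X -> \bar R}) (S : set (X -> R[i]))
    (q : (X -> R[i]) -> E),
  [/\ [/\ S `<=` Lp mu p%:E,
          S (fun=> 0),
          (forall a f g, S f -> S g -> S (fun x => a * f x + g x)) &
          (forall f, Lp mu p%:E f ->
             (forall e : R, 0 < e -> exists2 g, S g &
                (Lp_norm mu p%:E (fun x => f x - g x)%R < e%:E)%E) ->
             S f)],
      (forall a f g, S f -> S g ->
         q (fun x => a * f x + g x) = a *: q f + q g),
      (forall y : E, exists2 f, S f & q f = y) &
      (forall y : E, (rnorm y)%:E =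
         ereal_inf [set Lp_norm mu p%:E f | f in [set f | S f /\ q f = y]])].

Section multipliers.
Context {R : realType} {G : lcGroupType}.
Variable p : R.
Implicit Types phi psi : G -> R[i].

Definition sup_norm {E : completeNormedModType R[i]} (alpha : G -> E) : \bar R :=
  ereal_sup [set (rnorm (alpha t))%:E | t in [set: G]].

Definition dual_sup_norm {E : completeNormedModType R[i]}
    (beta : G -> {linear E -> R[i]^o}) : \bar R :=
  ereal_sup [set dual_norm (beta s) | s in [set: G]].

Definition Mpcb_rep phi (E : completeNormedModType R[i]) (alpha : G -> E)
    (beta : G -> {linear E -> R[i]^o}) : Prop :=
  [/\ SQp p E,
      continuous alpha /\ (sup_norm alpha < +oo)%E,
      (forall s, dual_norm (fun x => beta s' x - beta s x) @[s' --> s] --> 0%E)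
        /\ (dual_sup_norm beta < +oo)%E &
      forall s t, phi (s * t^-1)%g = beta s (alpha t)].

Definition Mpcb : set (G -> R[i]) :=
  [set phi | exists E alpha beta, @Mpcb_rep phi E alpha beta].

Definition Mpcb_norm phi : \bar R :=
  ereal_inf [set r | exists E alpha beta, @Mpcb_rep phi E alpha beta /\
                       r = (sup_norm alpha * dual_sup_norm beta)%E].

Definition Mpcb_dual_norm (l : (G -> R[i]) -> R[i]) : \bar R :=
  ereal_sup [set (Normc.normc (l phi))%:E |
             phi in [set phi | Mpcb phi /\ (Mpcb_norm phi <= 1)%E]].

(* Only the values of l on Mpcb matter. *)
Definition Mpcb_dual : set ((G -> R[i]) -> R[i]) :=
  [set l | (forall a phi psi, Mpcb phi -> Mpcb psi ->
              l (fun s => a * phi s + psi s) = a * l phi + l psi) /\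
           (Mpcb_dual_norm l < +oo)%E].

End multipliers.

Notation borel G := (g_sigma_algebraType (@open G)).

(* Left Haar measures as nonzero left-invariant Radon measures. *)
Definition left_haar {R : realType} {G : lcGroupType}
    (mu : {measure set (borel G) -> \bar R}) : Prop :=
  [/\ (0 < mu [set: G])%E,
      (forall (s : G) (A : set G), @measurable _ (borel G) A ->
         mu [set t : G | A (s * t)%g] = mu A),
      (forall K : set G, compact K -> (mu K < +oo)%E),
      (forall A : set G, @measurable _ (borel G) A ->
         mu A = ereal_inf [set mu U | U in [set U : set G | open U /\ A `<=` U]]) &
      (forall U : set G, open U ->
         mu U = ereal_sup [set mu K | K in [set K : set G | compact K /\ K `<=` U]])].

Section herz_algebra.
Context {R : realType} {G : lcGroupType}.
Variables (mu : {measure set (borel G) -> \bar R}) (p : R).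

Let q : \bar R := hoelder_conjugate p%:E.

Definition left_regular (s : G) (f : G -> R[i]) : G -> R[i] :=
  fun t => f (s^-1 * t)%g.

Definition Lp_pairing (g f : G -> R[i]) : R[i] :=
  integralC mu (fun t : borel G => g t * f t).

(* The list [:: (g_1, f_1); ...; (g_n, f_n)] stands for the element
   g_1 (x) f_1 + ... + g_n (x) f_n of the algebraic tensor product. *)
Definition tensor : Type := seq ((G -> R[i]) * (G -> R[i])).

Definition tensor_wf (u : tensor) : Prop :=
  forall i, (i < size u)%N ->
    Lp mu q (nth (fun=> 0, fun=> 0) u i).1 /\
    Lp mu p%:E (nth (fun=> 0, fun=> 0) u i).2.

(* Bilinear forms on (L_{p'}, L_p), well defined on classes modulo almost
   everywhere equality. *)
Definition Lp_bilinear (B : (G -> R[i]) -> (G -> R[i]) -> R[i]) : Prop :=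
  [/\ (forall a g1 g2 f, Lp mu q g1 -> Lp mu q g2 -> Lp mu p%:E f ->
         B (fun t => a * g1 t + g2 t) f = a * B g1 f + B g2 f),
      (forall a g f1 f2, Lp mu q g -> Lp mu p%:E f1 -> Lp mu p%:E f2 ->
         B g (fun t => a * f1 t + f2 t) = a * B g f1 + B g f2),
      (forall g f, Lp mu q g -> Lp mu p%:E f -> Lp_norm mu q g = 0%E ->
         B g f = 0) &
      (forall g f, Lp mu q g -> Lp mu p%:E f -> Lp_norm mu p%:E f = 0%E ->
         B g f = 0)].

(* Equality in the algebraic tensor product: bilinear forms separate its
   points. *)
Definition tensor_eq (u v : tensor) : Prop :=
  forall B, Lp_bilinear B -> \sum_(x <- u) B x.1 x.2 = \sum_(x <- v) B x.1 x.2.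

Definition tensor_sub (u v : tensor) : tensor :=
  u ++ [seq ((fun t => - x.1 t), x.2) | x <- v].

Definition projective_norm (u : tensor) : \bar R :=
  ereal_inf [set (\sum_(x <- v) Lp_norm mu q x.1 * Lp_norm mu p%:E x.2)%E |
             v in [set v | tensor_wf v /\ tensor_eq u v]].

Definition projective_cauchy (u : nat -> tensor) : Prop :=
  forall e : R, 0 < e -> exists N, forall m n, (N <= m)%N -> (N <= n)%N ->
    (projective_norm (tensor_sub (u m) (u n)) < e%:E)%E.

Definition Lambda (u : tensor) (s : G) : R[i] :=
  \sum_(x <- u) Lp_pairing x.1 (left_regular s x.2).

(* The elements of the completed projective tensor product are the limits of
   Cauchy sequences of algebraic tensors, and Lambda extends to it by
   continuity for the uniform, hence the pointwise, convergence. *)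
Definition Ap : set (G -> R[i]) :=
  [set phi | exists u : nat -> tensor,
    [/\ forall n, tensor_wf (u n), projective_cauchy u &
        forall s, Normc.normc (Lambda (u n) s - phi s) @[n --> \oo] --> (0 : R)]].

Definition L1_functional (f : G -> R[i]) (phi : G -> R[i]) : R[i] :=
  integralC mu (fun t : borel G => f t * phi t).

Definition Qpcb : set ((G -> R[i]) -> R[i]) :=
  [set l | Mpcb_dual p l /\
    forall e : R, 0 < e -> exists2 f, Lp mu 1%:E f &
      (Mpcb_dual_norm p (fun phi => l phi - L1_functional f phi)%R < e%:E)%E].

Definition directed (I : Type) (le : I -> I -> Prop) : Prop :=
  [/\ inhabited I, (forall i, le i i),
      (forall i j k, le i j -> le j k -> le i k) &
      (forall i j, exists k, le i k /\ le j k)].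

Definition p_AP : Prop :=
  exists (I : Type) (le : I -> I -> Prop) (phi : I -> G -> R[i]),
  [/\ directed le, (forall i, Ap (phi i)) &
      forall l, Qpcb l -> forall e : R, 0 < e ->
        exists i0, forall i, le i0 i -> Normc.normc (l (phi i) - l (fun=> 1)) < e].

End herz_algebra.

(* Main.v *)
(* Let x12, x13, x23, x21, x31 be the five elementary one-parameter subgroups of
   SL(3,R) whose roots are consecutive on the hexagon, and let mu_t be the average
   of x12(a) x23(s) x31(a') over a, a' in [0,1] and s in {0, t, ..., (M-1) t}.
   In a Heisenberg group <x, y, z>, averaging y^b x^a and y^b x^a z^k over suitable
   ranges of a and b gives almost the same operator on l_2, hence on l_p by
   interpolation, and on l_p(E) for E in SQ_p; transferring a p-completely bounded
   multiplier to a finite Heisenberg model, the two averages are close as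
   functionals on the multipliers, polynomially in the lengths of the ranges.
   Applying this to <x23, x31, x21>, <x12, x23, x13> and <x21, x13, x23>, one
   replaces the factor x23(s) by an average of x13 x21 that does not depend on t:
   the mu_t, smoothed by a compactly supported function, form a Cauchy sequence in
   the dual of the multipliers. Its limit lies in Q_p-cb, is nonzero on the
   constant 1 and is zero on functions vanishing at infinity, in particular on
   A_p. *)

Require Import Defs.
From HB Require Import structures.
From mathcomp Require Import all_boot all_order all_algebra perm.
From mathcomp Require Import complex zify ring lra.
From mathcomp Require Import all_classical all_reals all_analysis measurable_realfun.

Set Implicit Arguments.
Unset Strict Implicit.
Unset Printing Implicit Defensive.
Import Order.TTheory GRing.Theory Num.Theory.
Import numFieldNormedType.Exports.
Local Open Scope classical_set_scope.
Local Open Scope ring_scope.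

(** * Heisenberg averages on l_2 *)

(** The translation that trades [y^b] for [y^b z^k] is by [x^(k/b)], so [k] must be divisible by
    every [b] in the range of averaging. This arithmetic shapes the proof: one-parameter averages
    become means over meshes, and the number of points of a mesh carries factorials that depend on
    t. Two values of t are compared on a common refinement; the change of mesh is made on the
    kernels, where the Lipschitz constant of the smoothing function controls it, and it costs as
    little as wanted because the mesh is chosen last. An insertion of [z^k] costs about [1/M + k/N]
    to a power that depends on p. At scale m, x13 runs over [0, m^5) and x21 over m multiples of
    m^4, while m^6 <= t and t M <= m^8. The three insertions then have k/N at most 1/m, and the
    window is wide enough for two successive values of t: take t = M^6, with M multiplied at each
    step by a fixed power of 2 chosen from the exponent. Hence summable errors for every p. *)

Section FiniteL2.
Context {R : realType} {T : finType}.
Implicit Types (f g h u v : T -> R) (s r : {perm T}).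

Definition dot f g := \sum_t f t * g t.
Definition nrm f := Num.sqrt (dot f f).
Definition pull s f : T -> R := fun t => f (s t).
Definition avg n (F : nat -> T -> R) : T -> R :=
  fun t => n%:R^-1 * \sum_(i < n) F i t.

Lemma dot_ge0 f : 0 <= dot f f.
Proof. by apply: sumr_ge0 => t _; rewrite -expr2 sqr_ge0. Qed.

Lemma nrm_ge0 f : 0 <= nrm f. Proof. exact: sqrtr_ge0. Qed.

Lemma nrm_sqr f : nrm f ^+ 2 = dot f f.
Proof. by rewrite sqr_sqrtr ?dot_ge0. Qed.

Lemma dotC f g : dot f g = dot g f.
Proof. by apply: eq_bigr => t _; rewrite mulrC. Qed.

Lemma dotDl f g h : dot (fun t => f t + g t) h = dot f h + dot g h.
Proof. by rewrite -big_split; apply: eq_bigr => t _; rewrite mulrDl. Qed.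

Lemma dotBl f g h : dot (fun t => f t - g t) h = dot f h - dot g h.
Proof. by rewrite -sumrB; apply: eq_bigr => t _; rewrite mulrBl. Qed.

Lemma dotZl a f h : dot (fun t => a * f t) h = a * dot f h.
Proof. by rewrite mulr_sumr; apply: eq_bigr => t _; rewrite mulrA. Qed.

Lemma dotBr f g h : dot h (fun t => f t - g t) = dot h f - dot h g.
Proof. by rewrite dotC dotBl !(dotC h). Qed.

Lemma dot_suml n (F : nat -> T -> R) h :
  dot (fun t => \sum_(i < n) F i t) h = \sum_(i < n) dot (F i) h.
Proof.
rewrite exchange_big; apply: eq_bigr => t _.
by rewrite mulr_suml.
Qed.

Lemma dot_sumr n (F : nat -> T -> R) h :
  dot h (fun t => \sum_(i < n) F i t) = \sum_(i < n) dot h (F i).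
Proof. by rewrite dotC dot_suml; apply: eq_bigr => i _; rewrite dotC. Qed.

Lemma dot_pull s f g : dot (pull s f) (pull s g) = dot f g.
Proof. by rewrite /dot [RHS](reindex_inj (@perm_inj _ s)). Qed.

Lemma nrm_pull s f : nrm (pull s f) = nrm f.
Proof. by rewrite /nrm dot_pull. Qed.

Lemma pullM s r f : pull s (pull r f) = pull (s * r)%g f.
Proof. by apply/funext => t; rewrite /pull permM. Qed.

Lemma dot_le f g : `|dot f g| <= nrm f * nrm g.
Proof.
suff h : dot f g ^+ 2 <= dot f f * dot g g.
  rewrite -sqrtrM ?dot_ge0// -[leLHS]ger0_norm// -sqrtr_sqr ler_wsqrtr//.
  by rewrite real_normK ?num_real.
have [g0|g0] := eqVneq (dot g g) 0.
  suff -> : dot f g = 0 by rewrite g0 expr0n/= mulr0.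
  rewrite /dot big1// => t _.
  have /eqP := g0; rewrite psumr_eq0 => [/allP/(_ t)|i _]; last first.
    by rewrite -expr2 sqr_ge0.
  by rewrite mem_index_enum => /(_ isT)/=; rewrite mulf_eq0 orbb => /eqP ->; rewrite mulr0.
have gp : 0 < dot g g by rewrite lt_neqAle eq_sym g0 dot_ge0.
have := dot_ge0 (fun t => dot g g * f t - dot f g * g t).
rewrite dotBl !dotBr !dotZl !(dotC _ (fun t => _ * _)) !dotZl (dotC g f) => H.
have {}H : 0 <= dot g g * (dot f f * dot g g - dot f g ^+ 2) by apply: le_trans H _; rewrite le_eqVlt; apply/orP; left; apply/eqP; ring.
by rewrite pmulr_rge0// subr_ge0 in H.
Qed.

Lemma nrmD f g : nrm (fun t => f t + g t) <= nrm f + nrm g.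
Proof.
rewrite -(@ler_pXn2r _ 2) ?nnegrE ?nrm_ge0 ?addr_ge0 ?nrm_ge0//.
rewrite nrm_sqr dotDl !(dotC _ (fun t => _ + _)) !dotDl (dotC g f) sqrrD !nrm_sqr.
have := ler_norm (dot f g); have := dot_le f g; lra.
Qed.

Lemma nrmZ a f : nrm (fun t => a * f t) = `|a| * nrm f.
Proof.
by rewrite /nrm dotZl dotC dotZl mulrA -expr2 sqrtrM ?sqr_ge0// sqrtr_sqr.
Qed.

Lemma nrmB f g : nrm (fun t => f t - g t) <= nrm f + nrm g.
Proof.
have -> : nrm g = nrm (fun t => -1 * g t) by rewrite nrmZ normrN1 mul1r.
under eq_fun do rewrite -mulN1r.
exact: nrmD.
Qed.

Lemma nrm_avg_le n F f : (forall i, nrm (F i) <= nrm f) -> nrm (avg n F) <= nrm f.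
Proof.
move=> H; rewrite /avg nrmZ ger0_norm ?invr_ge0//.
case: n => [|n]; first by rewrite invr0 mul0r nrm_ge0.
rewrite ler_pdivrMl ?ltr0n//.
elim: n.+1 => [|m ih].
  rewrite mul0r /nrm (_ : dot _ _ = 0) ?sqrtr0//.
  by rewrite /dot big1// => t _; rewrite big_ord0 mul0r.
under [X in nrm X]eq_fun do rewrite big_ord_recr/=.
apply: le_trans (nrmD _ _) _; rewrite -natr1 mulrDl mul1r; exact: lerD.
Qed.

(** One shift telescopes: all but the two extreme terms of the average cancel, which leaves [2 / N]
    times the norm of [f]. Translations are isometric, so [j] shifts cost [j] times as much. *)
Lemma avg_shift (x : {perm T}) N f j (v := avg N (fun a => pull (x ^+ a)%g f)) : (0 < N)%N ->
  nrm (fun t => pull (x ^+ j)%g v t - v t) <= j%:R * (2 / N%:R * nrm f).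
Proof.
move=> N0; elim: j => [|j ih].
  rewrite mul0r expg0 /nrm /dot big1 ?sqrtr0// => t _.
  by rewrite /pull perm1 subrr mul0r.
have -> : (fun t => pull (x ^+ j.+1)%g v t - v t) =
    (fun t => (pull (x ^+ j)%g (fun t => pull x v t - v t) t) + (pull (x ^+ j)%g v t - v t)).
  by apply/funext => t; rewrite /pull expgSr permM addrA subrK.
apply: le_trans (nrmD _ _) _; rewrite nrm_pull -natr1 addrC mulrDl mul1r lerD//.
have -> : (fun t => pull x v t - v t) =
   (fun t => N%:R^-1 * (pull (x ^+ N)%g f t - f t)).
  apply/funext => t; rewrite /v /avg {1}/pull -mulrBr; congr (_ * _).
  rewrite -sumrB.
  transitivity (\sum_(i < N) (pull (x ^+ i.+1)%g f t - pull (x ^+ i)%g f t)).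
    by apply: eq_bigr => i _; rewrite /pull expgS permM.
  rewrite -(big_mkord xpredT (fun i => pull (x ^+ i.+1)%g f t - pull (x ^+ i)%g f t)).
  by rewrite telescope_sumr// expg0 {2}/pull perm1.
rewrite nrmZ ger0_norm ?invr_ge0// mulrAC mulrC ler_wpM2r ?invr_ge0//.
by apply: le_trans (nrmB _ _) _; rewrite nrm_pull mulr2n mulrDl mul1r.
Qed.

End FiniteL2.

Section HeisenbergWords.
Local Open Scope group_scope.

Definition hword {G : groupType} (x y z : G) (b a c : nat) : G :=
  y ^+ b * x ^+ a * z ^+ c.

Definition heisenberg {G : groupType} (x y z : G) :=
  [/\ x * y = y * x * z, commute x z & commute y z].

Lemma heisenbergX {G : groupType} (x y z : G) (a b : nat) : heisenberg x y z ->
  x ^+ a * y ^+ b = y ^+ b * x ^+ a * z ^+ (a * b).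
Proof.
move=> [xy xz yz].
have H1 n : x ^+ n * y = y * x ^+ n * z ^+ n.
  elim: n => [|n ih]; first by rewrite !expg0 !mulg1 mul1g.
  rewrite expgS -mulgA ih !mulgA xy -!mulgA; congr (_ * _).
  by rewrite (mulgA z) (commuteX n (commute_sym xz)) -mulgA -expgS mulgA -expgS.
elim: b => [|b ih]; first by rewrite muln0 !expg0 !mulg1 mul1g.
rewrite expgS mulgA H1 -!mulgA; congr (_ * _).
have c : commute (z ^+ a) (y ^+ b) by apply: commuteX2; exact: commute_sym.
by rewrite c (mulgA (x ^+ a)) ih -!mulgA -expgnDr mulnS addnC.
Qed.

(** Moving [x ^+ a] past [y ^+ b'] produces the twist [z ^+ (a * b')]. This is the law of the
    discrete Heisenberg group in natural exponents, the form that can be copied on a finite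
    model. *)
Lemma hwordM {G : groupType} (x y z : G) b a c b' a' c' : heisenberg x y z ->
  hword x y z b a c * hword x y z b' a' c' =
  hword x y z (b + b') (a + a') (c + c' + a * b').
Proof.
move=> hs; have [xy xz yz] := hs; rewrite /hword.
have cy n m : commute (z ^+ n) (y ^+ m) by apply: commuteX2; exact: commute_sym.
have cx n m : commute (z ^+ n) (x ^+ m) by apply: commuteX2; exact: commute_sym.
rewrite !mulgA -(mulgA _ (z ^+ c)) cy mulgA -(mulgA _ (z ^+ c)) cx.
rewrite -(mulgA (y ^+ b)) (heisenbergX a b' hs) !mulgA -expgnDr.
rewrite -(mulgA _ (z ^+ (a * b'))) cx !mulgA -(mulgA _ (x ^+ a)) -expgnDr.
by rewrite -!mulgA -!expgnDr [(a * b' + _)%N]addnC.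
Qed.

End HeisenbergWords.

Section HeisenbergL2.
Context {R : realType} {T : finType}.
Variables (x y z : {perm T}) (M N k : nat).
Hypothesis hs : heisenberg x y z.
Hypothesis dvd_k : forall b, (0 < b < M)%N -> (b %| k)%N.
Hypotheses (M0 : (0 < M)%N) (N0 : (0 < N)%N).

Definition heis_op (f : T -> R) : T -> R := fun t =>
  (M%:R * N%:R)^-1 * \sum_(b < M) \sum_(a < N)
    (f (hword x y z b a 0 t) - f (hword x y z b a k t)).

(** The adjoint is carried along for two purposes: duality in the range [p < 2], and the averages of
    inverse words. *)
Definition heis_adj (f : T -> R) : T -> R := fun t =>
  (M%:R * N%:R)^-1 * \sum_(b < M) \sum_(a < N)
    (f ((hword x y z b a 0)^-1 t)%g - f ((hword x y z b a k)^-1 t)%g).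

Lemma heis_adjE f g : dot (heis_op f) g = dot f (heis_adj g).
Proof.
rewrite /heis_op /heis_adj (dotC f) !dotZl; congr (_ * _).
rewrite (dot_suml _ (fun b t => \sum_(a < N)
    (f (hword x y z b a 0 t) - f (hword x y z b a k t)))).
rewrite (dot_suml _ (fun b t => \sum_(a < N)
    (g ((hword x y z b a 0)^-1 t)%g - g ((hword x y z b a k)^-1 t)%g))).
apply: eq_bigr => b _.
rewrite (dot_suml _ (fun a t => (f (hword x y z b a 0 t) - f (hword x y z b a k t)))).
rewrite (dot_suml _ (fun a t => (g ((hword x y z b a 0)^-1 t)%g - g ((hword x y z b a k)^-1 t)%g))).
apply: eq_bigr => a _; rewrite !dotBl.
have E (s : {perm T}) : dot (fun t => f (s t)) g = dot (fun t => g (s^-1 t)%g) f.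
  rewrite -(dot_pull s^-1) dotC; congr (dot _ _).
  by apply/funext => t; rewrite /pull permKV.
by congr (_ - _); exact: E.
Qed.

(* Translating both sides of the pairing by [x ^+ j], [j = k / b], almost fixes
   the average [v] and multiplies [y ^+ b] by [z ^+ k]. *)
Lemma dot_translate (f p r : T -> R) (d : R) b : (0 < b < M)%N ->
  (forall j, (j <= k)%N ->
     nrm (fun t => pull (x ^+ j)%g p t - p t) <= d) ->
  (forall j, (j <= k)%N ->
     nrm (fun t => pull (x ^+ j)%g r t - r t) <= d) ->
  nrm p <= nrm f -> nrm r <= nrm f ->
  `|dot p (pull (y ^+ b)%g r) - dot p (pull (y ^+ b * z ^+ k)%g r)| <= 2 * d * nrm f.
Proof.
move=> bM dp dr pf rf; have [_ xz _] := hs.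
have b0 : (0 < b)%N by case/andP: bM.
have /dvdnP[j jk] := dvd_k bM.
have jlek : (j <= k)%N by rewrite jk leq_pmulr.
have E : dot p (pull (y ^+ b)%g r) =
   dot (pull (x ^+ j)%g p) (pull (y ^+ b * z ^+ k)%g (pull (x ^+ j)%g r)).
  rewrite pullM (_ : (y ^+ b * z ^+ k * x ^+ j = x ^+ j * y ^+ b)%g).
    by rewrite -pullM dot_pull.
  by rewrite (heisenbergX _ _ hs) -jk -!mulgA; congr (_ * _)%g; apply: commuteX2; exact: commute_sym.
rewrite E; set s := (_ * _)%g.
have -> : dot (pull (x ^+ j)%g p) (pull s (pull (x ^+ j)%g r)) - dot p (pull s r) =
   dot (fun t => pull (x ^+ j)%g p t - p t) (pull s (pull (x ^+ j)%g r)) +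
   dot p (pull s (fun t => pull (x ^+ j)%g r t - r t)).
  have -> : pull s (fun t => pull (x ^+ j)%g r t - r t) =
     (fun t => pull s (pull (x ^+ j)%g r) t - pull s r t) by [].
  rewrite dotBl dotBr; ring.
apply: le_trans (ler_normD _ _) _.
have -> : 2 * d * nrm f = d * nrm f + nrm f * d by ring.
apply: lerD; apply: le_trans (dot_le _ _) _; rewrite !nrm_pull.
  by apply: ler_pM => //; [exact: nrm_ge0|exact: nrm_ge0|exact: dp].
by apply: ler_pM => //; [exact: nrm_ge0|exact: nrm_ge0|exact: dr].
Qed.

(** Almost orthogonality: the operator averages the vectors [y^b u] with [u = v - z^k v]. In the
    square of its norm the [M] diagonal terms contribute [4 / M]; the others are small because [y^b]
    and [y^b z^k] have nearly the same matrix coefficients on [v] and [w]. *)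
Lemma heis_op_l2 f :
  dot (heis_op f) (heis_op f) <= (4 / M%:R + 8 * k%:R / N%:R) * dot f f.
Proof.
have [_ xz yz] := hs.
pose v := avg N (fun a => pull (x ^+ a)%g f).
pose w := pull (z ^+ k)%g v.
pose u : T -> R := fun t => v t - w t.
have opE : heis_op f = avg M (fun b => pull (y ^+ b)%g u).
  apply/funext => t; rewrite /heis_op /avg invfM -mulrA; congr (_ * _).
  rewrite mulr_sumr; apply: eq_bigr => b _.
  rewrite sumrB mulrBr /pull /u /w /v /avg /pull; congr (_ * _ - _ * _).
    by apply: eq_bigr => a _; rewrite /hword expg0 mulg1 permM.
  apply: eq_bigr => a _; rewrite /hword -!permM; congr (f (fun_of_perm _ _)).
  by rewrite -!mulgA; congr (_ * _)%g; exact: commuteX2.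
have vf : nrm v <= nrm f by apply: nrm_avg_le => i; rewrite nrm_pull.
have wf : nrm w <= nrm f by rewrite nrm_pull.
have uf : nrm u <= 2 * nrm f.
  by apply: le_trans (nrmB _ _) _; rewrite mulr2n mulrDl mul1r lerD.
set d := k%:R * (2 / N%:R * nrm f).
have dv j : (j <= k)%N -> nrm (fun t => pull (x ^+ j)%g v t - v t) <= d.
  move=> jk; apply: le_trans (avg_shift x f j N0) _.
  by rewrite ler_wpM2r ?ler_nat// mulr_ge0 ?divr_ge0 ?nrm_ge0.
have dw j : (j <= k)%N -> nrm (fun t => pull (x ^+ j)%g w t - w t) <= d.
  move=> jk; apply: le_trans (dv _ jk).
  rewrite -[leRHS](nrm_pull (z ^+ k)%g) le_eqVlt; apply/orP; left; apply/eqP.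
  congr nrm; apply/funext => t; rewrite /w /pull -!permM.
  by congr (v (fun_of_perm _ _) - _); exact: commuteX2.
have off b : (0 < b < M)%N -> `|dot u (pull (y ^+ b)%g u)| <= 4 * d * nrm f.
  move=> bM.
  (* The four terms are grouped into two differences to which [dot_translate] applies; [w] is as
     invariant under [x] as [v], because [z] is central. *)
  have -> : dot u (pull (y ^+ b)%g u) =
      (dot v (pull (y ^+ b)%g v) - dot v (pull (y ^+ b * z ^+ k)%g v)) -
      (dot w (pull (y ^+ b)%g v) - dot w (pull (y ^+ b * z ^+ k)%g v)).
    have -> : pull (y ^+ b)%g u =
      (fun t => pull (y ^+ b)%g v t - pull (y ^+ b * z ^+ k)%g v t).
      by apply/funext => t; rewrite /u /w /pull permM.
    by rewrite /u dotBl !dotBr.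
  apply: le_trans (ler_normB _ _) _.
  have -> : 4 * d * nrm f = 2 * d * nrm f + 2 * d * nrm f by ring.
  by apply: lerD; apply: dot_translate.
have d0 : 0 <= 4 * d * nrm f.
  by rewrite !mulr_ge0 ?divr_ge0 ?nrm_ge0.
have all b b' : (b < M)%N -> (b' < M)%N ->
   dot (pull (y ^+ b)%g u) (pull (y ^+ b')%g u) <=
   (b == b')%:R * (4 * dot f f) + 4 * d * nrm f.
  wlog bb' : b b' / (b <= b')%N => [H|] bM b'M.
    have [bb'|/ltnW bb'] := leqP b b'; first exact: H.
    by rewrite dotC eq_sym H.
  have -> : dot (pull (y ^+ b)%g u) (pull (y ^+ b')%g u) = dot u (pull (y ^+ (b' - b))%g u).
    by rewrite -(dot_pull (y ^+ b)%g u) pullM -expgnDr subnKC.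
  have [->|nbb'] := eqVneq b b'.
    rewrite mul1r subnn expg0.
    have -> : pull 1%g u = u by apply/funext => t; rewrite /pull perm1.
    apply: (@le_trans _ _ (4 * dot f f)); last by rewrite lerDl.
    rewrite -!nrm_sqr -[4](_ : 2 ^+ 2 = 4); last by rewrite expr2; lra.
    by rewrite -exprMn lerXn2r// nnegrE ?nrm_ge0// mulr_ge0 ?nrm_ge0.
  rewrite mul0r add0r; apply: le_trans (ler_norm _) _; apply: off.
  by rewrite subn_gt0 ltn_neqAle nbb' bb'/= (leq_ltn_trans _ b'M)// leq_subr.
rewrite opE /avg dotZl dotC dotZl.
rewrite (dot_suml _ (fun b => pull (y ^+ b)%g u)).
have M0' : 0 < M%:R :> R by rewrite ltr0n.
rewrite mulrA -invfM ler_pdivrMl ?mulr_gt0//.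
apply: (@le_trans _ _ (\sum_(b < M) \sum_(b' < M) ((b == b' :> nat)%:R * (4 * dot f f) + 4 * d * nrm f))).
  apply: ler_sum => b _; rewrite (dot_sumr _ (fun b => pull (y ^+ b)%g u)).
  by apply: ler_sum => b' _; exact: all.
have -> : \sum_(b < M) \sum_(b' < M) ((b == b' :> nat)%:R * (4 * dot f f) + 4 * d * nrm f)
   = M%:R * (4 * dot f f) + M%:R * (M%:R * (4 * d * nrm f)).
  under eq_bigr => b _.
    rewrite big_split/= sumr_const card_ord (bigD1 b)//= big1 ?addr0 => [|i ib]; last first.
      by rewrite (_ : (b == i :> nat) = false) ?mul0r//; apply/negbTE; rewrite eq_sym.
    rewrite eqxx mul1r.
    over.
  by rewrite sumr_const card_ord -mulrDr !(mulr_natl _ M).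
rewrite le_eqVlt; apply/orP; left; apply/eqP; rewrite /d -[dot f f]nrm_sqr.
have N0' : N%:R != 0 :> R by rewrite pnatr_eq0 -lt0n.
field; do ?[apply/andP; split] => //; rewrite ?gt_eqF//.
Qed.

(** The squared norm of [heis_adj f] is at most [nrm f] times the norm of [heis_op (heis_adj f)];
    dividing by [nrm (heis_adj f)] requires the zero case to be split off. *)
Lemma heis_adj_l2 f :
  dot (heis_adj f) (heis_adj f) <= (4 / M%:R + 8 * k%:R / N%:R) * dot f f.
Proof.
set A := _ + _; have A0 : 0 <= A by rewrite addr_ge0// divr_ge0// mulr_ge0.
rewrite -[A]sqr_sqrtr// -!nrm_sqr -exprMn; set S := Num.sqrt A.
have S0 : 0 <= S := sqrtr_ge0 _.
have opS : nrm (heis_op (heis_adj f)) <= S * nrm (heis_adj f).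
  rewrite -(@ler_pXn2r _ 2) ?nnegrE ?nrm_ge0 ?mulr_ge0 ?nrm_ge0//.
  by rewrite exprMn !nrm_sqr sqr_sqrtr// heis_op_l2.
rewrite lerXn2r ?nnegrE ?nrm_ge0 ?mulr_ge0 ?nrm_ge0//.
have [->|n0] := eqVneq (nrm (heis_adj f)) 0; first by rewrite mulr_ge0 ?nrm_ge0.
have np : 0 < nrm (heis_adj f) by rewrite lt_neqAle eq_sym n0 nrm_ge0.
rewrite -(ler_pM2r np) -expr2 nrm_sqr -heis_adjE.
apply: le_trans (ler_norm _) _; apply: le_trans (dot_le _ _) _.
by rewrite mulrAC ler_wpM2r ?nrm_ge0.
Qed.

End HeisenbergL2.

(** * Interpolation *)

Section Interpolation.
Context {R : realType}.

Lemma sqr_powR (a q : R) : 0 < q -> `|a| `^ (q + 2) = a ^+ 2 * `|a| `^ q.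
Proof.
move=> q0; have [->|a0] := eqVneq a 0.
  by rewrite normr0 powR0 ?expr0n ?mul0r// gt_eqF// addr_gt0.
rewrite powRD; last by rewrite (gt_eqF (addr_gt0 q0 _)).
by rewrite mulrC powR_mulrn// real_normK// num_real.
Qed.

(** The terms below [B] are an initial segment of a geometric progression, dominated by its last
    term. *)
Lemma geometric_sum_le (s r B : R) K : 0 <= s -> 1 < r -> 0 <= B ->
  \sum_(k < K) (if s * r ^+ k <= B then s * r ^+ k else 0) <= B * (r / (r - 1)).
Proof.
move=> s0 r1 B0; have r10 : 0 < r - 1 by rewrite subr_gt0.
have r0 : 0 < r by apply: lt_trans r1.
elim: K => [|K ih]; first by rewrite big_ord0 mulr_ge0// divr_ge0// ltW.
have [sB|sB] := boolP (s * r ^+ K <= B); last first.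
  by rewrite big_ord_recr/= (negbTE sB) addr0.
apply: (@le_trans _ _ (\sum_(k < K.+1) s * r ^+ k)).
  apply: ler_sum => k _; case: ifP => // _.
  by rewrite mulr_ge0// exprn_ge0// ltW.
rewrite -mulr_sumr mulrA ler_pdivlMr// -mulrA [X in s * X]mulrC -subrX1.
rewrite mulrBr mulr1 exprSr mulrA lerBlDr.
by apply: (@le_trans _ _ (B * r)); [rewrite ler_wpM2r// ltW|rewrite lerDl].
Qed.

Lemma dyadic_level (m a : R) K : 0 < m -> m <= a -> a < m * 2 ^+ K ->
  exists k : 'I_K, m * 2 ^+ k <= a < m * 2 ^+ k.+1.
Proof.
move=> m0 ma; elim: K => [|K ih] aK.
  by move: aK; rewrite expr0 mulr1 ltNge ma.
have [/ih[k kP]|Ka] := ltP a (m * 2 ^+ K).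
  by exists (widen_ord (leqnSn K) k).
by exists ord_max => /=; rewrite Ka.
Qed.

(** Finiteness of [T] confines the nonzero values to finitely many dyadic levels, so that the level
    decomposition is a finite sum. *)
Lemma dyadic_range (T : finType) (g : T -> R) : exists (m : R) (K : nat),
  0 < m /\ forall t, g t != 0 -> m <= `|g t| < m * 2 ^+ K.
Proof.
pose m := \big[Num.min/1]_(t | g t != 0) `|g t|.
have m0 : 0 < m by apply: lt_bigmin => // t gt; rewrite normr_gt0.
pose S := (\sum_t `|g t|) / m.
have S0 : 0 <= S by rewrite divr_ge0 ?sumr_ge0// ltW.
exists m, (Num.truncn S).+1; split=> // t gt.
rewrite [m <= _]bigmin_le_cond//= -ltr_pdivrMl//.
apply: (@le_lt_trans _ _ S).
  rewrite /S mulrC ler_wpM2r ?invr_ge0 ?(ltW m0)//.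
  by rewrite (bigD1 t)//= lerDl sumr_ge0.
apply: lt_trans (truncnS_gt S) _.
by rewrite -natrX ltr_nat ltn_expl.
Qed.

(** The [4] comes from halving [|op f t|] before squaring, [8 ^ q] from the threshold
    [m 2^k < 4 |f t|] compared with the upper end [m 2^(k+1)] of the level, and the quotient is the
    sum of the geometric series of ratio [2 ^ (- q)]. *)
Definition marcinkiewicz_cst (q : R) := 4 * 8 `^ q * (2 `^ q / (2 `^ q - 1)).

Lemma powR2_gt1 (q : R) : 0 < q -> 1 < 2 `^ q :> R.
Proof.
move=> q0; suff : 1 `^ q < 2 `^ q :> R by rewrite powR1.
by rewrite gt0_ltr_powR ?nnegrE// ltr1n.
Qed.

Lemma marcinkiewicz_cst_gt0 q : 0 < q -> 0 < marcinkiewicz_cst q.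
Proof.
move=> q0; rewrite !mulr_gt0 ?invr_gt0 ?powR_gt0// subr_gt0; exact: powR2_gt1.
Qed.

(* The operator is controlled at level [m 2^k] by its l2 norm on the part of
   [f] exceeding [m 2^k / 4]. *)
Lemma marcinkiewicz (T : finType) (op : (T -> R) -> T -> R) (A q : R) f :
  0 < q -> 0 <= A ->
  (forall f g t, op (fun t => f t - g t) t = op f t - op g t) ->
  (forall f, dot (op f) (op f) <= A * dot f f) ->
  (forall f (c : R), (forall t, `|f t| <= c) -> forall t, `|op f t| <= 2 * c) ->
  \sum_t `|op f t| `^ (q + 2) <= marcinkiewicz_cst q * A * \sum_t `|f t| `^ (q + 2).
Proof.
move=> q0 A0 opB op2 opoo.
have [m [K [m0 mK]]] := dyadic_range (op f).
pose fk k t := if m * 2 ^+ k < 4 * `|f t| then f t else 0.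
pose w k := (2 * m) `^ q * (2 `^ q) ^+ k.
have wE k : w k = (m * 2 ^+ k.+1) `^ q.
  rewrite /w -powR_mulrn ?powR_ge0// -powRrM mulrC [q * _]mulrC powRrM.
  rewrite powR_mulrn// -powRM ?exprn_ge0 ?mulr_ge0 ?(ltW m0)//.
  by congr (_ `^ _); rewrite exprS; ring.
have w0 k : 0 <= w k by rewrite wE powR_ge0.
have step1 t : `|op f t| `^ (q + 2) <= \sum_(k < K) w k * (4 * (op (fk k) t * op (fk k) t)).
  have nn k : 0 <= w k * (4 * (op (fk k) t * op (fk k) t)).
    by rewrite mulr_ge0// mulr_ge0// -expr2 sqr_ge0.
  have [z|z] := eqVneq (op f t) 0.
    by rewrite z normr0 powR0 ?sumr_ge0// gt_eqF// addr_gt0.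
  have /andP[m1 m2] := mK _ z.
  have [k /andP[k1 k2]] := dyadic_level m0 m1 m2.
  rewrite (bigD1 k)//=; apply: ler_wpDr; first exact: sumr_ge0.
  rewrite sqr_powR// mulrC; apply: ler_pM; rewrite ?powR_ge0 ?sqr_ge0//.
    by rewrite wE ge0_ler_powR ?nnegrE ?(ltW q0) ?(ltW k2)// ?mulr_ge0 ?exprn_ge0 ?(ltW m0).
  (* The discarded part of [f] is at most [m 2^k / 4] everywhere; the sup bound [2] lets it
     contribute at most half of [|op f t|]. *)
  have low : `|op f t - op (fk k) t| <= `|op f t| / 2.
    rewrite -opB; apply: le_trans (_ : 2 * (m * 2 ^+ k / 4) <= _); last first.
      by rewrite mulrA mulrC; move: k1; set X := m * _; lra.
    apply: opoo => u; rewrite /fk; case: ifPn; first by rewrite subrr normr0 divr_ge0 ?mulr_ge0 ?exprn_ge0 ?(ltW m0).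
    by rewrite -leNgt subr0; set X := m * _; lra.
  have half : `|op f t| / 2 <= `|op (fk k) t|.
    by move: low; have := ler_normD (op f t - op (fk k) t) (op (fk k) t); rewrite subrK; lra.
  rewrite -expr2 -(real_normK (num_real (op f t))) -(real_normK (num_real (op (fk k) t))).
  have := @lerXn2r _ 2 (`|op f t| / 2) (`|op (fk k) t|); rewrite !nnegrE divr_ge0// normr_ge0.
  by move/(_ isT isT half); rewrite expr_div_n; lra.
apply: le_trans (ler_sum _ (fun t _ => step1 t)) _.
rewrite exchange_big/=.
(* The l_2 bound enters linearly, so the smallness of [A] survives the interpolation. *)
apply: (@le_trans _ _ (\sum_(k < K) w k * (4 * (A * dot (fk k) (fk k))))).
  apply: ler_sum => k _; rewrite -!mulr_sumr ler_wpM2l// ler_wpM2l//; exact: op2.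
have -> : \sum_(k < K) w k * (4 * (A * dot (fk k) (fk k))) =
   \sum_t (4 * A * (f t ^+ 2 * \sum_(k < K) (if m * 2 ^+ k < 4 * `|f t| then w k else 0))).
  under [RHS]eq_bigr do rewrite !mulr_sumr.
  rewrite [RHS]exchange_big/=; apply: eq_bigr => k _.
  rewrite /dot !mulr_sumr; apply: eq_bigr => t _; rewrite /fk.
  by case: ifP => _; ring.
rewrite [leRHS]mulr_sumr; apply: ler_sum => t _.
rewrite sqr_powR//; set S := \sum_(k < K) _; set C := marcinkiewicz_cst q.
have -> : 4 * A * (f t ^+ 2 * S) = A * f t ^+ 2 * (4 * S) by ring.
have -> : C * A * (f t ^+ 2 * `|f t| `^ q) = A * f t ^+ 2 * (C * `|f t| `^ q) by ring.
apply: ler_wpM2l; first by rewrite mulr_ge0// sqr_ge0.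
rewrite /C /marcinkiewicz_cst -!mulrA ler_wpM2l// {}/S.
apply: le_trans (_ : (8 * `|f t|) `^ q * (2 `^ q / (2 `^ q - 1)) <= _); last first.
  by rewrite powRM// le_eqVlt; apply/orP; left; apply/eqP; ring.
apply: le_trans (geometric_sum_le K (powR_ge0 (2 * m) q) (powR2_gt1 q0) (powR_ge0 (8 * `|f t|) q)).
apply: ler_sum => k _; rewrite -/(w k); case: ifP => [c|_]; last by case: ifP.
rewrite ifT// wE ge0_ler_powR ?nnegrE ?(ltW q0)// ?mulr_ge0 ?exprn_ge0 ?(ltW m0)//.
by rewrite exprS mulrCA; move: c; set X := m * _; lra.
Qed.

(** Pair [op f] with [g = sg (op f) |op f|^(p-1)], move the operator to [adj g], and apply Young's
    inequality pointwise with weights [e] and [e^-1]; the resulting term [S / p'] is absorbed by the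
    left-hand side. *)
Lemma adjoint_powR_bound (T : finType) (op adj : (T -> R) -> T -> R) (p e : R) :
  1 < p -> 0 < e ->
  (forall f g, dot (op f) g = dot f (adj g)) ->
  (forall g, \sum_t `|adj g t| `^ (p / (p - 1)) <=
     e `^ (p / (p - 1)) * \sum_t `|g t| `^ (p / (p - 1))) ->
  forall f, \sum_t `|op f t| `^ p <= e `^ p * \sum_t `|f t| `^ p.
Proof.
move=> p1 e0 opadj H f; set p' := p / (p - 1) in H.
have p10 : 0 < p - 1 by rewrite subr_gt0.
have p0 : 0 < p by apply: lt_trans p1.
have p'0 : 0 < p' by rewrite divr_gt0.
have conj : p^-1 + p'^-1 = 1.
  by rewrite /p' invf_div; field; rewrite gt_eqF// gt_eqF.
pose g t := Num.sg (op f t) * `|op f t| `^ (p - 1).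
have gp t : `|g t| `^ p' = `|op f t| `^ p.
  have [z|z] := eqVneq (op f t) 0.
    by rewrite /g z sgr0 mul0r normr0 !powR0// gt_eqF.
  rewrite /g normrM normr_sg z mul1r (ger0_norm (powR_ge0 _ _)) -powRrM.
  by rewrite /p' mulrC divfK// gt_eqF.
have gop t : op f t * g t = `|op f t| `^ p.
  have [z|z] := eqVneq (op f t) 0.
    by rewrite z mul0r normr0 powR0// gt_eqF.
  rewrite /g mulrA [op f t * _]mulrC -normrEsg -{1}[`|op f t|]powRr1//.
  have pE : 1 + (p - 1) = p by rewrite addrC subrK.
  rewrite -[in RHS]pE [in RHS]powRD//.
  by rewrite normr_eq0 z implybT.
set S := \sum_t _; set F := \sum_t _.
have SE : S = dot f (adj g).
  by rewrite -opadj; apply: eq_bigr => t _; rewrite gop.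
have Hg : \sum_t `|adj g t| `^ p' <= e `^ p' * S.
  by apply: le_trans (H g) _; under eq_bigr do rewrite gp.
have : S <= e `^ p / p * F + S / p'.
  rewrite [leLHS]SE; apply: (@le_trans _ _ (\sum_t (e `^ p * `|f t| `^ p / p + e^-1 `^ p' * `|adj g t| `^ p' / p'))).
    apply: ler_sum => t _; apply: le_trans (ler_norm _) _.
    rewrite normrM.
    have Y : (e * `|f t|) * (e^-1 * `|adj g t|) <=
        (e * `|f t|) `^ p / p + (e^-1 * `|adj g t|) `^ p' / p'.
      by apply: conjugate_powR; rewrite ?mulr_ge0 ?invr_ge0 ?(ltW e0).
    move: Y; rewrite mulrACA mulfV ?gt_eqF// mul1r.
    by rewrite !powRM ?invr_ge0 ?(ltW e0).
  rewrite big_split/=; apply: lerD.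
    by rewrite -mulr_suml -mulr_sumr mulrAC.
  rewrite -mulr_suml -mulr_sumr ler_wpM2r ?invr_ge0 ?(ltW p'0)//.
  apply: le_trans (ler_wpM2l (powR_ge0 _ _) Hg) _.
  by rewrite mulrA -powRM ?invr_ge0 ?(ltW e0)// mulVf ?powR1 ?mul1r// gt_eqF.
have -> : S / p' = S - S / p.
  by rewrite -{2}[S]mulr1 -conj; ring.
move=> h; have {}h : S / p <= e `^ p / p * F by lra.
by move: h; rewrite mulrAC ler_pM2r ?invr_gt0.
Qed.

(** A polynomial dependence, uniform in the finite action: norm [delta] on l_p is ensured once the
    l_2 bound is below [c * delta ^+ d]. A natural [d] lets the scales be chosen later among powers
    of [2]. *)
Definition heis_bound (p c : R) (d : nat) := forall (delta : R) (T : finType)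
  (x y z : {perm T}) (M N k : nat), 0 < delta -> delta <= 1 ->
  heisenberg x y z -> (forall b, (0 < b < M)%N -> (b %| k)%N) ->
  (0 < M)%N -> (0 < N)%N ->
  4 / M%:R + 8 * k%:R / N%:R <= c * delta ^+ d ->
  forall f,
   \sum_t `|heis_op x y z M N k f t| `^ p <= delta `^ p * \sum_t `|f t| `^ p /\
   \sum_t `|heis_adj x y z M N k f t| `^ p <= delta `^ p * \sum_t `|f t| `^ p.

Lemma avg2_le (M N : nat) (F : nat -> nat -> R) (c : R) :
  0 <= c -> (forall b a, `|F b a| <= c) ->
  `|(M%:R * N%:R)^-1 * \sum_(b < M) \sum_(a < N) F b a| <= c.
Proof.
move=> c0 H; rewrite normrM ger0_norm ?invr_ge0 ?mulr_ge0//.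
case: M => [|M]; first by rewrite mul0r invr0 mul0r.
case: N => [|N]; first by rewrite mulr0 invr0 mul0r.
rewrite ler_pdivrMl ?mulr_gt0//.
apply: le_trans (ler_norm_sum _ _ _) _.
apply: (@le_trans _ _ (\sum_(b < M.+1) \sum_(a < N.+1) c)).
  apply: ler_sum => b _; apply: le_trans (ler_norm_sum _ _ _) _.
  by apply: ler_sum => a _; exact: H.
under eq_bigr do rewrite sumr_const card_ord.
by rewrite sumr_const card_ord -mulrnA mulnC -natrM mulr_natl.
Qed.

(** Interpolation between the l_2 bound and the trivial sup bound [2]. The case [p = 2] is direct,
    because the interpolation constant blows up as [p] tends to [2]. *)
Lemma heis_bound_ge2 p : 2 <= p -> exists c d, 0 < c /\ heis_bound p c d.
Proof.
(* [d] exceeds [p], hence [delta ^+ d] is at most the real power of exponent [p] when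
   [delta <= 1]. *)
move=> p2; pose d := (Num.truncn p).+1.
have key (C : R) : 0 < C ->
   (forall (T : finType) (op : (T -> R) -> T -> R) A, 0 <= A ->
     (forall f g t, op (fun t => f t - g t) t = op f t - op g t) ->
     (forall f, dot (op f) (op f) <= A * dot f f) ->
     (forall f (c : R), (forall t, `|f t| <= c) -> forall t, `|op f t| <= 2 * c) ->
     forall f, \sum_t `|op f t| `^ p <= C * A * \sum_t `|f t| `^ p) ->
   heis_bound p C^-1 d.
  move=> C0 H delta T x y z M N k d0 d1 hs dk M0 N0 le.
  set A := _ + _ in le; have A0 : 0 <= A by rewrite addr_ge0// divr_ge0// mulr_ge0.
  have CA : C * A <= delta `^ p.
    rewrite -ler_pdivlMl//; apply: le_trans le _; rewrite ler_wpM2l ?invr_ge0 ?(ltW C0)//.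
    rewrite -powR_mulrn ?(ltW d0)//; apply: ger_powR; first by rewrite d0.
    by rewrite ltW// /d truncnS_gt.
  move=> f; split.
    apply: (@le_trans _ _ (C * A * \sum_t `|f t| `^ p)); last first.
      by rewrite ler_wpM2r// sumr_ge0// => t _; rewrite powR_ge0.
    apply: H => // [g h t|g|g c gc t].
    - rewrite /heis_op -mulrBr; congr (_ * _); rewrite -sumrB; apply: eq_bigr => b _.
      by rewrite -sumrB; apply: eq_bigr => a _; ring.
    - exact: (heis_op_l2 hs dk M0 N0 g).
    have c0 : 0 <= c by apply: le_trans (gc t).
    apply: (@avg2_le M N (fun b a => g (hword x y z b a 0 t) - g (hword x y z b a k t))); first by rewrite mulr_ge0.
    by move=> b a; apply: le_trans (ler_normB _ _) _; rewrite mulr2n mulrDl mul1r lerD.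
  apply: (@le_trans _ _ (C * A * \sum_t `|f t| `^ p)); last first.
    by rewrite ler_wpM2r// sumr_ge0// => t _; rewrite powR_ge0.
  apply: H => // [g h t|g|g c gc t].
  - rewrite /heis_adj -mulrBr; congr (_ * _); rewrite -sumrB; apply: eq_bigr => b _.
    by rewrite -sumrB; apply: eq_bigr => a _; ring.
  - exact: (heis_adj_l2 hs dk M0 N0 g).
  have c0 : 0 <= c by apply: le_trans (gc t).
  apply: (@avg2_le M N (fun b a => g ((hword x y z b a 0)^-1 t)%g - g ((hword x y z b a k)^-1 t)%g)); first by rewrite mulr_ge0.
  by move=> b a; apply: le_trans (ler_normB _ _) _; rewrite mulr2n mulrDl mul1r lerD.
have [p2E|pn2] := eqVneq p 2.
  exists 1^-1, d; split; first by rewrite invr1.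
  apply: key => // T op A A0 _ op2 _ f; rewrite p2E mul1r.
  have E (h : T -> R) : \sum_t `|h t| `^ 2 = dot h h.
    by apply: eq_bigr => t _; rewrite powR_mulrn// real_normK ?num_real// expr2.
  by rewrite !E.
have q0 : 0 < p - 2 by rewrite subr_gt0 lt_neqAle eq_sym pn2.
exists (marcinkiewicz_cst (p - 2))^-1, d; split.
  by rewrite invr_gt0 marcinkiewicz_cst_gt0.
apply: key; first exact: marcinkiewicz_cst_gt0.
move=> T op A A0 opB op2 opoo f.
by have := marcinkiewicz f q0 A0 opB op2 opoo; rewrite subrK.
Qed.

(** For [p < 2] the conjugate exponent exceeds [2], and duality exchanges the bounds of [heis_op]
    and [heis_adj]. *)
Lemma heis_bound_exists p : 1 < p -> exists c d, 0 < c /\ heis_bound p c d.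
Proof.
move=> p1; have [|p2] := leP 2 p; first exact: heis_bound_ge2.
have p10 : 0 < p - 1 by rewrite subr_gt0.
have [|c [d [c0 H]]] := @heis_bound_ge2 (p / (p - 1)).
  by rewrite ler_pdivlMr//; lra.
exists c, d; split=> // delta T x y z M N k d0 d1 hs dk M0 N0 le f.
have {}H := H _ _ _ _ _ _ _ _ d0 d1 hs dk M0 N0 le; split.
  apply: (@adjoint_powR_bound _ _ (heis_adj x y z M N k)) => // [g h|g].
    exact: heis_adjE.
  by have [] := H g.
apply: (@adjoint_powR_bound _ _ (heis_op x y z M N k)) => // [g h|g].
  by rewrite dotC -heis_adjE dotC.
by have [] := H g.
Qed.

End Interpolation.

(** * Transference to multipliers *)

Section ComplexModulus.
Context {R : realType}.
Implicit Types z w : R[i].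
Local Notation normc := Normc.normc.
Local Notation Re := (@complex.Re R).
Local Notation Im := (@complex.Im R).

Lemma norm_normc z : `|z| = (normc z)%:C%C.
Proof. by case: z. Qed.

Lemma normc_ge0 z : 0 <= normc z.
Proof. by case: z => a b; exact: sqrtr_ge0. Qed.

Lemma ler_normcD z w : normc (z + w) <= normc z + normc w.
Proof. exact: (@le_normcD R z w). Qed.

Lemma normc_opp z : normc (- z) = normc z.
Proof. exact: (@normcN R z). Qed.

Lemma normc_sub z w : normc (z - w) = normc (w - z).
Proof. by rewrite -normc_opp opprB. Qed.

Lemma ler_normcB z w : normc (z - w) <= normc z + normc w.
Proof. by apply: le_trans (ler_normcD _ _) _; rewrite normc_opp. Qed.

Lemma ler_normc_sum (I : Type) (r : seq I) (P : pred I) (F : I -> R[i]) :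
  normc (\sum_(i <- r | P i) F i) <= \sum_(i <- r | P i) normc (F i).
Proof.
elim/big_rec2 : _ => [|i a b _ ih]; first by rewrite Normc.normc0.
by apply: le_trans (ler_normcD _ _) _; rewrite lerD2l.
Qed.

Lemma normc_real (a : R) : normc a%:C%C = `|a|.
Proof. by rewrite /Normc.normc /= expr0n addr0 sqrtr_sqr. Qed.

Lemma normcMl (a : R) z : normc (a%:C%C * z) = `|a| * normc z.
Proof. by rewrite Normc.normcM normc_real. Qed.

Lemma Re_le_normc z : `|Re z| <= normc z.
Proof.
case: z => a b /=; rewrite -sqrtr_sqr ler_wsqrtr// lerDl; exact: sqr_ge0.
Qed.

Lemma Im_le_normc z : `|Im z| <= normc z.
Proof.
case: z => a b /=; rewrite -sqrtr_sqr ler_wsqrtr// lerDr; exact: sqr_ge0.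
Qed.

Lemma normc_le_ReIm z : normc z <= `|Re z| + `|Im z|.
Proof.
case: z => a b /=; rewrite -[leRHS]ger0_norm ?addr_ge0// -sqrtr_sqr ler_wsqrtr//.
rewrite sqrrD !real_normK ?num_real// -addrA lerD2l lerDr.
by rewrite mulrn_wge0// mulr_ge0.
Qed.

Lemma Re_sum (I : Type) (r : seq I) (F : I -> R[i]) :
  Re (\sum_(i <- r) F i) = \sum_(i <- r) Re (F i).
Proof.
elim: r => [|i r ih]; rewrite ?big_nil// !big_cons -ih.
by case: (F i) (\sum_(j <- r) F j) => ? ? [].
Qed.

Lemma Im_sum (I : Type) (r : seq I) (F : I -> R[i]) :
  Im (\sum_(i <- r) F i) = \sum_(i <- r) Im (F i).
Proof.
elim: r => [|i r ih]; rewrite ?big_nil// !big_cons -ih.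
by case: (F i) (\sum_(j <- r) F j) => ? ? [].
Qed.

Lemma Re_realM (a : R) z : Re (a%:C%C * z) = a * Re z.
Proof. by case: z => x y /=; rewrite mul0r subr0. Qed.

Lemma Im_realM (a : R) z : Im (a%:C%C * z) = a * Im z.
Proof. by case: z => x y /=; rewrite mul0r addr0. Qed.

Lemma measurable_normc d (X : measurableType d) (f : X -> R[i]) :
  measurable_funC f -> measurable_fun setT (fun x => normc (f x)).
Proof.
move=> [mR mI].
rewrite (_ : (fun x => _) = (@Num.sqrt R) \o (fun x => Re (f x) ^+ 2 + Im (f x) ^+ 2)); last first.
  by apply/funext => x /=; case: (f x).
apply: measurableT_comp; first exact: (continuous_measurable_fun (@sqrt_continuous R)).
by apply: measurable_funD; exact: measurable_funX.
Qed.

Lemma powR_normc_le z p : 0 <= p ->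
  normc z `^ p <= 2 `^ p * (`|Re z| `^ p + `|Im z| `^ p).
Proof.
move=> p0; set a := `|Re z|; set b := `|Im z|.
apply: (@le_trans _ _ ((2 * Num.max a b) `^ p)).
  rewrite ge0_ler_powR ?nnegrE ?normc_ge0 ?mulr_ge0 ?le_max ?normr_ge0//.
  apply: le_trans (normc_le_ReIm z) _; rewrite mulr2n mulrDl mul1r.
  by rewrite lerD// le_max lexx ?orbT.
rewrite powRM ?le_max ?normr_ge0// ler_wpM2l ?powR_ge0//.
by rewrite /Num.max; case: ifP => _; rewrite ?lerDl ?lerDr powR_ge0.
Qed.

End ComplexModulus.

Section LpIntegral.
Context {R : realType} {d : measure_display} {X : measurableType d}.
Variable mu : {measure set X -> \bar R}.
Implicit Types (p : R) (f : X -> R[i]).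
Local Notation normc := Normc.normc.

Lemma Lp_norm_powR p f : 0 < p ->
  (Lp_norm mu p%:E f `^ p)%E = (\int[mu]_x ((normc (f x)) `^ p)%:E)%E.
Proof.
move=> p0; apply: etrans (poweR_Lnorm mu _ (lt0r_neq0 p0)) _.
by apply: eq_integral => x _; rewrite /= ger0_norm ?normc_ge0.
Qed.

Lemma Lp_norm_ge0 (p : \bar R) f : (0 <= Lp_norm mu p f)%E.
Proof. exact: Lnorm_ge0. Qed.

Lemma powR_le_Lp_norm p f (a : R) : 0 < p -> 0 <= a ->
  (a%:E <= Lp_norm mu p%:E f)%E ->
  ((a `^ p)%:E <= \int[mu]_x ((normc (f x)) `^ p)%:E)%E.
Proof.
move=> p0 a0 h; rewrite -Lp_norm_powR// -poweR_EFin.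
by apply: gt0_ler_poweR => //; rewrite ?(ltW p0)// in_itv/= ?lee_fin ?a0 ?Lp_norm_ge0 ?leey.
Qed.

Lemma Lp_norm_le_powR p f (a : R) : 0 < p -> 0 <= a ->
  (Lp_norm mu p%:E f <= a%:E)%E ->
  (\int[mu]_x ((normc (f x)) `^ p)%:E <= (a `^ p)%:E)%E.
Proof.
move=> p0 a0 h; rewrite -Lp_norm_powR// -poweR_EFin.
by apply: gt0_ler_poweR => //; rewrite ?(ltW p0)// in_itv/= ?lee_fin ?a0 ?Lp_norm_ge0 ?leey.
Qed.

Lemma measurable_powR_normc p f : measurable_funC f ->
  measurable_fun setT (fun x => ((normc (f x)) `^ p)%:E).
Proof.
move=> mf; apply/measurable_EFinP.
apply: (measurableT_comp (measurable_powR p)); exact: measurable_normc.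
Qed.

End LpIntegral.

(** * Extension of scalar l_p bounds to subquotients of L_p, and transference *)

Section SQpOperators.
Context {R : realType}.
Local Notation normc := Normc.normc.

Lemma rnorm_ge0 (E : completeNormedModType R[i]) (x : E) : 0 <= rnorm x.
Proof. by rewrite /rnorm; have := normr_ge0 x; rewrite lecE => /andP[_]. Qed.

(* A matrix acting boundedly on scalar l_p acts boundedly on E-valued l_p:
   lift the vectors to the L_p space of which E is a subquotient and integrate. *)
Lemma SQp_operator_bound (p : R) (E : completeNormedModType R[i])
    (T J : finType) (w : J -> R) (pi : J -> T -> T) (C a : R) (F : {pred T}) (u : T -> E) :
  0 < p -> SQp p E -> 0 <= C -> 0 <= a ->
  (forall f : T -> R, \sum_t `|\sum_j w j * f (pi j t)| `^ p <=
      C * \sum_t `|f t| `^ p) ->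
  (forall t, t \in F -> rnorm (u t) < a) ->
  (forall t, t \notin F -> u t = 0) ->
  \sum_t rnorm (\sum_j (w j)%:C%C *: u (pi j t)) `^ p <=
    2 `^ p * 2 * C * (#|F|%:R * a `^ p).
Proof.
move=> p0 [d [X [mu [S [q [[SLp S0 Slin _] qlin qsurj qnorm]]]]]] C0 a0 HT uF uF'.
have q0 : q (fun=> 0) = 0.
  have := qlin 1 _ _ S0 S0.
  rewrite (_ : (fun x => 1 * 0 + 0) = (fun=> 0)); last by apply/funext => x; rewrite mulr0 addr0.
  by rewrite scale1r => /eqP; rewrite -subr_eq subrr => /eqP.
have /choice[f fP] : forall t, exists f : X -> R[i], [/\ S f, q f = u t &
    (\int[mu]_x ((normc (f x)) `^ p)%:E <= (if t \in F then a `^ p else 0)%:E)%E].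
  move=> t; case: ifPn => [tF|tF]; last first.
    exists (fun=> 0); split=> //; first by rewrite q0 uF'.
    under eq_integral do rewrite Normc.normc0 powR0 ?gt_eqF//.
    by rewrite integral0.
  (* The quotient norm need not be attained; the strict bound on [rnorm (u t)] leaves room for a
     lift of seminorm below [a]. *)
  have /ereal_inf_lt[_ [f [Sf fu] <-] fa] : (ereal_inf [set Lp_norm mu p%:E f |
      f in [set f | S f /\ q f = u t]] < a%:E)%E.
    by rewrite -qnorm lte_fin uF.
  by exists f; split=> //; apply: Lp_norm_le_powR => //; exact: ltW.
pose g t : X -> R[i] := fun x => \sum_j (w j)%:C%C * f (pi j t) x.
have gP t : S (g t) /\ q (g t) = \sum_j (w j)%:C%C *: u (pi j t).
  rewrite /g; elim: (index_enum J) => [|j r [ih1 ih2]].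
    rewrite big_nil (_ : (fun x => _) = (fun=> 0)); last by apply/funext => x; rewrite big_nil.
    by rewrite q0.
  rewrite big_cons (_ : (fun x => _) = (fun x => (w j)%:C%C * f (pi j t) x +
      \sum_(j <- r) (w j)%:C%C * f (pi j t) x)); last by apply/funext => x; rewrite big_cons.
  have [Sf fu _] := fP (pi j t); split; first exact: Slin.
  by rewrite qlin// ih2 fu.
have mf t : measurable_funC (f t) by have [/SLp[]] := fP t.
have mg t : measurable_funC (g t) by have [/SLp[]] := gP t.
have step t : ((rnorm (\sum_j (w j)%:C%C *: u (pi j t)) `^ p)%:E <=
    \int[mu]_x ((normc (g t x)) `^ p)%:E)%E.
  apply: powR_le_Lp_norm => //; first exact: rnorm_ge0.
  by rewrite qnorm; apply: ereal_inf_lbound; exists (g t) => //; have [] := gP t.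
rewrite -lee_fin -sumEFin.
apply: le_trans (lee_sum _ (fun t _ => step t)) _.
rewrite -ge0_integral_sum//; last by move=> t x _; rewrite lee_fin powR_ge0.
  2: by move=> t; exact: measurable_powR_normc.
apply: (@le_trans _ _ (\int[mu]_x ((2 `^ p * 2 * C)%:E * \sum_t ((normc (f t x)) `^ p)%:E))%E).
  apply: ge0_le_integral => //.
  - by move=> x _; apply: sume_ge0 => t _; rewrite lee_fin powR_ge0.
  - by apply: emeasurable_sum => t; exact: measurable_powR_normc.
  - apply: measurable_funeM; apply: emeasurable_sum => t; exact: measurable_powR_normc.
  move=> x _; rewrite !sumEFin -EFinM lee_fin.
  (* The scalar bound concerns real functions; it is applied to the real and imaginary parts, at the
     cost [2 ^ p * 2]. *)
  apply: (@le_trans _ _ (\sum_t 2 `^ p * (`|complex.Re (g t x)| `^ p + `|complex.Im (g t x)| `^ p))).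
    by apply: ler_sum => t _; apply: powR_normc_le; exact: ltW.
  rewrite -mulr_sumr -!mulrA ler_wpM2l ?powR_ge0// big_split/= mulr2n mulrDl mul1r.
  apply: lerD.
    apply: (@le_trans _ _ (C * \sum_t `|complex.Re (f t x)| `^ p)).
      apply: le_trans (HT _); apply: ler_sum => t _.
      by rewrite /g Re_sum; under eq_bigr do rewrite Re_realM.
    rewrite ler_wpM2l//; apply: ler_sum => t _.
    by rewrite ge0_ler_powR ?nnegrE ?normc_ge0 ?(ltW p0)// Re_le_normc.
  apply: (@le_trans _ _ (C * \sum_t `|complex.Im (f t x)| `^ p)).
    apply: le_trans (HT _); apply: ler_sum => t _.
    by rewrite /g Im_sum; under eq_bigr do rewrite Im_realM.
  rewrite ler_wpM2l//; apply: ler_sum => t _.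
  by rewrite ge0_ler_powR ?nnegrE ?normc_ge0 ?(ltW p0)// Im_le_normc.
rewrite ge0_integralZl//; last 3 first.
- by apply: emeasurable_sum => t; exact: measurable_powR_normc.
- by move=> x _; apply: sume_ge0 => t _; rewrite lee_fin powR_ge0.
- by rewrite lee_fin !mulr_ge0 ?powR_ge0.
rewrite [leRHS]EFinM; apply: lee_wpmul2l; first by rewrite lee_fin !mulr_ge0 ?powR_ge0.
rewrite ge0_integral_sum//; last by move=> t x _; rewrite lee_fin powR_ge0.
  2: by move=> t; exact: measurable_powR_normc.
apply: (@le_trans _ _ (\sum_t (if t \in F then a `^ p else 0)%:E)%E).
  by apply: lee_sum => t _; have [] := fP t.
by rewrite sumEFin lee_fin -big_mkcond/= sumr_const mulr_natl.
Qed.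

End SQpOperators.

Section Transference.
Context {R : realType} {G : lcGroupType}.
Local Notation normc := Normc.normc.
Implicit Types (p : R) (phi : G -> R[i]).

(** A representation with explicit real bounds. The one on [alpha] is strict so that its values lift
    to functions of L_p seminorm below [A]. *)
Definition mult_bound p phi (A B : R) := exists (E : completeNormedModType R[i])
  (alpha : G -> E) (beta : G -> {linear E -> R[i]^o}),
  [/\ Mpcb_rep p phi alpha beta, 0 <= B, (forall t, rnorm (alpha t) < A) &
      (forall s x, normc (beta s x) <= B * rnorm x)].

(** Turns control of a mean of [p]-th powers into control of the mean itself, without Hölder's
    inequality; it is summed over [F] with [D = delta * A]. *)
Lemma le_add_powR (a D p : R) : 0 <= a -> 0 < D -> 1 < p ->
  a <= D + a `^ p / D `^ (p - 1).
Proof.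
move=> a0 D0 p1; have [aD|Da] := leP a D.
  by apply: le_trans aD _; rewrite lerDl divr_ge0 ?powR_ge0.
have a1 : 0 < a by apply: lt_trans D0 Da.
apply: (@le_trans _ _ (a `^ p / D `^ (p - 1))); last by rewrite lerDr ltW.
rewrite ler_pdivlMr ?powR_gt0//.
have -> : a `^ p = a * a `^ (p - 1).
  rewrite -{2}[a]powRr1 ?(ltW a1)// -powRD; last by rewrite (gt_eqF a1) implybT.
  by rewrite addrC subrK.
rewrite ler_wpM2l ?(ltW a1)// ge0_ler_powR ?nnegrE ?(ltW D0) ?(ltW Da) ?(ltW a1)//.
by rewrite subr_ge0 ltW.
Qed.

(** [27] is the allowed ratio between the sizes of [F'] and [F], [2 ^ p * 2] the cost of complex
    scalars, and [1] stands for the term [D] of [le_add_powR]. *)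
Definition transference_cst p : R := 1 + 2 `^ p * 2 * 27.

(* [rho] maps an orbit piece [F] of the permutations into [G] so that
   [phi (g h_j g')] is a matrix coefficient between the points [rho s], [s] in [F]. *)
Lemma transference p phi (A B delta : R) (T J : finType) (w : J -> R) (h : J -> G)
    (pi : J -> T -> T) (rho : T -> G) (F F' : {set T}) (g g' : G) :
  1 < p -> mult_bound p phi A B -> 0 < delta ->
  (0 < #|F|)%N -> (#|F'| <= 27 * #|F|)%N ->
  (forall j t, t \in F -> rho (pi j t) = ((h j)^-1 * rho t)%g /\ pi j t \in F') ->
  (forall f : T -> R, \sum_t `|\sum_j w j * f (pi j t)| `^ p <=
      delta `^ p * \sum_t `|f t| `^ p) ->
  normc (\sum_j (w j)%:C%C * phi (g * h j * g')%g) <=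
    transference_cst p * delta * A * B.
Proof.
move=> p1 [E [alpha [beta [[Esq _ _ rep] B0 aA bB]]]] d0 F0 FF' hrho HT.
have p0 : 0 < p by apply: lt_trans p1.
have A0 : 0 < A by apply: le_lt_trans (aA 1%g); exact: rnorm_ge0.
pose u t : E := if t \in F' then alpha (g'^-1 * rho t)%g else 0.
pose v t := \sum_j (w j)%:C%C *: u (pi j t).
(* [phi (g h_j g')] is the coefficient between [g rho(s)] and [g'^-1 h_j^-1 rho(s)], where [rho(s)]
   cancels. The left-hand side is therefore independent of [s] and can be averaged over [F]. *)
have vE s : s \in F -> \sum_j (w j)%:C%C * phi (g * h j * g')%g = beta (g * rho s)%g (v s).
  move=> sF; rewrite /v linear_sum; apply: eq_bigr => j _.
  have [rj Fj] := hrho j s sF.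
  rewrite linearZ /u Fj rj -rep; congr (_ * phi _).
  by rewrite !invgM !invgK !mulgA mulgK.
set D := delta * A; have D0 : 0 < D by rewrite mulr_gt0.
have Hv : \sum_t rnorm (v t) `^ p <= 2 `^ p * 2 * delta `^ p * (#|F'|%:R * A `^ p).
  apply: SQp_operator_bound => //; rewrite ?powR_ge0 ?(ltW A0)//.
    by move=> t tF; rewrite /u tF.
  by move=> t /negbTE tF; rewrite /u tF.
set S := \sum_j _.
have F0' : 0 < #|F|%:R :> R by rewrite ltr0n.
rewrite -(ler_pM2l F0').
apply: (@le_trans _ _ (\sum_(s in F) B * (D + rnorm (v s) `^ p / D `^ (p - 1)))).
  rewrite mulr_natl -sumr_const; apply: ler_sum => s sF.
  rewrite /S (vE _ sF); apply: le_trans (bB _ _) _.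
  by rewrite ler_wpM2l// le_add_powR// rnorm_ge0.
rewrite -mulr_sumr big_split/= sumr_const -mulr_suml -[D *+ _]mulr_natl.
apply: (@le_trans _ _ (B * (#|F|%:R * D + 2 `^ p * 2 * delta `^ p * (27 * #|F|%:R * A `^ p) / D `^ (p - 1)))).
  rewrite ler_wpM2l// lerD2l ler_wpM2r ?invr_ge0 ?powR_ge0//.
  apply: (@le_trans _ _ (\sum_t rnorm (v t) `^ p)).
    by rewrite big_mkcond/=; apply: ler_sum => t _; case: ifP => // _; rewrite powR_ge0.
  apply: le_trans Hv _; rewrite ler_wpM2l ?mulr_ge0 ?powR_ge0//.
  by rewrite ler_wpM2r ?powR_ge0// -natrM ler_nat.
have DE : delta `^ p * A `^ p = D * D `^ (p - 1).
  rewrite -powRM ?(ltW d0) ?(ltW A0)// -/D -[X in X * _]powRr1 ?(ltW D0)// -powRD.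
    by rewrite addrC subrK.
  by rewrite (gt_eqF D0) implybT.
have -> : 2 `^ p * 2 * delta `^ p * (27 * #|F|%:R * A `^ p) / D `^ (p - 1) =
    2 `^ p * 2 * 27 * #|F|%:R * (delta `^ p * A `^ p) / D `^ (p - 1) by ring.
rewrite DE le_eqVlt; apply/orP; left; apply/eqP.
rewrite /transference_cst /D; field.
by rewrite gt_eqF ?powR_gt0.
Qed.
End Transference.

(* Left translations of the discrete Heisenberg group, wrapped modulo [n]. *)
Section HeisenbergModel.
Variable n' : nat.
Local Notation n := n'.+2.
Local Notation T := ('Z_n * 'Z_n * 'Z_n)%type.

Definition modelX (t : T) : T := (t.1.1, t.1.2 + 1, t.2 + t.1.1).
Definition modelY (t : T) : T := (t.1.1 + 1, t.1.2, t.2).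
Definition modelZ (t : T) : T := (t.1.1, t.1.2, t.2 + 1).

Lemma modelX_inj : injective modelX.
Proof.
apply: (can_inj (g := fun t : T => (t.1.1, t.1.2 - 1, t.2 - t.1.1))).
by move=> [[b a] c]; rewrite /modelX /= !addrK.
Qed.

Lemma modelY_inj : injective modelY.
Proof.
apply: (can_inj (g := fun t : T => (t.1.1 - 1, t.1.2, t.2))).
by move=> [[b a] c]; rewrite /modelY /= !addrK.
Qed.

Lemma modelZ_inj : injective modelZ.
Proof.
apply: (can_inj (g := fun t : T => (t.1.1, t.1.2, t.2 - 1))).
by move=> [[b a] c]; rewrite /modelZ /= !addrK.
Qed.

(** Permutations compose from left to right, so left translations reverse products; their inverses
    satisfy the relations in the order of [heisenberg]. It is thus the inverse of a word that acts
    as a left translation. *)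
Definition wrapX := (perm modelX_inj)^-1%g.
Definition wrapY := (perm modelY_inj)^-1%g.
Definition wrapZ := (perm modelZ_inj)^-1%g.

Lemma wrap_heisenberg : heisenberg wrapX wrapY wrapZ.
Proof.
split; apply: invg_inj; rewrite !invgM !invgK ?mulgA; apply/permP => -[[b a] c];
  rewrite !permM !permE /modelX /modelY /modelZ //=.
- by rewrite addrAC -addrA.
- by rewrite addrAC.
Qed.

Lemma hword_perm b a c (t : T) :
  ((hword wrapX wrapY wrapZ b a c)^-1%g) t =
  (t.1.1 + b%:R, t.1.2 + a%:R, t.2 + c%:R + a%:R * t.1.1).
Proof.
have X m u : ((wrapX ^+ m)^-1)%g u = (u.1.1, u.1.2 + m%:R, u.2 + m%:R * u.1.1).
  rewrite /wrapX expVgn invgK; elim: m => [|m ih].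
    by rewrite expg0 perm1 mul0r !addr0; case: u => [[]].
  by rewrite expgSr permM ih permE /modelX /= -natr1 mulrDl mul1r !addrA.
have Y m u : ((wrapY ^+ m)^-1)%g u = (u.1.1 + m%:R, u.1.2, u.2).
  rewrite /wrapY expVgn invgK; elim: m => [|m ih].
    by rewrite expg0 perm1 !addr0; case: u => [[]].
  by rewrite expgSr permM ih permE /modelY /= -natr1 !addrA.
have Z m u : ((wrapZ ^+ m)^-1)%g u = (u.1.1, u.1.2, u.2 + m%:R).
  rewrite /wrapZ expVgn invgK; elim: m => [|m ih].
    by rewrite expg0 perm1 !addr0; case: u => [[]].
  by rewrite expgSr permM ih permE /modelZ /= -natr1 !addrA.
by rewrite /hword !invgM !permM Z X Y.
Qed.

End HeisenbergModel.

Lemma card_ord_interval n lo hi : (hi <= n)%N ->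
  #|[set i : 'I_n | (lo <= i < hi)%N]%SET| = (hi - lo)%N.
Proof.
move=> hn; rewrite -sum1_card.
rewrite (eq_bigl (fun i : 'I_n => (xpredT i && (i < hi)%N) && (lo <= i)%N)); last first.
  by move=> i; rewrite finset.inE /= andbC.
rewrite -(big_geq_mkord lo n (fun i => xpredT i && (i < hi)%N) (fun=> 1%N)).
by rewrite -big_nat_widen// sum_nat_const_nat muln1.
Qed.

(** [K] bounds the displacement of the central coordinate: at most [k], plus the twist [a * tb] with
    [a < N] and [tb < 2 * M]. A point of the middle box therefore moves inside the large box without
    wrapping around. *)
Lemma box_add (M N K k n b a c tb ta tc : nat) :
  n = (3 * (M + N + K))%N -> K = (k + N * (2 * M))%N ->
  (b < M)%N -> (a < N)%N -> (c <= k)%N ->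
  (1 * M <= tb < 2 * M)%N -> (1 * N <= ta < 2 * N)%N -> (1 * K <= tc < 2 * K)%N ->
  [/\ (tb + b < n.+2)%N, (ta + a < n.+2)%N, (tc + (c + a * tb) < n.+2)%N &
    [&& 0 * M <= tb + b < 3 * M, 0 * N <= ta + a < 3 * N
      & 0 * K <= tc + (c + a * tb) < 3 * K]%N].
Proof.
move=> -> KE bM aN ck b12 a12 c12.
have : (a * tb <= N * (2 * M))%N by apply: leq_mul; lia.
move: (a * tb)%N (N * (2 * M))%N KE => u v KE uv.
split; lia.
Qed.

Lemma box_sub (M N K k n b a c tb ta tc : nat) :
  n = (3 * (M + N + K))%N -> K = (k + N * (2 * M))%N ->
  (b < M)%N -> (a < N)%N -> (c <= k)%N ->
  (1 * M <= tb < 2 * M)%N -> (1 * N <= ta < 2 * N)%N -> (1 * K <= tc < 2 * K)%N ->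
  [/\ (tb < n.+2)%N, (ta < n.+2)%N, (tc < n.+2)%N,
    [&& b <= tb, a <= ta & c + a * (tb - b) <= tc]%N &
    [&& 0 * M <= tb - b < 3 * M, 0 * N <= ta - a < 3 * N
      & 0 * K <= tc - (c + a * (tb - b)) < 3 * K]%N].
Proof.
move=> -> KE bM aN ck b12 a12 c12.
have : (a * (tb - b) <= N * (2 * M))%N by apply: leq_mul; lia.
move: (a * (tb - b))%N (N * (2 * M))%N KE => u v KE uv.
split; lia.
Qed.

Section HeisenbergTransference.
Context {R : realType} {G : lcGroupType}.
Local Notation normc := Normc.normc.
Implicit Types (phi : G -> R[i]) (x y z g : G).

Definition heis_gap phi x y z M N k g g' : R[i] :=
  ((M%:R * N%:R)^-1)%:C%C * \sum_(b < M) \sum_(a < N)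
    (phi (g * hword x y z b a 0 * g')%g - phi (g * hword x y z b a k * g')%g).

(** Inverse words have their factors in the opposite order; reindexed, they give the averages of
    [x ^+ a * y ^+ b]. *)
Definition heis_gapV phi x y z M N k g g' : R[i] :=
  ((M%:R * N%:R)^-1)%:C%C * \sum_(b < M) \sum_(a < N)
    (phi (g * (hword x y z b a 0)^-1 * g')%g - phi (g * (hword x y z b a k)^-1 * g')%g).

Section Model.
Variables (x y z : G) (M N k : nat).
Hypothesis hs : heisenberg x y z.
Hypotheses (M0 : (0 < M)%N) (N0 : (0 < N)%N).

Let K := (k + N * (2 * M))%N.
Let n' := (3 * (M + N + K))%N.
Let T := ('Z_n'.+2 * 'Z_n'.+2 * 'Z_n'.+2)%type.
Let J := ('I_M * 'I_N * bool)%type.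

Let K0 : (0 < K)%N.
Proof. by rewrite addn_gt0 !muln_gt0 N0 M0 orbT. Qed.

Definition model_pt (t : T) : G := hword x y z t.1.1 t.1.2 t.2.

Definition model_box lo hi : {set T} :=
  finset.setX (finset.setX [set b : 'I_n'.+2 | (lo * M <= b < hi * M)%N]
             [set a : 'I_n'.+2 | (lo * N <= a < hi * N)%N])
       [set c : 'I_n'.+2 | (lo * K <= c < hi * K)%N].

Lemma in_model_box lo hi (t : T) : (t \in model_box lo hi) =
  [&& (lo * M <= t.1.1 < hi * M)%N, (lo * N <= t.1.2 < hi * N)%N
    & (lo * K <= t.2 < hi * K)%N].
Proof. by case: t => [[b a] c]; rewrite !finset.in_setX !finset.in_set /= -andbA. Qed.

Lemma card_model_box lo hi : (hi <= 3)%N ->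
  #|model_box lo hi| = ((hi - lo) ^ 3 * (M * N * K))%N.
Proof.
move=> h3.
have le m : (m <= M + N + K)%N -> (hi * m <= n'.+2)%N.
  move=> ml; apply: (@leq_trans n'); last by rewrite /n'; lia.
  by rewrite /n' leq_mul.
rewrite /model_box !cardsX !card_ord_interval -?mulnBl; try by apply: le; lia.
by rewrite !expnS expn0 muln1; ring.
Qed.

Lemma val_model (u : 'Z_n'.+2) (m : nat) : (u + m < n'.+2)%N ->
  nat_of_ord (u + m%:R) = (u + m)%N.
Proof.
move=> um; rewrite -[u in LHS]natr_Zp -natrD val_Zp_nat// modn_small//.
Qed.

Lemma model_pt_hword b a c (t : T) :
  (t.1.1 + b < n'.+2)%N -> (t.1.2 + a < n'.+2)%N ->
  (t.2 + (c + a * t.1.1) < n'.+2)%N ->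
  ((hword (wrapX n') (wrapY n') (wrapZ n') b a c)^-1%g t).1.1 = (t.1.1 + b)%N :> nat /\
  ((hword (wrapX n') (wrapY n') (wrapZ n') b a c)^-1%g t).1.2 = (t.1.2 + a)%N :> nat /\
  ((hword (wrapX n') (wrapY n') (wrapZ n') b a c)^-1%g t).2 = (t.2 + (c + a * t.1.1))%N :> nat.
Proof.
move=> hb ha hc; rewrite hword_perm /=.
split; first exact: val_model.
split; first exact: val_model.
have E : t.2 + c%:R + a%:R * t.1.1 = t.2 + (c + a * t.1.1)%:R :> 'Z_n'.+2.
  by rewrite natrD natrM natr_Zp addrA.
exact: etrans (congr1 (@nat_of_ord _) E) (val_model hc).
Qed.

Lemma model_ptE b a c (t : T) :
  (t.1.1 + b < n'.+2)%N -> (t.1.2 + a < n'.+2)%N ->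
  (t.2 + (c + a * t.1.1) < n'.+2)%N ->
  model_pt ((hword (wrapX n') (wrapY n') (wrapZ n') b a c)^-1%g t) =
  (hword x y z b a c * model_pt t)%g.
Proof.
move=> hb ha hc; have [e1 [e2 e3]] := model_pt_hword hb ha hc.
rewrite /model_pt hwordM// e1 e2 e3; congr (hword _ _ _ _ _ _); [exact: addnC|exact: addnC|].
by rewrite addnCA addnA.
Qed.

Let word (j : J) : {perm T} :=
  hword (wrapX n') (wrapY n') (wrapZ n') j.1.1 j.1.2 (if j.2 then k else 0%N).
Let wordG (j : J) : G := hword x y z j.1.1 j.1.2 (if j.2 then k else 0%N).

Lemma model_adj (j : J) t : t \in model_box 1 2 ->
  model_pt ((word j)^-1%g t) = (((wordG j)^-1)^-1 * model_pt t)%g /\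
  (word j)^-1%g t \in model_box 0 3.
Proof.
case: j => [[b a] e]; rewrite /word /wordG /=; set c := if e then k else 0%N.
have ck : (c <= k)%N by rewrite /c; case: ifP.
rewrite in_model_box => /and3P[b12 a12 c12].
have [hb ha hc box] := box_add (erefl n') (erefl K) (ltn_ord b) (ltn_ord a) ck b12 a12 c12.
split; first by rewrite invgK; exact: model_ptE.
by rewrite in_model_box; have [-> [-> ->]] := model_pt_hword hb ha hc.
Qed.

Lemma model_op (j : J) t : t \in model_box 1 2 ->
  model_pt (word j t) = ((wordG j)^-1 * model_pt t)%g /\
  word j t \in model_box 0 3.
Proof.
case: j => [[b a] e]; rewrite /word /wordG /=; set c := if e then k else 0%N.
have ck : (c <= k)%N by rewrite /c; case: ifP.
rewrite in_model_box => /and3P[b12 a12 c12].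
have [bn an cn /and3P[bt at' ct] box] :=
  box_sub (erefl n') (erefl K) (ltn_ord b) (ltn_ord a) ck b12 a12 c12.
set w := hword (wrapX n') _ _ _ _ _; set wG := hword x _ _ _ _ _.
(* The image of [t], found by solving [w^-1 t2 = t] one coordinate after the other; [box_sub]
   ensures that no subtraction is truncated. *)
pose t2 : T := ((t.1.1 - b)%:R, (t.1.2 - a)%:R, (t.2 - (c + a * (t.1.1 - b)))%:R).
have v (m m' : nat) : (m < n'.+2)%N -> nat_of_ord ((m - m')%:R : 'Z_n'.+2) = (m - m')%N.
  by move=> mn; rewrite val_Zp_nat// modn_small// (leq_ltn_trans (leq_subr _ _)).
have v1 : t2.1.1 = (t.1.1 - b)%N :> nat by exact: v.
have v2 : t2.1.2 = (t.1.2 - a)%N :> nat by exact: v.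
have v3 : t2.2 = (t.2 - (c + a * (t.1.1 - b)))%N :> nat by exact: v.
have hb : (t2.1.1 + b < n'.+2)%N by rewrite v1 subnK.
have ha : (t2.1.2 + a < n'.+2)%N by rewrite v2 subnK.
have hc : (t2.2 + (c + a * t2.1.1) < n'.+2)%N by rewrite v3 v1 subnK.
have [e1 [e2 e3]] := model_pt_hword hb ha hc.
have tE : (w^-1)%g t2 = t.
  move: e1 e2 e3; rewrite -/w v1 v2 v3 !subnK//.
  case: ((w^-1)%g t2) => [[u1 u2] u3] /= e1 e2 e3.
  rewrite [t]surjective_pairing [t.1]surjective_pairing.
  by congr (_, _, _); apply/val_inj.
have wt : w t = t2 by rewrite -tE permKV.
rewrite wt; split; last by rewrite in_model_box v1 v2 v3.
by rewrite -[in RHS]tE (model_ptE hb ha hc) mulKg.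
Qed.

Lemma sum_words (V : nmodType) (F : 'I_M -> 'I_N -> bool -> V) :
  \sum_(j : J) F j.1.1 j.1.2 j.2 = \sum_b \sum_a (F b a false + F b a true).
Proof.
rewrite pair_bigA/= (eq_bigr (fun q => \sum_(e : bool) F q.1 q.2 e)); last first.
  by move=> q _; rewrite big_bool addrC.
by rewrite pair_bigA.
Qed.

Lemma heis_gap_le p c d phi A B delta g g' : 1 < p -> @heis_bound R p c d ->
  (forall b, (0 < b < M)%N -> (b %| k)%N) ->
  mult_bound p phi A B -> 0 < delta -> delta <= 1 ->
  4 / M%:R + 8 * k%:R / N%:R <= c * delta ^+ d ->
  normc (heis_gap phi x y z M N k g g') <= transference_cst p * delta * A * B /\
  normc (heis_gapV phi x y z M N k g g') <= transference_cst p * delta * A * B.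
Proof.
move=> p1 HB dk mb d0 d1 small.
have HBT := HB _ _ _ _ _ _ _ _ d0 d1 (wrap_heisenberg n') dk M0 N0 small.
have cF : #|model_box 1 2| = (M * N * K)%N by rewrite card_model_box// mul1n.
have cF' : #|model_box 0 3| = (27 * (M * N * K))%N by rewrite card_model_box.
have F0 : (0 < #|model_box 1 2|)%N by rewrite cF !muln_gt0 M0 N0 K0.
have FF' : (#|model_box 0 3| <= 27 * #|model_box 1 2|)%N by rewrite cF cF'.
(* The boolean in [J] selects the word ending in [z ^+ k], which carries the sign [-1]. *)
pose w (j : J) : R := (if j.2 then -1 else 1) * (M%:R * N%:R)^-1.
have wsum (f : J -> R) : \sum_j w j * f j =
    (M%:R * N%:R)^-1 * \sum_(b < M) \sum_(a < N) (f (b, a, false) - f (b, a, true)).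
  rewrite mulr_sumr.
  have := sum_words (fun b a e => w (b, a, e) * f (b, a, e)).
  rewrite (eq_bigr (fun j => w j * f j)); last by move=> [[b a] e].
  move=> ->; apply: eq_bigr => b _; rewrite mulr_sumr; apply: eq_bigr => a _.
  by rewrite /w /=; ring.
have wsumC (f : J -> R[i]) : \sum_j (w j)%:C%C * f j =
    ((M%:R * N%:R)^-1)%:C%C * \sum_(b < M) \sum_(a < N) (f (b, a, false) - f (b, a, true)).
  rewrite mulr_sumr.
  have := sum_words (fun b a e => (w (b, a, e))%:C%C * f (b, a, e)).
  rewrite (eq_bigr (fun j => (w j)%:C%C * f j)); last by move=> [[b a] e].
  move=> ->; apply: eq_bigr => b _; rewrite mulr_sumr; apply: eq_bigr => a _.
  by rewrite /w /= mul1r mulN1r rmorphN; ring.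
split.
  have := @transference R G p phi A B delta T J w wordG (fun j => word j) model_pt
    (model_box 1 2) (model_box 0 3) g g' p1 mb d0 F0 FF' model_op.
  rewrite wsumC; apply => f.
  have [+ _] := HBT f; apply: le_trans; apply: ler_sum => t _.
  by rewrite (wsum (fun j => f (word j t))).
have := @transference R G p phi A B delta T J w (fun j => (wordG j)^-1%g)
  (fun j => (word j)^-1%g) model_pt
  (model_box 1 2) (model_box 0 3) g g' p1 mb d0 F0 FF' model_adj.
rewrite wsumC; apply => f.
have [_] := HBT f; apply: le_trans; apply: ler_sum => t _.
by rewrite (wsum (fun j => f ((word j)^-1%g t))).
Qed.

End Model.

End HeisenbergTransference.

(** * Finite means and insertion of central factors *)

Section FiniteMeans.
Context {R : realType}.
Local Notation normc := Normc.normc.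

Definition fmean (T : finType) (F : T -> R[i]) : R[i] :=
  (#|T|%:R^-1)%:C%C * \sum_t F t.

Lemma eq_fmean (T : finType) (F F' : T -> R[i]) : F =1 F' -> fmean F = fmean F'.
Proof. by move=> FF'; rewrite /fmean (eq_bigr F'). Qed.

Lemma fmeanB (T : finType) (F F' : T -> R[i]) :
  fmean (fun t => F t - F' t) = fmean F - fmean F'.
Proof. by rewrite /fmean -mulrBr sumrB. Qed.

Lemma fmeanN (T : finType) (F : T -> R[i]) : fmean (fun t => - F t) = - fmean F.
Proof. by rewrite /fmean sumrN mulrN. Qed.

Lemma fmean_rev n (F : 'I_n -> R[i]) : fmean F = fmean (fun i => F (rev_ord i)).
Proof. by rewrite /fmean (reindex_inj rev_ord_inj). Qed.

Lemma fmeanZ (T : finType) a (F : T -> R[i]) :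
  fmean (fun t => a * F t) = a * fmean F.
Proof. by rewrite /fmean -mulr_sumr mulrCA. Qed.

Lemma fmean_cst (T : finType) (v : R[i]) : (0 < #|T|)%N -> fmean (fun _ : T => v) = v.
Proof.
move=> T0; rewrite /fmean sumr_const -[v *+ _]mulr_natl mulrA.
rewrite -(rmorph_nat (real_complex R)) -rmorphM mulVf ?rmorph1 ?mul1r//.
by rewrite pnatr_eq0 -lt0n.
Qed.

Lemma normc_fmean (T : finType) (F : T -> R[i]) :
  normc (fmean F) <= #|T|%:R^-1 * \sum_t normc (F t).
Proof.
rewrite /fmean normcMl ger0_norm ?invr_ge0// ler_wpM2l ?invr_ge0//.
exact: ler_normc_sum.
Qed.

Lemma fmean_le (T : finType) (F : T -> R[i]) c : 0 <= c ->
  (forall t, normc (F t) <= c) -> normc (fmean F) <= c.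
Proof.
move=> c0 H; apply: le_trans (normc_fmean F) _.
have [T0|T0] := posnP #|T|; first by rewrite T0 invr0 mul0r.
rewrite ler_pdivrMl ?ltr0n//.
apply: le_trans (ler_sum _ (fun t _ => H t)) _.
by rewrite sumr_const mulr_natl.
Qed.

Lemma fmean_swap (S T : finType) (F : S -> T -> R[i]) :
  fmean (fun s => fmean (F s)) = fmean (fun t => fmean (F^~ t)).
Proof.
rewrite /fmean -mulr_sumr -[in RHS]mulr_sumr exchange_big/=.
by rewrite !mulrA [_%:C%C * _]mulrC.
Qed.

Lemma fmean_rotate (S T U : finType) (F : S -> T -> U -> R[i]) :
  fmean (fun s => fmean (fun t => fmean (F s t))) =
  fmean (fun u => fmean (fun s => fmean (fun t => F s t u))).
Proof.
under eq_fmean do rewrite fmean_swap.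
by rewrite fmean_swap.
Qed.

End FiniteMeans.

Section HeisenbergInsertion.
Context {R : realType} {G : lcGroupType}.
Local Notation normc := Normc.normc.
Implicit Types (phi : G -> R[i]) (x y z g : G).

Lemma fmean_ord2 (M N : nat) (F : nat -> nat -> R[i]) :
  ((M%:R * N%:R)^-1)%:C%C * \sum_(b < M) \sum_(a < N) F b a =
  fmean (fun b : 'I_M => fmean (fun a : 'I_N => F b a)).
Proof. by rewrite invfM rmorphM /fmean !card_ord -mulr_sumr mulrA. Qed.

(** Complementary powers on both sides turn an inverse word into a positive one with [x] before [y];
    only the central exponent is exchanged with its complement. *)
Lemma hword_rev x y z (a b a1 b1 e f : nat) : heisenberg x y z ->
  (x ^+ (a + a1) * (hword x y z b1 a1 e)^-1 * (z ^+ (e + f) * y ^+ (b1 + b)) =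
   x ^+ a * y ^+ b * z ^+ f)%g.
Proof.
move=> [_ xz yz].
have cy n m : commute (z ^+ n)%g (y ^+ m)%g by apply: commuteX2; exact: commute_sym.
have cx n m : commute (x ^+ n)%g (z ^+ m)%g by apply: commuteX2.
rewrite /hword -(mulgA (y ^+ b1)%g) (cx a1 e) !invgM !expgnDr !mulgA mulgK.
rewrite -(mulgA _ (z ^+ e)%g (z ^+ f)%g) -expgnDr -(mulgA _ _ (y ^+ b1)%g) (cy (e + f)%N b1).
by rewrite mulgA mulgVK expgnDr mulgA mulgVK -!mulgA (cy f b).
Qed.

Lemma transference_cst_ge1 (p : R) : 1 <= transference_cst p.
Proof. by rewrite lerDl !mulr_ge0// powR_ge0. Qed.

Definition heis_small (c : R) (d : nat) (delta : R) (M N k : nat) :=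
  [/\ (0 < M)%N, (0 < N)%N, forall b, (0 < b < M)%N -> (b %| k)%N &
      4 / M%:R + 8 * k%:R / N%:R <= c * delta ^+ d].

(** The only form in which the operator bounds enter the comparison of words. Both orders of [x] and
    [y] appear because the words in SL(3,R) meet such pairs in both. *)
Definition heis_insertion (p c : R) (d : nat) :=
  forall phi (A B delta : R) x y z (M N k : nat) g g',
  mult_bound p phi A B -> 0 < delta -> delta <= 1 -> heisenberg x y z ->
  heis_small c d delta M N k ->
  normc (fmean (fun b : 'I_M => fmean (fun a : 'I_N =>
    phi (g * (y ^+ b * x ^+ a) * g')%g -
    phi (g * (y ^+ b * x ^+ a * z ^+ k) * g')%g))) <= delta * A * B /\
  normc (fmean (fun a : 'I_N => fmean (fun b : 'I_M =>
    phi (g * (x ^+ a * y ^+ b) * g')%g -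
    phi (g * (x ^+ a * y ^+ b * z ^+ k) * g')%g))) <= delta * A * B.

Lemma heis_insertion_exists (p : R) : 1 < p ->
  exists c d, 0 < c /\ heis_insertion p c d.
Proof.
move=> p1; have [c [d [c0 H]]] := heis_bound_exists p1.
have C1 := transference_cst_ge1 p; set C := transference_cst p in C1.
have C0 : 0 < C by apply: lt_le_trans C1.
(* The operator bound is applied at [delta / C], which absorbs the transference constant. *)
exists (c / C ^+ d), d; split; first by rewrite divr_gt0 ?exprn_gt0.
move=> phi A B delta x y z M N k g g' mb d0 d1 hs [M0 N0 dk small].
have dC0 : 0 < delta / C by rewrite divr_gt0.
have dC1 : delta / C <= 1 by rewrite ler_pdivrMr// mul1r (le_trans d1).
have {}small : 4 / M%:R + 8 * k%:R / N%:R <= c * (delta / C) ^+ d.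
  by apply: le_trans small _; rewrite expr_div_n mulrA mulrAC.
have gap g1 g2 := heis_gap_le hs M0 N0 g1 g2 p1 H dk mb dC0 dC1 small.
have CE : transference_cst p * (delta / C) * A * B = delta * A * B.
  by rewrite -/C mulrCA [C * _]mulrC mulVf ?gt_eqF// mulr1.
split.
  have [+ _] := gap g g'; rewrite CE; apply: le_trans.
  rewrite /heis_gap (@fmean_ord2 M N (fun b a =>
    phi (g * hword x y z b a 0 * g')%g - phi (g * hword x y z b a k * g')%g)).
  rewrite le_eqVlt; apply/orP; left; apply/eqP; congr normc.
  by apply: eq_fmean => b; apply: eq_fmean => a; rewrite /hword expg0 mulg1.
(* Inverse words are enclosed between the top powers of [x], [y] and [z]. Reversing both ranges of
   summation then leaves [x ^+ a * y ^+ b], with the central exponents [0] and [k] exchanged, hence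
   a sign. *)
have [_] := gap (g * x ^+ N.-1)%g (z ^+ k * y ^+ M.-1 * g')%g.
rewrite CE; apply: le_trans; rewrite /heis_gapV.
pose F b a := (phi (g * x ^+ N.-1 * (hword x y z b a 0)^-1 * (z ^+ k * y ^+ M.-1 * g')) -
  phi (g * x ^+ N.-1 * (hword x y z b a k)^-1 * (z ^+ k * y ^+ M.-1 * g')))%g.
rewrite (@fmean_ord2 M N F) [in leRHS]fmean_swap -[leRHS]normc_opp.
rewrite le_eqVlt; apply/orP; left; apply/eqP; congr normc.
rewrite -fmeanN [RHS]fmean_rev; apply: eq_fmean => a.
rewrite -fmeanN [RHS]fmean_rev; apply: eq_fmean => b.
have aE : N.-1 = (a + (N - a.+1))%N by have := ltn_ord a; lia.
have bE : M.-1 = ((M - b.+1) + b)%N by have := ltn_ord b; lia.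
rewrite /F /= opprB.
have E e f : (e + f = k)%N ->
   (g * x ^+ N.-1 * (hword x y z (M - b.+1) (N - a.+1) e)^-1 * (z ^+ k * y ^+ M.-1 * g') =
    g * (x ^+ a * y ^+ b * z ^+ f) * g')%g.
  by move=> <-; rewrite aE bE -(hword_rev a b (N - a.+1) (M - b.+1) e f hs) !mulgA.
by rewrite (E k 0%N (addn0 k)) (E 0%N k (add0n k)) expg0 mulg1.
Qed.

End HeisenbergInsertion.

(** * Words in SL(3,R) *)

Section Elementary.
Context {R : realType}.
Local Notation G := (SL 3 R).
Implicit Types (i j k l : 'I_3) (s t : R).

(** Linearity in row [i]: one term is the identity, the other has equal rows [i] and [j]. *)
Lemma det_elem n (i j : 'I_n) s : i != j ->
  \det (1%:M + s *: delta_mx i j : 'M[R]_n) == 1.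
Proof.
move=> ij.
pose C : 'M[R]_n := \matrix_(k, l) (if k == i then (l == j)%:R else (k == l)%:R).
rewrite (@determinant_multilinear _ _ _ 1%:M C i 1 s).
- rewrite det1 mulr1 (@determinant_alternate _ _ C i j) ?mulr0 ?addr0//.
  by move=> l; rewrite !mxE eqxx [j == i]eq_sym (negbTE ij) eq_sym.
- by apply/rowP => l; rewrite !mxE eqxx /= mul1r.
- apply/matrixP => k l; rewrite !mxE [lift i k == i]eq_sym (negbTE (neq_lift _ _)) /=.
  by rewrite mulr0 addr0.
- apply/matrixP => k l; rewrite !mxE [lift i k == i]eq_sym (negbTE (neq_lift _ _)) /=.
  by rewrite mulr0 addr0.
Qed.

Definition elem i j (ij : i != j) s : G := MkSL (det_elem s ij).

Lemma elemM i j (ij : i != j) s t : (elem ij s * elem ij t)%g = elem ij (s + t).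
Proof.
apply/val_inj => /=; rewrite mulmxDl mul1mx mulmxDr mulmx1 -scalemxAl -scalemxAr.
rewrite mul_delta_mx_cond [j == i]eq_sym (negbTE ij) mulr0n !scaler0 addr0.
by rewrite scalerDl addrA addrAC.
Qed.

Lemma elem0 i j (ij : i != j) : elem ij 0 = 1%g.
Proof. by apply/val_inj => /=; rewrite scale0r addr0. Qed.

Lemma elemX i j (ij : i != j) s n : (elem ij s ^+ n)%g = elem ij (n%:R * s).
Proof.
elim: n => [|n ih]; first by rewrite expg0 mul0r elem0.
by rewrite expgS ih elemM -natr1 mulrDl mul1r addrC.
Qed.

Lemma elemV i j (ij : i != j) s : (elem ij s)^-1%g = elem ij (- s).
Proof. by apply/esym/eqP; rewrite -mulg_eq1 elemM addNr elem0. Qed.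

Lemma elemC i j k l (ij : i != j) (kl : k != l) s t : j != k -> i != l ->
  commute (elem ij s) (elem kl t).
Proof.
move=> jk il; apply/val_inj => /=.
rewrite !mulmxDl !mul1mx !mulmxDr !mulmx1 -!scalemxAl -!scalemxAr !mul_delta_mx_cond.
rewrite (negbTE jk) [l == i]eq_sym (negbTE il) !mulr0n !scaler0 !addr0.
by rewrite -!addrA; congr (_ + _); rewrite addrC.
Qed.

Lemma elem_commutator i j k (ij : i != j) (jk : j != k) (ik : i != k) s t :
  (elem ij s * elem jk t = elem jk t * elem ij s * elem ik (s * t))%g.
Proof.
apply/val_inj => /=.
rewrite !mulmxDl !mul1mx !mulmxDr !mulmx1 !mulmxDl -!scalemxAl -!scalemxAr -!scalemxAl !mul_delta_mx_cond.
rewrite eqxx [k == i]eq_sym (negbTE ik) [j == i]eq_sym (negbTE ij) !mul0mx.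
rewrite !mulr0n ?mul0mx ?scaler0 !mulr1n !addr0 scalerA.
by rewrite mul1mx addrA -!addrA; congr (_ + _); rewrite addrC -addrA.
Qed.

Lemma heisenberg_elem i j k (ij : i != j) (jk : j != k) (ik : i != k) s t :
  heisenberg (elem ij s) (elem jk t) (elem ik (s * t)).
Proof.
split; first exact: elem_commutator.
- by apply: elemC => //; rewrite eq_sym.
- by apply: elemC => //; rewrite eq_sym.
Qed.

Lemma heisenberg_elem_sym i j k (ij : i != j) (jk : j != k) (ik : i != k) s t :
  heisenberg (elem jk t) (elem ij s) (elem ik (- (s * t))).
Proof.
split.
- by rewrite (elem_commutator ij jk ik) -mulgA elemM subrr elem0 mulg1.
- by apply: elemC => //; rewrite eq_sym.
- by apply: elemC => //; rewrite eq_sym.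
Qed.

Definition o0 : 'I_3 := @Ordinal 3 0 isT.
Definition o1 : 'I_3 := @Ordinal 3 1 isT.
Definition o2 : 'I_3 := @Ordinal 3 2 isT.

(* The roots [12, 13, 23, 21, 31], five consecutive ones on the hexagon: neighbours
   commute and the commutator of [x_i] and [x_(i+2)] is [x_(i+1)]. *)
Definition x0 : R -> G := @elem o0 o1 isT.
Definition x1 : R -> G := @elem o0 o2 isT.
Definition x2 : R -> G := @elem o1 o2 isT.
Definition x3 : R -> G := @elem o1 o0 isT.
Definition x4 : R -> G := @elem o2 o0 isT.

End Elementary.

(** * Comparison of word averages with a common hub *)

Section WordAverages.
Context {R : realType}.
Local Notation G := (SL 3 R).
Local Notation normc := Normc.normc.
Implicit Types (phi : G -> R[i]) (g : G).

Definition word (Q t a b a' : nat) : G :=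
  (x0 (a%:R / Q%:R) * x2 (t * b)%:R * x4 (a'%:R / Q%:R))%g.

(** A mesh of step [1 / Q] stands for the interval [[0, 1]], since insertions average over powers of
    a single group element. *)
Definition word_mean (Q t M : nat) phi g : R[i] :=
  fmean (fun a : 'I_Q => fmean (fun b : 'I_M => fmean (fun a' : 'I_Q =>
    phi (word Q t a b a' * g)%g))).

(** Neither [t] nor [M] occurs, so several word means can be compared through it. The step [1 / q]
    makes [x2 (1 / m!)] the commutator of [x1 (1 / q)] and [x3 (- m ^ 4)]; every [x2 (t * b)] is a
    power of it with exponent divisible by all positive integers below [m]. *)
Definition hub_mean (Q m : nat) phi g : R[i] :=
  let q := (m ^ 4 * m`!)%N in
  fmean (fun a : 'I_Q => fmean (fun i : 'I_(q * m ^ 5) => fmean (fun j : 'I_m =>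
    fmean (fun a' : 'I_Q => phi (x0 (a%:R / Q%:R) * x1 (i%:R / q%:R) *
      x3 (- (m ^ 4 * j)%:R) * x4 (a'%:R / Q%:R) * g)%g)))).

(** The ratios of central length to averaging length are at most [m^5 / t] for the first two
    insertions and [t M / m^9] for the third, all at most [1 / m]. As the other averages have at
    least [m] terms, [12 = 4 + 8] covers both parts of the smallness condition. *)
Lemma word_mean_hub (p c : R) (d : nat) phi (A B delta : R) (m t M r : nat) g
    (Q := (m ^ 4 * m`! * t * M`! * r)%N) :
  @heis_insertion R G p c d -> mult_bound p phi A B -> 0 < delta -> delta <= 1 ->
  (0 < m)%N -> (m <= M)%N -> (m ^ 6 <= t)%N -> (t * M <= m ^ 8)%N -> (0 < r)%N ->
  12 / m%:R <= c * delta ^+ d -> 0 <= A -> 0 <= B ->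
  normc (word_mean Q t M phi g - hub_mean Q m phi g) <= 3 * (delta * A * B).
Proof.
move=> ins mb d0 d1 m0 mM mt tM r0 small A0 B0.
have D0 : 0 <= delta * A * B by rewrite !mulr_ge0// ltW.
pose q := (m ^ 4 * m`!)%N.
have q0 : (0 < q)%N by rewrite muln_gt0 expn_gt0 m0 fact_gt0.
have t0 : (0 < t)%N by apply: leq_trans mt; rewrite expn_gt0 m0.
have M0 : (0 < M)%N by apply: leq_trans mM.
have N0 : (0 < q * m ^ 5)%N by rewrite muln_gt0 q0 expn_gt0 m0.
have QE : Q = (q * t * (M`! * r))%N by rewrite /Q /q !mulnA.
have f0 : (0 < M`! * r)%N by rewrite muln_gt0 fact_gt0 r0.
have fdvd b : (0 < b < M)%N -> (b %| M`! * r)%N.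
  by move=> /andP[b0 bM]; apply: dvdn_mulr; apply: dvdn_fact; rewrite b0 ltnW.
clearbody Q; move: (M`! * r)%N QE f0 fdvd => f QE f0 fdvd.
have Q0 : (0 < Q)%N by rewrite QE muln_gt0 muln_gt0 q0 t0 f0.
have nz n : (0 < n)%N -> n%:R != 0 :> R by rewrite pnatr_eq0 -lt0n.
have mR : 0 < m%:R :> R by rewrite ltr0n.
have tR : 0 < t%:R :> R by rewrite ltr0n.
have qR : 0 < q%:R :> R by rewrite ltr0n.
have QR : Q%:R = q%:R * t%:R * f%:R :> R by rewrite QE !natrM.
have mtR : m%:R ^+ 6 <= t%:R :> R by rewrite -natrX ler_nat.
have tMR : t%:R * M%:R <= m%:R ^+ 8 :> R by rewrite -natrM -natrX ler_nat.
have small4 (n : nat) (k : R) : (0 < n)%N -> (m <= n)%N -> k <= m%:R^-1 -> 4 / n%:R + 8 * k <= c * delta ^+ d.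
  move=> n0 mn k1; apply: le_trans small.
  have -> : 12 / m%:R = 4 / m%:R + 8 * m%:R^-1 :> R by field; exact: nz.
  apply: lerD; apply: ler_wpM2l => //.
  by rewrite lef_pV2 ?posrE ?ltr0n// ler_nat.
pose W a b i j a' : G := (x0 (a%:R / Q%:R) * x2 (t * b)%:R * x1 (i%:R / q%:R) *
   x3 (- (m ^ 4 * j)%:R) * x4 (a'%:R / Q%:R) * g)%g.
pose W1 a b j a' : G := (x0 (a%:R / Q%:R) * x2 (t * b)%:R *
   x3 (- (m ^ 4 * j)%:R) * x4 (a'%:R / Q%:R) * g)%g.
pose W0 a b a' : G := (word Q t a b a' * g)%g.
pose U a i j a' : G := (x0 (a%:R / Q%:R) * x1 (i%:R / q%:R) *
      x3 (- (m ^ 4 * j)%:R) * x4 (a'%:R / Q%:R) * g)%g.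
pose five (H : nat -> nat -> nat -> nat -> nat -> R[i]) :=
  fmean (fun a : 'I_Q => fmean (fun b : 'I_M => fmean (fun i : 'I_(q * m ^ 5) =>
    fmean (fun j : 'I_m => fmean (fun a' : 'I_Q => H a b i j a'))))).
have fiveB H H' : five (fun a b i j a' => H a b i j a' - H' a b i j a') = five H - five H'.
  rewrite /five -fmeanB; apply: eq_fmean => a; rewrite -fmeanB; apply: eq_fmean => b.
  rewrite -fmeanB; apply: eq_fmean => i; rewrite -fmeanB; apply: eq_fmean => j.
  by rewrite -fmeanB.
(* From [W0] to [W1] a factor [x3] is inserted using [x2] and [x4]; from [W1] to [W] a factor [x1],
   using [x0] and [x2]; from [W] to [U] the factor [x2] is removed using [x1] and [x3]. *)
have -> : word_mean Q t M phi g - hub_mean Q m phi g =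
    five (fun a b i j a' => phi (W0 a b a') - phi (W1 a b j a')) +
    five (fun a b i j a' => phi (W1 a b j a') - phi (W a b i j a')) +
    five (fun a b i j a' => phi (W a b i j a') - phi (U a i j a')).
  have -> : word_mean Q t M phi g = five (fun a b i j a' => phi (W0 a b a')).
    apply: eq_fmean => a; apply: eq_fmean => b.
    by rewrite !fmean_cst ?card_ord.
  have -> : hub_mean Q m phi g = five (fun a b i j a' => phi (U a i j a')).
    by apply: eq_fmean => a; rewrite fmean_cst ?card_ord.
  by rewrite !fiveB !addrA !subrK.
have -> : 3 * (delta * A * B) = delta * A * B + delta * A * B + delta * A * B by ring.
apply: le_trans (ler_normcD _ _) _; apply: lerD.
  apply: le_trans (ler_normcD _ _) _; apply: lerD.
  - apply: fmean_le => // a; rewrite fmean_swap; apply: fmean_le => // i.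
    rewrite fmean_swap; apply: fmean_le => // j.
    (* The commutator is [x3 (- t / Q)], and its [k]-th power is [x3 (- m ^ 4 j)]; the factor [f], a
       multiple of [M!], supplies the divisibility. *)
    pose k := (m ^ 4 * j * (q * f))%N.
    have sm : heis_small c d delta M Q k.
      split=> // [b bM|].
        by rewrite /k; do 2 apply: dvdn_mull; exact: fdvd.
      rewrite -mulrA; apply: small4 => //.
      rewrite /k QR natrM [(q * _)%:R]natrM.
      have -> : (m ^ 4 * j)%:R * (q%:R * f%:R) / (q%:R * t%:R * f%:R) =
         (m ^ 4 * j)%:R / t%:R :> R by field; rewrite !nz.
      rewrite ler_pdivrMr// ler_pdivlMl//; apply: le_trans mtR.
      rewrite -natrX -natrM ler_nat mulnA -expnS [(m ^ 6)%N]expnSr leq_mul2l.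
      by rewrite ltnW ?orbT.
    have [+ _] := ins phi A B delta _ _ _ M Q k (x0 (a%:R / Q%:R)) g mb d0 d1
      (@heisenberg_elem_sym R o1 o2 o0 isT isT isT t%:R Q%:R^-1) sm.
    apply: le_trans; rewrite le_eqVlt; apply/orP; left; apply/eqP; congr normc.
    apply: eq_fmean => b; apply: eq_fmean => a'; rewrite !elemX; congr (phi _ - phi _).
      by rewrite /W0 /word natrM [t%:R * _]mulrC !mulgA.
    rewrite /W1 (_ : k%:R * - (t%:R / Q%:R) = - (m ^ 4 * j)%:R); last first.
      by rewrite /k QR natrM [(q * _)%:R]natrM; field; rewrite !nz.
    rewrite natrM [t%:R * _]mulrC -!mulgA; congr (_ * (_ * _))%g.
    by rewrite !mulgA; congr (_ * _)%g; exact: elemC.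
  - rewrite /five fmean_rotate; apply: fmean_le => // i.
    rewrite fmean_rotate; apply: fmean_le => // j.
    rewrite fmean_rotate; apply: fmean_le => // a'.
    pose k := (i * f)%N.
    have sm : heis_small c d delta M Q k.
      split=> // [b bM|]; first by rewrite /k; apply: dvdn_mull; exact: fdvd.
      rewrite -mulrA; apply: small4 => //.
      rewrite /k QR natrM.
      have -> : i%:R * f%:R / (q%:R * t%:R * f%:R) = i%:R / (q%:R * t%:R) :> R.
        by field; rewrite !nz.
      rewrite ler_pdivrMr ?mulr_gt0// ler_pdivlMl// [q%:R * _]mulrC.
      apply: (@le_trans _ _ (m%:R * (q * m ^ 5)%:R)).
        by rewrite ler_wpM2l// ler_nat ltnW.
      by rewrite natrM natrX mulrCA -exprS [leRHS]mulrC ler_wpM2l// ltW.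
    have [_] := ins phi A B delta _ _ _ M Q k 1%g (x3 (- (m ^ 4 * j)%:R) * x4 (a'%:R / Q%:R) * g)%g mb d0 d1
      (@heisenberg_elem R o0 o1 o2 isT isT isT Q%:R^-1 t%:R) sm.
    apply: le_trans; rewrite le_eqVlt; apply/orP; left; apply/eqP; congr normc.
    apply: eq_fmean => a; apply: eq_fmean => b; rewrite !elemX mul1g; congr (phi _ - phi _).
      by rewrite /W1 natrM [t%:R * _]mulrC !mulgA.
    rewrite /W (_ : k%:R * (Q%:R^-1 * t%:R) = i%:R / q%:R); last first.
      by rewrite /k QR natrM; field; rewrite !nz.
    by rewrite mul1g natrM [t%:R * _]mulrC !mulgA.
apply: fmean_le => // a; apply: fmean_le => // b.
rewrite fmean_rotate; apply: fmean_le => // a'.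
pose k := (t * b * m`!)%N.
have sm : heis_small c d delta m (q * m ^ 5) k.
  split=> // [e /andP[e0 em]|].
    by rewrite /k; apply: dvdn_mull; apply: dvdn_fact; rewrite e0 ltnW.
  rewrite -mulrA; apply: small4 => //.
  have qE : (q * m ^ 5)%:R = m%:R ^+ 4 * m`!%:R * m%:R ^+ 5 :> R by rewrite -!natrX -!natrM.
  rewrite qE /k natrM [(t * b)%:R]natrM.
  have -> : t%:R * b%:R * m`!%:R / (m%:R ^+ 4 * m`!%:R * m%:R ^+ 5) =
      (t%:R * b%:R) / (m%:R ^+ 8 * m%:R) :> R by field; rewrite !nz ?fact_gt0.
  rewrite ler_pdivrMr ?mulr_gt0 ?exprn_gt0// [m%:R ^+ 8 * _]mulrC mulKf ?nz//.
  by apply: le_trans tMR; rewrite ler_wpM2l// ler_nat ltnW.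
have [_] := ins phi A B delta _ _ _ m (q * m ^ 5)%N k (x0 (a%:R / Q%:R)) (x4 (a'%:R / Q%:R) * g)%g mb d0 d1
  (@heisenberg_elem_sym R o1 o0 o2 isT isT isT (- (m ^ 4)%:R) q%:R^-1) sm.
apply: le_trans; rewrite le_eqVlt; apply/orP; left; apply/eqP; rewrite -normc_opp; congr normc.
rewrite -fmeanN; apply: eq_fmean => i; rewrite -fmeanN; apply: eq_fmean => j.
rewrite !elemX opprB; congr (phi _ - phi _).
  rewrite /U (_ : j%:R * - (m ^ 4)%:R = - (m ^ 4 * j)%:R); last by rewrite natrM; ring.
  by rewrite !mulgA.
rewrite /W (_ : k%:R * - (- (m ^ 4)%:R / q%:R) = (t * b)%:R); last first.
  by rewrite /k /q natrM [(m ^ 4 * _)%:R]natrM; field; rewrite !nz ?fact_gt0 ?expn_gt0 ?m0.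
rewrite (_ : j%:R * - (m ^ 4)%:R = - (m ^ 4 * j)%:R); last by rewrite natrM; ring.
rewrite -!mulgA; congr (_ * _)%g; rewrite !mulgA; congr (_ * _ * _)%g.
have c1 : commute (x2 (t * b)%:R : G) (x1 (i%:R / q%:R)) by exact: elemC.
have c3 : commute (x2 (t * b)%:R : G) (x3 (- (m ^ 4 * j)%:R)) by exact: elemC.
by rewrite c1 -!mulgA c3.
Qed.

End WordAverages.

(** * Integration on SL(3,R) *)

Section ComplexIntegral.
Context {R : realType} {d : measure_display} {X : measurableType d}.
Variable mu : {measure set X -> \bar R}.
Implicit Types (f g : X -> R[i]) (b : X -> R).
Local Notation normc := Normc.normc.
Local Notation Re := (@complex.Re R).
Local Notation Im := (@complex.Im R).

Definition cintegrable f :=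
  mu.-integrable setT (fun x => (Re (f x))%:E) /\
  mu.-integrable setT (fun x => (Im (f x))%:E).

Lemma measurable_funC_mul f g : measurable_funC f -> measurable_funC g ->
  measurable_funC (fun x => f x * g x).
Proof.
move=> [mRf mIf] [mRg mIg]; split.
  rewrite (_ : (fun x => _) = (fun x => Re (f x) * Re (g x) - Im (f x) * Im (g x))).
    by apply: measurable_funB; exact: measurable_funM.
  by apply/funext => x; case: (f x) (g x) => ? ? [].
rewrite (_ : (fun x => _) = (fun x => Re (f x) * Im (g x) + Im (f x) * Re (g x))).
  by apply: measurable_funD; exact: measurable_funM.
by apply/funext => x; case: (f x) (g x) => ? ? [].
Qed.

Lemma measurable_funC_add f g : measurable_funC f -> measurable_funC g ->
  measurable_funC (fun x => f x + g x).
Proof.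
move=> [mRf mIf] [mRg mIg]; split.
  rewrite (_ : (fun x => _) = (fun x => Re (f x) + Re (g x))).
    exact: measurable_funD.
  by apply/funext => x; case: (f x) (g x) => ? ? [].
rewrite (_ : (fun x => _) = (fun x => Im (f x) + Im (g x))).
  exact: measurable_funD.
by apply/funext => x; case: (f x) (g x) => ? ? [].
Qed.

Lemma measurable_funC_cst (c : R[i]) : measurable_funC (fun _ : X => c).
Proof. by split; exact: measurable_cst. Qed.

Lemma measurable_funC_real b : measurable_fun setT b ->
  measurable_funC (fun x => (b x)%:C%C).
Proof. by move=> mb; split => //; exact: measurable_cst. Qed.

Lemma measurable_funC_fmean (T : finType) (F : T -> X -> R[i]) :
  (forall t, measurable_funC (F t)) -> measurable_funC (fun x => fmean (fun t => F t x)).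
Proof.
move=> mF; apply: measurable_funC_mul; first exact: measurable_funC_cst.
elim: (index_enum T) => [|t r ih].
  by under eq_fun do rewrite big_nil; exact: measurable_funC_cst.
by under eq_fun do rewrite big_cons; exact: measurable_funC_add.
Qed.

Lemma cintegrable_measurable f : cintegrable f -> measurable_funC f.
Proof.
move=> [iR iI]; split; apply/measurable_EFinP.
  exact: (measurable_int mu iR).
exact: (measurable_int mu iI).
Qed.

Lemma cintegrable_dom f b : measurable_funC f ->
  mu.-integrable setT (fun x => (b x)%:E) ->
  (forall x, normc (f x) <= b x) -> cintegrable f.
Proof.
move=> [mR mI] ib fb; split; apply: le_integrable ib => //; try exact/measurable_EFinP.
  move=> x _; rewrite lee_fin; apply: le_trans (ler_norm _).
  by apply: le_trans (fb x); exact: Re_le_normc.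
move=> x _; rewrite lee_fin; apply: le_trans (ler_norm _).
by apply: le_trans (fb x); exact: Im_le_normc.
Qed.

Lemma cintegrable_lin a f g : cintegrable f -> cintegrable g ->
  cintegrable (fun x => a * f x + g x).
Proof.
move=> [Rf If] [Rg Ig]; split.
  rewrite (_ : (fun x => _) = (fun x => ((Re a)%:E * (Re (f x))%:E) +
     ((- Im a)%:E * (Im (f x))%:E) + (Re (g x))%:E)%E).
    by apply: integrableD => //; apply: integrableD => //; apply: integrableZl.
  apply/funext => x; rewrite -!EFinM -!EFinD; congr (_%:E).
  by case: a (f x) (g x) => ? ? [? ?] [? ?] /=; rewrite mulNr.
rewrite (_ : (fun x => _) = (fun x => ((Re a)%:E * (Im (f x))%:E) +
   ((Im a)%:E * (Re (f x))%:E) + (Im (g x))%:E)%E).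
  by apply: integrableD => //; apply: integrableD => //; apply: integrableZl.
apply/funext => x; rewrite -!EFinM -!EFinD; congr (_%:E).
by case: a (f x) (g x) => ? ? [? ?] [? ?] /=.
Qed.

Lemma integralC_lin a f g : cintegrable f -> cintegrable g ->
  integralC mu (fun x => a * f x + g x) = a * integralC mu f + integralC mu g.
Proof.
move=> [Rf If] [Rg Ig].
have iZ (c : R) (h : X -> R) : mu.-integrable setT (fun x => (h x)%:E) ->
    mu.-integrable setT (EFin \o (fun x => c * h x)).
  move=> ih; rewrite (_ : _ \o _ = (fun x => c%:E * (h x)%:E)%E); last by apply/funext => x /=; rewrite EFinM.
  exact: integrableZl.
have iD (h k : X -> R) : mu.-integrable setT (EFin \o h) ->
    mu.-integrable setT (EFin \o k) -> mu.-integrable setT (EFin \o (fun x => h x + k x)).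
  move=> ih ik; rewrite (_ : _ \o _ = (fun x => (h x)%:E + (k x)%:E)%E); last by apply/funext => x /=; rewrite EFinD.
  exact: integrableD.
rewrite /integralC.
rewrite (_ : (fun x => Re _) = (fun x => (Re a * Re (f x) + - Im a * Im (f x)) + Re (g x))); last first.
  apply/funext => x.
  by case: a (f x) (g x) => ? ? [? ?] [? ?] /=; rewrite mulNr.
rewrite (_ : (fun x => Im _) = (fun x => (Re a * Im (f x) + Im a * Re (f x)) + Im (g x))); last first.
  apply/funext => x.
  by case: a (f x) (g x) => ? ? [? ?] [? ?] /=.
rewrite !RintegralD//; try by [apply: iD; exact: iZ|exact: iZ].
rewrite !RintegralZl//.
by case: a => a1 a2 /=; rewrite mulNr.
Qed.

Lemma integralC0 : integralC mu (fun=> 0) = 0.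
Proof. by rewrite /integralC /Rintegral integral0. Qed.

Lemma cintegrable0 : cintegrable (fun=> 0).
Proof. by split; exact: integrable0. Qed.

Lemma integralC_fmean (T : finType) (F : T -> X -> R[i]) :
  (forall t, cintegrable (F t)) ->
  cintegrable (fun x => fmean (fun t => F t x)) /\
  integralC mu (fun x => fmean (fun t => F t x)) = fmean (fun t => integralC mu (F t)).
Proof.
move=> iF.
have S : cintegrable (fun x => \sum_t F t x) /\
   integralC mu (fun x => \sum_t F t x) = \sum_t integralC mu (F t).
  elim: (index_enum T) => [|t r [ih1 ih2]].
    rewrite big_nil (_ : (fun x => _) = (fun=> 0)); last by apply/funext => x; rewrite big_nil.
    by split; [exact: cintegrable0|exact: integralC0].
  rewrite big_cons (_ : (fun x => _) = (fun x => 1 * F t x + \sum_(t <- r) F t x)); last first.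
    by apply/funext => x; rewrite big_cons mul1r.
  by split; [exact: cintegrable_lin|rewrite integralC_lin// ih2 mul1r].
rewrite /fmean; set c := (_%:C)%C.
rewrite (_ : (fun x => _) = (fun x => c * \sum_t F t x + 0)); last by apply/funext => x; rewrite addr0.
have [S1 S2] := S; split; first by apply: cintegrable_lin => //; exact: cintegrable0.
by rewrite integralC_lin//; [rewrite S2 integralC0 addr0|exact: cintegrable0].
Qed.

(** The factor [2] comes from bounding the real and imaginary parts separately; it recurs in the
    later estimates. *)
Lemma normc_integralC f b : cintegrable f ->
  mu.-integrable setT (fun x => (b x)%:E) -> (forall x, normc (f x) <= b x) ->
  normc (integralC mu f) <= 2 * (\int[mu]_x b x).
Proof.
move=> [iR iI] ib fb; apply: le_trans (normc_le_ReIm _) _.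
rewrite mulr2n mulrDl mul1r; apply: lerD => /=.
  apply: le_trans (le_normr_Rintegral _ iR) _ => //; apply: le_Rintegral => //.
    rewrite (_ : _ \o _ = (fun x => `|(Re (f x))%:E|)%E); last by [].
    exact: integrable_abse.
  by move=> x _; apply: le_trans (fb x); exact: Re_le_normc.
apply: le_trans (le_normr_Rintegral _ iI) _ => //; apply: le_Rintegral => //.
  rewrite (_ : _ \o _ = (fun x => `|(Im (f x))%:E|)%E); last by [].
  exact: integrable_abse.
by move=> x _; apply: le_trans (fb x); exact: Im_le_normc.
Qed.

End ComplexIntegral.

Section BorelGroup.
Context {R : realType} {G : lcGroupType}.
Local Notation Re := (@complex.Re R).
Local Notation Im := (@complex.Im R).

Lemma borel_open (U : set G) : open U -> @measurable _ (borel G) U.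
Proof. by move=> oU; exact: sub_sigma_algebra. Qed.

Lemma continuous_borel_measurable (f : G -> R) : continuous f ->
  @measurable_fun _ _ (borel G) R setT f.
Proof.
move=> /continuousP cf; apply: (measurability _ (RGenOpens.measurableE R)).
move=> _ [_ [a [b ->] <-]]; rewrite setTI; apply: borel_open.
exact/cf/interval_open.
Qed.

Lemma mulg_continuousl (h : G) : continuous (fun t : G => (h * t)%g).
Proof.
move=> t; apply: (@continuous_comp _ _ _ (fun t : G => (h, t)) (fun xy : G * G => (xy.1 * xy.2)%g)).
  by apply: cvg_pair; [exact: cvg_cst|exact: cvg_id].
exact: mulg_continuous.
Qed.

Lemma translate_measurable (h : G) :
  @measurable_fun _ _ (borel G) (borel G) setT (fun t => (h * t)%g).
Proof.
apply: (@measurability _ _ _ (borel G) setT _ (@open G)) => //.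
move=> _ [U oU <-]; rewrite setTI; apply: borel_open.
exact: (proj1 (@continuousP _ _ _) (@mulg_continuousl h) U oU).
Qed.

Variable mu : {measure set (borel G) -> \bar R}.
Hypothesis hmu : left_haar mu.

Lemma ge0_integral_translate (h : G) (f : borel G -> \bar R) :
  measurable_fun setT f -> (forall x, (0 <= f x)%E) ->
  (\int[mu]_x f (h * x)%g = \int[mu]_x f x)%E.
Proof.
move=> mf f0; have mh := translate_measurable h.
have [_ inv _ _ _] := hmu.
have := @ge0_integral_pushforward _ _ _ _ R _ mh mu setT f measurableT mf (fun x _ => f0 x).
rewrite preimage_setT => <-.
apply: eq_measure_integral => A mA _; exact: inv.
Qed.

Lemma integral_translate (h : G) (f : borel G -> \bar R) :
  measurable_fun setT f -> (\int[mu]_x f (h * x)%g = \int[mu]_x f x)%E.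
Proof.
move=> mf; rewrite integralE [RHS]integralE; congr (_ - _)%E.
  have p0 x : (0 <= f^\+ x)%E by exact: funepos_ge0.
  rewrite -[RHS](ge0_integral_translate h (measurable_funepos mf) p0).
  by apply: eq_integral => x _; rewrite !funeposE.
have n0 x : (0 <= f^\- x)%E by exact: funeneg_ge0.
rewrite -[RHS](ge0_integral_translate h (measurable_funeneg mf) n0).
by apply: eq_integral => x _; rewrite !funenegE.
Qed.

Lemma integralC_translate (h : G) (f : borel G -> R[i]) : measurable_funC f ->
  integralC mu (fun x => f (h * x)%g) = integralC mu f.
Proof.
move=> [mR mI]; rewrite /integralC /Rintegral.
rewrite (@integral_translate h (fun x => (Re (f x))%:E)); last exact/measurable_EFinP.
by rewrite (@integral_translate h (fun x => (Im (f x))%:E))//; exact/measurable_EFinP.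
Qed.

Lemma measurable_funC_translate (h : G) (f : borel G -> R[i]) :
  measurable_funC f -> measurable_funC (fun x : borel G => f (h * x)%g).
Proof.
by move=> [mR mI]; split; [exact: (measurableT_comp mR (translate_measurable h))
  |exact: (measurableT_comp mI (translate_measurable h))].
Qed.

End BorelGroup.

Section MatrixNorm.
Context {R : realType}.

Lemma mx_entry_le m n (A : 'M[R]_(m, n)) i j : `|A i j| <= `|A|.
Proof.
rewrite [leRHS]/Num.Def.normr/= mx_normrE.
by apply/bigmax_geP; right => /=; exists (i, j).
Qed.

Lemma mx_norm_le m n (A : 'M[R]_(m, n)) (c : R) : 0 <= c ->
  (forall i j, `|A i j| <= c) -> `|A| <= c.
Proof.
move=> c0 H; rewrite [leLHS]/Num.Def.normr/= mx_normrE.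
by apply/bigmax_leP; split => // -[i j] _ /=; exact: H.
Qed.

Lemma mulmx_norm_le m n k (A : 'M[R]_(m, n)) (B : 'M[R]_(n, k)) :
  `|A *m B| <= n%:R * `|A| * `|B|.
Proof.
apply: mx_norm_le; first by rewrite !mulr_ge0.
move=> i j; rewrite mxE; apply: le_trans (ler_norm_sum _ _ _) _.
apply: (@le_trans _ _ (\sum_(l < n) `|A| * `|B|)).
  apply: ler_sum => l _; rewrite normrM.
  by apply: ler_pM => //; exact: mx_entry_le.
by rewrite sumr_const card_ord -[leLHS]mulr_natl mulrA.
Qed.

Lemma det_norm_le n (A : 'M[R]_n) (c : R) : (forall i j, `|A i j| <= c) ->
  `|\det A| <= n`!%:R * c ^+ n.
Proof.
move=> H; apply: le_trans (ler_norm_sum _ _ _) _.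
apply: (@le_trans _ _ (\sum_(s : 'S_n) c ^+ n)).
  apply: ler_sum => s _; rewrite normrM normr_sign mul1r normr_prod.
  rewrite -[X in c ^+ X](card_ord n) -prodr_const.
  by apply: ler_prod => i _; rewrite normr_ge0 H.
by rewrite sumr_const card_Sn mulr_natl.
Qed.

End MatrixNorm.

(** * Norm estimates and the smoothing function on SL(3,R) *)

Section SL3Geometry.
Context {R : realType}.
Local Notation G := (SL 3 R).
Implicit Types (g h u : G) (s v : R).

Lemma SL_norm_mul g h : `|SLval (g * h)%g| <= 3 * `|SLval g| * `|SLval h|.
Proof. exact: mulmx_norm_le. Qed.

(** Since the determinant is [1], the entries of the inverse are signed minors of size 2. *)
Lemma SL_norm_inv g : `|SLval (g^-1)%g| <= 2 * `|SLval g| ^+ 2.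
Proof.
apply: mx_norm_le; first by rewrite mulr_ge0// exprn_ge0.
move=> i j; rewrite [SLval _](_ : _ = invmx (SLval g))//.
rewrite /invmx SL_unitmx (eqP (SLval_det g)) invr1 scale1r mxE /cofactor normrM normr_sign mul1r.
by apply: (@det_norm_le _ 2) => k l; rewrite !mxE; exact: mx_entry_le.
Qed.

Lemma norm_mx1 : `|1%:M : 'M[R]_3| <= 1.
Proof.
apply: mx_norm_le => // i j; rewrite mxE.
by case: (i == j); rewrite ?normr1 ?normr0.
Qed.

(** The smoothing function. It is Lipschitz with constant [1], which is what measures a change of
    mesh. *)
Definition tent g : R := Num.max 0 (1 - `|SLval g - 1%:M|).

Lemma tent_ge0 g : 0 <= tent g. Proof. by rewrite le_max lexx. Qed.

Lemma tent_le1 g : tent g <= 1.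
Proof. by rewrite ge_max ler01 lerBlDr lerDl normr_ge0. Qed.

Lemma tent_support g : tent g != 0 -> `|SLval g| <= 2.
Proof.
move=> b0; rewrite -[SLval g](subrK 1%:M); apply: le_trans (ler_normD _ _) _.
have -> : 2 = 1 + 1 :> R by [].
apply: lerD; last exact: norm_mx1.
by rewrite leNgt; apply: contraNN b0 => h; rewrite /tent max_l// subr_le0 ltW.
Qed.

Lemma mx_tent_lip (A B : 'M[R]_3) :
  `|Num.max 0 (1 - `|A - 1%:M|) - Num.max 0 (1 - `|B - 1%:M|)| <= `|A - B|.
Proof.
have lip (a b : R) : `|Num.max 0 a - Num.max 0 b| <= `|a - b|.
  have [a0|a0] := leP 0 a; have [b0|b0] := leP 0 b => //.
  - by rewrite subr0 ger0_norm// ger0_norm ?subr_ge0 ?(le_trans (ltW b0))// lerDl oppr_ge0 ltW.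
  - by rewrite sub0r normrN ger0_norm// distrC ger0_norm ?subr_ge0 ?(le_trans (ltW a0))// lerDl oppr_ge0 ltW.
  - by rewrite subrr normr0.
apply: le_trans (lip _ _) _; rewrite opprB addrC addrA subrK distrC.
apply: le_trans (ler_dist_dist _ _) _.
by rewrite opprB addrA subrK.
Qed.

Lemma tent_lip g h : `|tent g - tent h| <= `|SLval g - SLval h|.
Proof. exact: mx_tent_lip. Qed.

Lemma tent_continuous : continuous (tent : G -> R).
Proof.
move=> g; apply: (proj2 (@cvgrPdist_lt R R^o G (nbhs g) (nbhs_filter g) tent (tent g))) => e e0.
have H : nbhs g (@SLval 3 R @^-1` ball (SLval g) e).
  by apply: SLval_continuous; exact: nbhsx_ballx.
apply: (@filterS G (nbhs g) (@nbhs_filter G g) _ _ _ H) => h.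
rewrite /preimage/= -ball_normE/= => gh.
by apply: le_lt_trans (mx_tent_lip _ _) _.
Qed.

Lemma elem_norm (i j : 'I_3) (ij : i != j) s : `|SLval (elem ij s)| <= 1 + `|s|.
Proof.
apply: le_trans (ler_normD _ _) _; apply: lerD; first exact: norm_mx1.
rewrite normrZ -[leRHS]mulr1 ler_wpM2l//; apply: mx_norm_le => // k l.
by rewrite mxE; case: (_ && _); rewrite ?normr1 ?normr0.
Qed.

Lemma elem_lip (i j : 'I_3) (ij : i != j) s v :
  `|SLval (elem ij s) - SLval (elem ij v)| <= `|s - v|.
Proof.
rewrite /= opprD addrACA subrr add0r -scalerBl normrZ -[leRHS]mulr1 ler_wpM2l//.
by apply: mx_norm_le => // k l; rewrite mxE; case: (_ && _); rewrite ?normr1 ?normr0.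
Qed.

(** [word] with real parameters, so that two meshes can be compared. *)
Definition pword (s v s' : R) : G := (x0 s * x2 v * x4 s')%g.

Lemma pwordV s v s' : (pword s v s')^-1%g = (x4 (- s') * x2 (- v) * x0 (- s))%g.
Proof. by rewrite /pword !invgM !elemV mulgA. Qed.

Lemma mul3_norm (a b c : G) (r1 r2 r3 : R) : `|SLval a| <= r1 -> `|SLval b| <= r2 -> `|SLval c| <= r3 ->
  `|SLval (a * b * c)%g| <= 9 * r1 * r2 * r3.
Proof.
move=> h1 h2 h3; apply: le_trans (SL_norm_mul _ _) _.
have r10 : 0 <= r1 by apply: le_trans h1.
have r20 : 0 <= r2 by apply: le_trans h2.
have -> : 9 * r1 * r2 * r3 = 3 * (3 * r1 * r2) * r3 by ring.
apply: ler_pM => //; rewrite ler_wpM2l//; apply: le_trans (SL_norm_mul _ _) _.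
by apply: ler_pM; rewrite ?mulr_ge0 ?ler_wpM2l.
Qed.

Lemma pword_norm s v s' (T : R) : `|s| <= 1 -> `|v| <= T -> `|s'| <= 1 ->
  `|SLval (pword s v s')| <= 36 * (1 + T).
Proof.
move=> s1 vT s'1.
have -> : 36 * (1 + T) = 9 * 2 * (1 + T) * 2 by ring.
by apply: mul3_norm; apply: le_trans (elem_norm _ _) _; rewrite ?lerD2l.
Qed.

Lemma pwordV_lip s v s' s2 s2' (T dl : R) : `|s| <= 1 -> `|v| <= T -> `|s2'| <= 1 ->
  `|s - s2| <= dl -> `|s' - s2'| <= dl ->
  `|SLval (pword s v s')^-1%g - SLval (pword s2 v s2')^-1%g| <= 36 * (1 + T) * dl.
Proof.
move=> s1 vT s2'1 ds ds'; rewrite !pwordV.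
have T0 : 0 <= T by apply: le_trans vT.
have dl0 : 0 <= dl by apply: le_trans ds.
have two : 2 = 1 + 1 :> R by [].
have E (a b c a' c' : 'M[R]_3) : a *m b *m c - a' *m b *m c' =
    (a - a') *m b *m c + a' *m b *m (c - c').
  by rewrite !mulmxBl mulmxBr addrA subrK.
rewrite /= E; apply: le_trans (ler_normD _ _) _.
have P (a b c : 'M[R]_3) (r1 r2 r3 : R) : `|a| <= r1 -> `|b| <= r2 -> `|c| <= r3 ->
    `|a *m b *m c| <= 9 * r1 * r2 * r3.
  move=> h1 h2 h3; apply: le_trans (mulmx_norm_le _ _) _.
  have r10 : 0 <= r1 by apply: le_trans h1.
  have r20 : 0 <= r2 by apply: le_trans h2.
  have -> : 9 * r1 * r2 * r3 = 3 * (3 * r1 * r2) * r3 by ring.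
  apply: ler_pM => //; rewrite ler_wpM2l//; apply: le_trans (mulmx_norm_le _ _) _.
  by apply: ler_pM; rewrite ?mulr_ge0 ?ler_wpM2l.
have -> : 36 * (1 + T) * dl = 9 * dl * (1 + T) * 2 + 9 * 2 * (1 + T) * dl by ring.
apply: lerD; apply: P.
- by apply: le_trans (elem_lip _ _ _) _ => //; rewrite opprK addrC distrC.
- by apply: le_trans (elem_norm _ _) _ => //; rewrite normrN lerD2l.
- by apply: le_trans (elem_norm _ _) _ => //; rewrite normrN two lerD2l.
- by apply: le_trans (elem_norm _ _) _ => //; rewrite normrN two lerD2l.
- by apply: le_trans (elem_norm _ _) _ => //; rewrite normrN lerD2l.
- by apply: le_trans (elem_lip _ _ _) _ => //; rewrite opprK addrC distrC.
Qed.

Lemma pword_entry s v s' : SLval (pword s v s') o1 o2 = v.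
Proof.
do 3! rewrite ?mxE ?big_ord_recl ?big_ord0 /=.
ring.
Qed.

(** The entry [v] of the word is recovered after multiplication by [u^-1], whose norm is at most
    [8]; a large [v] thus carries a whole ball of points [u] far away. *)
Lemma pword_far s v s' u : 0 <= v -> `|SLval u| <= 2 ->
  v <= 24 * `|SLval (pword s v s' * u)%g|.
Proof.
move=> v0 u2.
have : `|SLval (pword s v s' * u * u^-1)%g| <= 3 * `|SLval (pword s v s' * u)%g| * 8.
  apply: le_trans (SL_norm_mul _ _) _; rewrite ler_wpM2l ?mulr_ge0//.
  apply: le_trans (SL_norm_inv _) _.
  have -> : 8 = 2 * 2 ^+ 2 :> R by ring.
  by rewrite ler_wpM2l// lerXn2r ?nnegrE.
rewrite mulgK => h.
have := mx_entry_le (SLval (pword s v s')) o1 o2; rewrite pword_entry ger0_norm//; lra.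
Qed.

(** The indicator makes the bound integrable: both translates of the bump live in the ball of radius
    [216 * (1 + T)], where [216 = 3 * 36 * 2]. *)
Lemma tent_pword_lip s v s' s2 s2' (T dl : R) u : `|s| <= 1 -> `|s'| <= 1 -> `|s2| <= 1 -> `|s2'| <= 1 ->
  `|v| <= T -> `|s - s2| <= dl -> `|s' - s2'| <= dl ->
  `|tent ((pword s v s')^-1 * u)%g - tent ((pword s2 v s2')^-1 * u)%g| <=
    (108 * (1 + T)) * (216 * (1 + T)) * dl * (`|SLval u| <= 216 * (1 + T))%R%:R.
Proof.
move=> s1 s'1 s21 s2'1 vT ds ds'.
have T0 : 0 <= T by apply: le_trans vT.
have dl0 : 0 <= dl by apply: le_trans ds.
have supp r r' : `|r| <= 1 -> `|r'| <= 1 -> tent ((pword r v r')^-1 * u)%g != 0 ->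
    `|SLval u| <= 216 * (1 + T).
  move=> r1 r'1 /tent_support b2.
  rewrite -[u](mulKg (pword r v r')^-1%g) invgK.
  apply: le_trans (SL_norm_mul _ _) _.
  have -> : 216 * (1 + T) = 3 * (36 * (1 + T)) * 2 by ring.
  by apply: ler_pM => //; rewrite ler_wpM2l// pword_norm.
have [uB|uB] := leP `|SLval u| (216 * (1 + T)); last first.
  have z r r' : `|r| <= 1 -> `|r'| <= 1 -> tent ((pword r v r')^-1 * u)%g = 0.
    by move=> r1 r'1; apply/eqP; apply: contraTT uB => /supp; rewrite -leNgt; apply.
  by rewrite !z// subrr normr0 mulr0.
rewrite mulr1; apply: le_trans (tent_lip _ _) _.
have -> : SLval ((pword s v s')^-1 * u)%g - SLval ((pword s2 v s2')^-1 * u)%g =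
   (SLval (pword s v s')^-1%g - SLval (pword s2 v s2')^-1%g) *m SLval u by rewrite mulmxBl.
apply: le_trans (mulmx_norm_le _ _) _.
have -> : 108 * (1 + T) * (216 * (1 + T)) * dl = 3 * (36 * (1 + T) * dl) * (216 * (1 + T)) by ring.
by apply: ler_pM => //; rewrite ler_wpM2l// pwordV_lip.
Qed.

End SL3Geometry.

(** * A_p and vanishing at infinity *)

Section LpPairing.
Context {R : realType}.
Local Notation G := (SL 3 R).
Local Notation normc := Normc.normc.
Variables (mu : {measure set (borel G) -> \bar R}) (p : R).
Hypotheses (hmu : left_haar mu) (p1 : 1 < p).

Local Notation q := (p / (p - 1)).

Let p0 : 0 < p. Proof. exact: lt_trans p1. Qed.
Let q0 : 0 < q. Proof. by rewrite divr_gt0// subr_gt0. Qed.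

Lemma hoelder_conjugate_fin : hoelder_conjugate p%:E = q%:E.
Proof.
rewrite /hoelder_conjugate/= eqe (gt_eqF p0) -EFinD inver subr_eq0 (gt_eqF p1).
by rewrite -EFinM.
Qed.

Lemma Lp_normE (r : R) (f : borel G -> R[i]) : 0 < r ->
  Lp_norm mu r%:E f = ((\int[mu]_t ((normc (f t)) `^ r)%:E) `^ r^-1)%E.
Proof.
move=> r0; rewrite -Lp_norm_powR// -poweRrM mulfV ?gt_eqF//.
by rewrite poweRe1// Lp_norm_ge0.
Qed.

Lemma integral_powR_ge0 (r : R) (f : borel G -> R[i]) :
  (0 <= \int[mu]_t ((normc (f t)) `^ r)%:E)%E.
Proof. by apply: integral_ge0 => t _; rewrite lee_fin powR_ge0. Qed.

Lemma Lp_norm_mono (r : R) (f g : borel G -> R[i]) : 0 < r ->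
  measurable_funC f -> measurable_funC g ->
  (forall t, normc (f t) <= normc (g t)) ->
  (Lp_norm mu r%:E f <= Lp_norm mu r%:E g)%E.
Proof.
move=> r0 mf mg fg; rewrite (Lp_normE f r0) (Lp_normE g r0).
apply: gt0_ler_poweR.
- by rewrite invr_ge0 ltW.
- by rewrite in_itv/= leey integral_powR_ge0.
- by rewrite in_itv/= leey integral_powR_ge0.
apply: ge0_le_integral => //.
- by move=> t _; rewrite lee_fin powR_ge0.
- exact: measurable_powR_normc.
- exact: measurable_powR_normc.
move=> t _; rewrite lee_fin.
by rewrite ge0_ler_powR ?nnegrE ?normc_ge0 ?(ltW r0).
Qed.

Lemma Lp_norm_leP (r a : R) (f : borel G -> R[i]) : 0 < r -> 0 <= a ->
  (\int[mu]_t ((normc (f t)) `^ r)%:E <= (a `^ r)%:E)%E ->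
  (Lp_norm mu r%:E f <= a%:E)%E.
Proof.
move=> r0 a0 h; rewrite (Lp_normE f r0).
have -> : a%:E = ((a `^ r)%:E `^ r^-1)%E.
  by rewrite poweR_EFin -powRrM mulfV ?gt_eqF// powRr1.
apply: gt0_ler_poweR => //.
- by rewrite invr_ge0 ltW.
- by rewrite in_itv/= leey integral_powR_ge0.
- by rewrite in_itv/= leey lee_fin powR_ge0.
Qed.

Lemma pairing_hoelder (g f : borel G -> R[i]) : Lp mu q%:E g -> Lp mu p%:E f ->
  cintegrable mu (fun t => g t * f t) /\
  ((normc (Lp_pairing mu g f))%:E <= 2%:E * (Lp_norm mu q%:E g * Lp_norm mu p%:E f))%E.
Proof.
move=> [mg ng] [mf nf].
have mG := measurable_normc mg; have mF := measurable_normc mf.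
have qp : q^-1 + p^-1 = 1.
  by rewrite invf_div; field; rewrite gt_eqF// gt_eqF ?subr_gt0.
have H := hoelder mu mG mF q0 p0 qp.
have {}H : (\int[mu]_t (normc (g t) * normc (f t))%:E <=
    Lp_norm mu q%:E g * Lp_norm mu p%:E f)%E.
  apply: le_trans H; rewrite Lnorm1 le_eqVlt; apply/orP; left; apply/eqP.
  by apply: eq_integral => t _; rewrite /= ger0_norm// mulr_ge0 ?normc_ge0.
have fin : (\int[mu]_t (normc (g t) * normc (f t))%:E < +oo)%E.
  by apply: le_lt_trans H _; rewrite lte_mul_pinfty ?Lp_norm_ge0// ge0_fin_numE ?Lp_norm_ge0.
have i0 : (0 <= \int[mu]_t (normc (g t) * normc (f t))%:E)%E.
  by apply: integral_ge0 => t _; rewrite lee_fin mulr_ge0 ?normc_ge0.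
have ib : mu.-integrable setT (fun t => (normc (g t) * normc (f t))%:E).
  apply/integrableP; split; first by apply/measurable_EFinP; exact: measurable_funM.
  apply: le_lt_trans fin; rewrite le_eqVlt; apply/orP; left; apply/eqP.
  by apply: eq_integral => t _; rewrite /= ger0_norm// mulr_ge0 ?normc_ge0.
have le t : normc (g t * f t) <= normc (g t) * normc (f t) by rewrite Normc.normcM.
have ci : cintegrable mu (fun t => g t * f t).
  by apply: cintegrable_dom ib le; exact: measurable_funC_mul.
split=> //; apply: (@le_trans _ _ (2%:E * \int[mu]_t (normc (g t) * normc (f t))%:E)%E).
  rewrite -(@fineK _ (\int[mu]_t (normc (g t) * normc (f t))%:E)%E); last by rewrite ge0_fin_numE.
  rewrite -EFinM lee_fin; exact: normc_integralC ci ib le.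
by apply: lee_wpmul2l.
Qed.

Lemma left_regular_Lp (s : G) (f : borel G -> R[i]) : Lp mu p%:E f ->
  Lp mu p%:E (left_regular s f) /\
  Lp_norm mu p%:E (left_regular s f) = Lp_norm mu p%:E f.
Proof.
move=> [mf nf].
have E : Lp_norm mu p%:E (left_regular s f) = Lp_norm mu p%:E f.
  have nn (t : borel G) : (0 <= ((normc (f t)) `^ p)%:E)%E by rewrite lee_fin powR_ge0.
  have H := ge0_integral_translate hmu (s^-1)%g (measurable_powR_normc p mf) nn.
  apply: etrans (Lp_normE (left_regular s f) p0) _; apply: etrans (esym (Lp_normE f p0)).
  exact: (congr1 (fun v => (v `^ p^-1)%E) H).
split=> //; split; last by rewrite E.
exact: measurable_funC_translate.
Qed.

Definition far_box (k : nat) : set (borel G) := [set t | `|SLval (t : G)| <= k%:R].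

Lemma measurable_far_box k : measurable (far_box k).
Proof.
rewrite -[far_box k]setCK; apply: measurableC; apply: borel_open.
have -> : ~` far_box k = (@SLval 3 R) @^-1` [set A | k%:R < `|A|].
  apply/seteqP; split => t; rewrite /far_box /=.
    by move=> /negP; rewrite -ltNge.
  by rewrite ltNge => /negP.
apply: open_comp => [t _|]; first exact: SLval_continuous.
have -> : [set A : 'M[R]_3 | k%:R < `|A|] = Num.norm @^-1` [set x : R | k%:R < x] by [].
by apply: open_comp => [A _|]; [exact: norm_continuous|exact: open_gt].
Qed.

Definition tail (k : nat) (f : borel G -> R[i]) : borel G -> R[i] :=
  fun t => if `|SLval (t : G)| <= k%:R then 0 else f t.

Definition core (k : nat) (f : borel G -> R[i]) : borel G -> R[i] :=
  fun t => if `|SLval (t : G)| <= k%:R then f t else 0.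

Lemma measurable_core k f : measurable_funC f -> measurable_funC (core k f).
Proof.
move=> mf.
have -> : core k f = (fun t => (\1_(far_box k) t)%:C%C * f t).
  apply/funext => t; rewrite /core indicE.
  case: ifPn => h; first by rewrite mem_set// mul1r.
  by rewrite memNset ?mul0r// /far_box /=; exact/negP.
apply: measurable_funC_mul => //; apply: measurable_funC_real.
by apply: measurable_indic; exact: measurable_far_box.
Qed.

Lemma measurable_tail k f : measurable_funC f -> measurable_funC (tail k f).
Proof.
move=> mf.
have -> : tail k f = (fun t => f t + -1 * core k f t).
  apply/funext => t; rewrite /tail /core.
  by case: ifP => _; rewrite ?mulr0 ?addr0// mulN1r subrr.
apply: measurable_funC_add => //; apply: measurable_funC_mul; first exact: measurable_funC_cst.
exact: measurable_core.
Qed.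

Lemma normc_tail_le k f t : normc (tail k f t) <= normc (f t).
Proof. by rewrite /tail; case: ifP => // _; rewrite Normc.normc0 normc_ge0. Qed.

Lemma normc_core_le k f t : normc (core k f t) <= normc (f t).
Proof. by rewrite /core; case: ifP => // _; rewrite Normc.normc0 normc_ge0. Qed.

Lemma tail_small (r : R) (f : borel G -> R[i]) (e : R) : 0 < r -> 0 < e ->
  Lp mu r%:E f -> \forall k \near \oo, (Lp_norm mu r%:E (tail k f) <= e%:E)%E.
Proof.
move=> r0 e0 [mf nf].
pose F (k : nat) (t : borel G) := ((normc (tail k f t)) `^ r)%:E.
have intf : mu.-integrable setT (fun t => ((normc (f t)) `^ r)%:E).
  apply/integrableP; split; first exact: measurable_powR_normc.
  under eq_integral do rewrite /= ger0_norm ?powR_ge0//.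
  by rewrite -Lp_norm_powR//; exact: poweR_lty.
have cv : (\int[mu]_t F k t)%E @[k --> \oo] --> (\int[mu]_t (cst 0 t : \bar R))%E.
  apply: (@dominated_cvg _ _ _ mu setT measurableT F (cst 0%E) (fun t => ((normc (f t)) `^ r)%:E)) => //.
  - by move=> k; apply: measurable_powR_normc; exact: measurable_tail.
  - move=> t _; apply: cvg_near_cst; exists (Num.truncn `|SLval (t : G)|).+1 => // k /= tk.
    rewrite /F /tail ifT ?Normc.normc0 ?powR0 ?gt_eqF//.
    by rewrite ltW// (lt_le_trans (truncnS_gt _))// ler_nat.
  - move=> k t _; rewrite /F /= lee_fin ger0_norm ?powR_ge0//.
    by rewrite ge0_ler_powR ?nnegrE ?normc_ge0 ?(ltW r0)// normc_tail_le.
rewrite integral0 in cv.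
have : \forall k \near \oo, (\int[mu]_t F k t < (e `^ r)%:E)%E.
  have H : ereal_nbhs 0%E (fun u : \bar R => (u < (e `^ r)%:E)%E).
    by apply: open_ereal_lt'; rewrite lte_fin powR_gt0.
  exact: (cv _ H).
apply: filterS => k /ltW h; apply: Lp_norm_leP => //; exact: ltW.
Qed.

End LpPairing.

Section HerzVanish.
Context {R : realType}.
Local Notation G := (SL 3 R).
Local Notation normc := Normc.normc.
Variables (mu : {measure set (borel G) -> \bar R}) (p : R).
Hypotheses (hmu : left_haar mu) (p1 : 1 < p).

Local Notation q := (p / (p - 1)).

Let p0 : 0 < p. Proof. exact: lt_trans p1. Qed.
Let q0 : 0 < q. Proof. by rewrite divr_gt0// subr_gt0. Qed.

Lemma Lp_tail (r : R) k f : 0 < r -> Lp mu r%:E f -> Lp mu r%:E (tail k f).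
Proof.
move=> r0 [mf nf]; have mt := measurable_tail k mf; split=> //.
by apply: le_lt_trans nf; apply: Lp_norm_mono => // t; exact: normc_tail_le.
Qed.

Lemma Lp_core (r : R) k f : 0 < r -> Lp mu r%:E f -> Lp mu r%:E (core k f).
Proof.
move=> r0 [mf nf]; have mt := measurable_core k mf; split=> //.
by apply: le_lt_trans nf; apply: Lp_norm_mono => // t; exact: normc_core_le.
Qed.

(** Norm balls of SL(3,R) are compact, so this is vanishing at infinity. *)
Definition vanishing (phi : G -> R[i]) := forall e : R, 0 < e ->
  exists r : R, forall s : G, r < `|SLval s| -> normc (phi s) <= e.

Lemma vanishing_add phi psi : vanishing phi -> vanishing psi ->
  vanishing (fun s => phi s + psi s).
Proof.
move=> v1 v2 e e0; have e2 : 0 < e / 2 by rewrite divr_gt0.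
have [r1 h1] := v1 _ e2; have [r2 h2] := v2 _ e2.
exists (Num.max r1 r2) => s; rewrite gt_max => /andP[s1 s2].
apply: le_trans (ler_normcD _ _) _; rewrite [leRHS](splitr e).
by apply: lerD; [exact: h1|exact: h2].
Qed.

(** A ball catches most of [g] and of [f]. For [s] far away, [t] and [s^-1 * t] cannot both lie in
    it, so the pairing only sees one of the two small tails. *)
Lemma pairing_vanishing g f : Lp mu q%:E g -> Lp mu p%:E f ->
  vanishing (fun s => Lp_pairing mu g (left_regular s f)).
Proof.
move=> Lg Lf e e0.
have fing : Lp_norm mu q%:E g \is a fin_num by rewrite ge0_fin_numE ?Lp_norm_ge0//; case: Lg.
have finf : Lp_norm mu p%:E f \is a fin_num by rewrite ge0_fin_numE ?Lp_norm_ge0//; case: Lf.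
set a := fine (Lp_norm mu q%:E g); set b := fine (Lp_norm mu p%:E f).
have a0 : 0 <= a by rewrite fine_ge0// Lp_norm_ge0.
have b0 : 0 <= b by rewrite fine_ge0// Lp_norm_ge0.
pose e' := e / (2 * (a + b + 1)).
have ab1 : 0 < a + b + 1 by rewrite ltr_wpDl// addr_ge0.
have e'0 : 0 < e' by rewrite divr_gt0// mulr_gt0.
have [K1 _ H1] := tail_small q0 e'0 Lg.
have [K2 _ H2] := tail_small p0 e'0 Lf.
pose k := maxn K1 K2.
have tg : (Lp_norm mu q%:E (tail k g) <= e'%:E)%E by apply: H1; exact: leq_maxl.
have tf : (Lp_norm mu p%:E (tail k f) <= e'%:E)%E by apply: H2; exact: leq_maxr.
(* This bounds the norm of [s = t * (s^-1 * t)^-1] when [t] and [s^-1 * t] both have norm at most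
   [k]. *)
exists (3 * k%:R * (2 * k%:R ^+ 2)) => s sfar.
have sep (t : G) : `|SLval t| <= k%:R -> k%:R < `|SLval (s^-1 * t)%g|.
  move=> tk; rewrite ltNge; apply: contraTN sfar => stk; rewrite -leNgt.
  have -> : s = (t * (s^-1 * t)^-1)%g by rewrite invgM invgK mulgA mulgV mul1g.
  apply: le_trans (SL_norm_mul _ _) _; apply: ler_pM => //.
    by rewrite ler_wpM2l.
  apply: le_trans (SL_norm_inv _) _; rewrite ler_wpM2l//.
  by rewrite lerXn2r ?nnegrE.
have [Lf1 Nf1] := left_regular_Lp hmu p1 s Lf.
have [Lf2 Nf2] := left_regular_Lp hmu p1 s (Lp_tail k p0 Lf).
have [c1 n1] := pairing_hoelder p1 (Lp_tail k q0 Lg) Lf1.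
have [c2 n2] := pairing_hoelder p1 (Lp_core k q0 Lg) Lf2.
have -> : Lp_pairing mu g (left_regular s f) =
    Lp_pairing mu (tail k g) (left_regular s f) +
    Lp_pairing mu (core k g) (left_regular s (tail k f)).
  rewrite -[X in X + _]mul1r -(integralC_lin 1 c1 c2).
  congr (integralC mu _); apply/funext => t; rewrite mul1r /left_regular /core.
  have [tk|tk] := boolP (`|SLval (t : G)| <= k%:R).
    by rewrite /tail tk mul0r add0r leNgt sep.
  by rewrite {1}/tail (negbTE tk) mul0r addr0.
apply: le_trans (ler_normcD _ _) _.
have m1 : normc (Lp_pairing mu (tail k g) (left_regular s f)) <= 2 * (e' * b).
  rewrite -lee_fin; apply: le_trans n1 _; rewrite [leRHS]EFinM; apply: lee_wpmul2l => //.
  rewrite Nf1 [leRHS]EFinM fineK//; apply: lee_pmul => //; exact: Lp_norm_ge0.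
have m2 : normc (Lp_pairing mu (core k g) (left_regular s (tail k f))) <= 2 * (a * e').
  rewrite -lee_fin; apply: le_trans n2 _; rewrite [leRHS]EFinM; apply: lee_wpmul2l => //.
  rewrite Nf2 [leRHS]EFinM fineK//; apply: lee_pmul => //; try exact: Lp_norm_ge0.
  case: Lg => mg _; apply: Lp_norm_mono => //; first exact: measurable_core.
  by move=> t; exact: normc_core_le.
apply: le_trans (lerD m1 m2) _.
have -> : e = 2 * (e' * (a + b + 1)).
  by rewrite /e'; field; rewrite gt_eqF.
by have := ltW e'0; nra.
Qed.

Lemma tensor_wf_cons x u : tensor_wf mu p (x :: u) ->
  [/\ Lp mu q%:E x.1, Lp mu p%:E x.2 & tensor_wf mu p u].
Proof.
rewrite /tensor_wf (hoelder_conjugate_fin p1) => h; have [h1 h2] := h 0%N isT.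
by split=> // i iu; exact: (h i.+1).
Qed.

Lemma Lambda_vanishing u : tensor_wf mu p u -> vanishing (Lambda mu u).
Proof.
elim: u => [_|x u ih /tensor_wf_cons[h1 h2 /ih v]].
  by move=> e e0; exists 0 => s _; rewrite /Lambda big_nil Normc.normc0 ltW.
have -> : Lambda mu (x :: u) =
    (fun s => Lp_pairing mu x.1 (left_regular s x.2) + Lambda mu u s).
  by apply/funext => s; rewrite /Lambda big_cons.
by apply: vanishing_add => //; exact: pairing_vanishing.
Qed.

(** Makes [tensor_eq] applicable to [Lambda], whose value at [s] then depends on the algebraic
    tensor and not on the list representing it. *)
Lemma Lp_bilinear_pairing s :
  Lp_bilinear mu p (fun g f => Lp_pairing mu g (left_regular s f)).
Proof.
rewrite /Lp_bilinear (hoelder_conjugate_fin p1); split.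
- move=> a g1 g2 f L1 L2 Lf; have [Lf1 _] := left_regular_Lp hmu p1 s Lf.
  have [c1 _] := pairing_hoelder p1 L1 Lf1; have [c2 _] := pairing_hoelder p1 L2 Lf1.
  rewrite /Lp_pairing -(integralC_lin a c1 c2); congr (integralC mu _).
  by apply/funext => t; ring.
- move=> a g f1 f2 Lg L1 L2.
  have [Lf1 _] := left_regular_Lp hmu p1 s L1; have [Lf2 _] := left_regular_Lp hmu p1 s L2.
  have [c1 _] := pairing_hoelder p1 Lg Lf1; have [c2 _] := pairing_hoelder p1 Lg Lf2.
  rewrite /Lp_pairing -(integralC_lin a c1 c2); congr (integralC mu _).
  by apply/funext => t; rewrite /left_regular; ring.
- move=> g f Lg Lf g0; have [Lf1 _] := left_regular_Lp hmu p1 s Lf.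
  have [_] := pairing_hoelder p1 Lg Lf1; rewrite g0 mul0e mule0 lee_fin => h.
  by apply: Normc.eq0_normc; apply/eqP; rewrite eq_le h normc_ge0.
- move=> g f Lg Lf f0; have [Lf1 Nf1] := left_regular_Lp hmu p1 s Lf.
  have [_] := pairing_hoelder p1 Lg Lf1; rewrite Nf1 f0 mule0 mule0 lee_fin => h.
  by apply: Normc.eq0_normc; apply/eqP; rewrite eq_le h normc_ge0.
Qed.

(** Uniformity in [s] is the point: it lets vanishing at infinity pass from the algebraic tensors to
    their Cauchy limits. *)
Lemma Lambda_le u s :
  ((normc (Lambda mu u s) / 2)%:E <= projective_norm mu p u)%E.
Proof.
apply: le_ereal_inf_tmp => _ [v [wv uv] <-].
rewrite /Lambda (uv _ (Lp_bilinear_pairing s)) (hoelder_conjugate_fin p1).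
elim: v wv {uv} => [_|x v ih /tensor_wf_cons[h1 h2 /ih {}ih]].
  by rewrite !big_nil Normc.normc0 mul0r.
rewrite !big_cons.
have [Lf1 Nf1] := left_regular_Lp hmu p1 s h2.
have [_ n1] := pairing_hoelder p1 h1 Lf1; rewrite Nf1 in n1.
apply: (@le_trans _ _ ((normc (Lp_pairing mu x.1 (left_regular s x.2)) / 2)%:E +
   (normc (\sum_(y <- v) Lp_pairing mu y.1 (left_regular s y.2)) / 2)%:E)%E).
  by rewrite -EFinD lee_fin -mulrDl ler_wpM2r ?invr_ge0// ler_normcD.
apply: leeD => //.
rewrite mulrC EFinM; apply: le_trans (lee_wpmul2l _ n1) _; first by rewrite lee_fin invr_ge0.
by rewrite muleA -EFinM mulVf ?mul1e// pnatr_eq0.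
Qed.

Lemma Lambda_sub u v s : tensor_wf mu p v ->
  Lambda mu (tensor_sub u v) s = Lambda mu u s - Lambda mu v s.
Proof.
move=> wv; rewrite /Lambda /tensor_sub big_cat big_map/=; congr (_ + _).
elim: v wv => [_|x v ih /tensor_wf_cons[h1 h2 /ih {}ih]].
  by rewrite !big_nil oppr0.
rewrite !big_cons ih opprD; congr (_ + _).
have [Lf1 _] := left_regular_Lp hmu p1 s h2.
have [c1 _] := pairing_hoelder p1 h1 Lf1.
transitivity (-1 * Lp_pairing mu x.1 (left_regular s x.2) + integralC mu (fun=> 0)).
  rewrite -(integralC_lin (-1) c1 (cintegrable0 mu)).
  by congr (integralC mu _); apply/funext => t; rewrite addr0 mulN1r mulNr.
by rewrite integralC0 addr0 mulN1r.
Qed.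

Lemma Ap_vanishing phi : Ap mu p phi -> vanishing phi.
Proof.
move=> [u [wu cu lu]] e e0.
have e80 : 0 < e / 8 by rewrite divr_gt0.
have [N HN] := cu _ e80.
have e20 : 0 < e / 2 by rewrite divr_gt0.
have e40 : 0 < e / 4 by rewrite divr_gt0.
have [r Hr] := Lambda_vanishing (wu N) e20.
exists r => s rs.
have /cvgrPdist_lt/(_ _ e40)[K _ HK] := lu s.
pose m := maxn K N.
have h1 : normc (Lambda mu (u m) s - phi s) < e / 4.
  have := HK m (leq_maxl _ _); rewrite sub0r normrN ger0_norm//; exact: normc_ge0.
have h2 : normc (Lambda mu (u m) s - Lambda mu (u N) s) <= e / 4.
  rewrite -Lambda_sub; last exact: wu.
  have := le_lt_trans (Lambda_le (tensor_sub (u m) (u N)) s) (HN m N (leq_maxr _ _) (leqnn _)).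
  by rewrite lte_fin; lra.
have h3 := Hr s rs.
have -> : phi s = Lambda mu (u N) s + (Lambda mu (u m) s - Lambda mu (u N) s)
    - (Lambda mu (u m) s - phi s) by ring.
apply: le_trans (ler_normcB _ _) _.
have := ler_normcD (Lambda mu (u N) s) (Lambda mu (u m) s - Lambda mu (u N) s).
by move: h1 h2 h3; lra.
Qed.

End HerzVanish.

(** * Haar integral of the smoothing function *)

Section TentIntegral.
Context {R : realType}.
Local Notation G := (SL 3 R).
Local Notation normc := Normc.normc.
Variables (mu : {measure set (borel G) -> \bar R}).
Hypotheses (hmu : left_haar mu).

Lemma far_box_finite k : (mu (far_box k) < +oo)%E.
Proof.
have [_ _ Kfin _ _] := hmu; apply: Kfin.
have -> : far_box k = [set A : G | forall i j, SLval A i j \in `[(- k%:R), k%:R]].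
  apply/seteqP; split => A /= h.
    move=> i j; rewrite in_itv/= -ler_norml; apply: le_trans h; exact: mx_entry_le.
  by apply: mx_norm_le => // i j; have := h i j; rewrite in_itv/= -ler_norml.
exact: SL_box_compact.
Qed.

Lemma integrable_far_box (c : R) k :
  mu.-integrable setT (fun t => (c * (`|SLval (t : G)| <= k%:R)%R%:R)%:E).
Proof.
have -> : (fun t : borel G => (c * (`|SLval (t : G)| <= k%:R)%R%:R)%:E) =
    (fun t => c%:E * (\1_(far_box k) t)%:E)%E.
  apply/funext => t; rewrite -EFinM indicE; congr (_ * _%:R)%:E.
  by have [h|h] := boolP (`|SLval (t : G)| <= k%:R); [rewrite mem_set|rewrite memNset//; exact/negP].
apply: integrableZl => //; apply/integrableP; split.
  by apply/measurable_EFinP; apply: measurable_indic; exact: measurable_far_box.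
have -> : (\int[mu]_t `|(\1_(far_box k) t)%:E| = \int[mu]_t (\1_(far_box k) t)%:E)%E.
  by apply: eq_integral => t _; rewrite /= ger0_norm// indicE.
rewrite (@integral_indic _ _ _ mu setT measurableT (far_box k) (measurable_far_box k)) setIT.
exact: far_box_finite.
Qed.

Lemma Rintegral_far_box (c : R) k :
  (\int[mu]_t (c * (`|SLval (t : G)| <= k%:R)%R%:R) = c * fine (mu (far_box k)))%R.
Proof.
have i1 : mu.-integrable setT (EFin \o (fun t : borel G => (`|SLval (t : G)| <= k%:R)%R%:R : R)).
  have := integrable_far_box 1 k; congr (mu.-integrable _ _).
  by apply/funext => t; rewrite /= mul1r.
rewrite RintegralZl//; congr (_ * _); rewrite /Rintegral; congr fine.
rewrite -[in RHS](setIT (far_box k)) -(@integral_indic _ _ _ mu setT measurableT (far_box k) (measurable_far_box k)).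
apply: eq_integral => t _; rewrite indicE; congr (_%:R)%:E.
by have [h|h] := boolP (`|SLval (t : G)| <= k%:R); [rewrite mem_set|rewrite memNset//; exact/negP].
Qed.

Lemma tent_measurable : @measurable_fun _ _ (borel G) R setT tent.
Proof. exact: continuous_borel_measurable tent_continuous. Qed.

Lemma tent_measurable_translate (h : G) :
  @measurable_fun _ _ (borel G) R setT (fun t => tent (h * t)%g).
Proof. exact: (measurableT_comp tent_measurable (translate_measurable h)). Qed.

Lemma tent_integrable : mu.-integrable setT (fun t : borel G => (tent t)%:E).
Proof.
apply: le_integrable (integrable_far_box 1 2) => //.
  by apply/measurable_EFinP; exact: tent_measurable.
move=> t _; rewrite lee_fin !ger0_norm ?tent_ge0 ?mul1r//.
have [->//|b0] := eqVneq (tent t) 0.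
by rewrite (tent_support b0) tent_le1.
Qed.

Lemma tent_integrable_translate (h : G) :
  mu.-integrable setT (fun t : borel G => (tent (h * t)%g)%:E).
Proof.
apply/integrableP; split.
  by apply/measurable_EFinP; exact: tent_measurable_translate.
have nn (t : borel G) : (0 <= (`|tent t|)%:E)%E by rewrite lee_fin.
have mb : measurable_fun setT (fun t : borel G => (`|tent t|)%:E).
  by apply/measurable_EFinP; apply: measurableT_comp => //; exact: tent_measurable.
have -> : (\int[mu]_t `|(tent (h * t)%g)%:E|)%E = (\int[mu]_t (`|tent t|)%:E)%E.
  exact: (ge0_integral_translate hmu h mb nn).
by have /integrableP[_] := tent_integrable.
Qed.

(** Finitely many translates of [U] cover a compact set, which is therefore null; by inner
    regularity the whole group would be null. *)
Lemma open_null_false (U : set G) : open U -> U 1%g -> mu U = 0%E -> False.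
Proof.
move=> oU U1 mU0; have [mpos inv _ _ reg] := hmu.
pose f (g : G) : set G := (fun t : G => (g^-1 * t)%g) @^-1` U.
have of_ g : open (f g).
  by apply: (proj1 (@continuousP _ _ _) (@mulg_continuousl G (g^-1)%g) U oU).
have fnull g : mu.-negligible (f g).
  exists (f g); split=> //; first exact: borel_open.
  by rewrite -mU0; apply: inv; exact: borel_open.
have Knull (K : set G) : compact K -> mu K = 0%E.
  move=> cK; have mK : measurable (K : set (borel G)).
    rewrite -[K]setCK; apply: measurableC; apply: borel_open.
    by apply: closed_openC; apply: compact_closed => //; exact: SL_hausdorff.
  apply: measure_negligible => //.
  move: cK; rewrite compact_cover => /(_ G setT f (fun i _ => of_ i)) [].
    by move=> t _; exists t => //; rewrite /f /= mulVg.
  move=> D _ KD.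
  (* Indices beyond the finite cover give the default translate [f 1], which is null as well. *)
  have sub : (K : set (borel G)) `<=` \bigcup_k (f (nth 1%g (finmap.enum_fset D) k) : set (borel G)).
    move=> t /KD[i iD fi]; exists (index i (finmap.enum_fset D)) => //.
    by rewrite nth_index.
  apply: (negligibleS sub).
  by apply: negligible_bigcup => k; exact: fnull.
move: mpos; rewrite (reg setT openT) => /ereal_sup_gt[_ [K [cK _] <-]].
by rewrite Knull// ltxx.
Qed.

Lemma tent_integral_gt0 : 0 < \int[mu]_t tent t.
Proof.
have nn : (0 <= \int[mu]_t (tent t)%:E)%E by apply: integral_ge0 => t _; rewrite lee_fin tent_ge0.
have fin : (\int[mu]_t (tent t)%:E)%E \is a fin_num.
  exact: integrable_fin_num tent_integrable.
rewrite -lte_fin /Rintegral fineK// lt0e nn andbT; apply/eqP => I0.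
pose U : set G := tent @^-1` [set r | 2^-1 < r].
have oU : open U.
  have /continuousP h := @tent_continuous R.
  by apply: h; exact: open_gt.
have mU : measurable (U : set (borel G)) by exact: borel_open.
have U1 : U 1%g.
  by rewrite /U /tent /= subrr normr0 subr0 max_r// invf_lt1// ltr1n.
apply: (open_null_false oU U1).
have le : ((2^-1)%:E * mu U <= 0)%E.
  rewrite -I0 -[U]setIT -(@integral_indic _ _ _ mu setT measurableT U mU).
  have mI : measurable_fun setT (fun t : borel G => (\1_U t)%:E : \bar R).
    by apply/measurable_EFinP; exact: measurable_indic.
  have nI (t : borel G) : setT t -> (0 <= (\1_U t)%:E :> \bar R)%E by move=> _; rewrite lee_fin.
  have n2 : (0 <= (2^-1)%:E :> \bar R)%E by rewrite lee_fin.
  rewrite -(ge0_integralZl mu measurableT mI nI n2).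
  apply: ge0_le_integral => //.
  - exact: measurable_funeM.
  - by apply/measurable_EFinP; exact: tent_measurable.
  move=> t _; rewrite -EFinM lee_fin indicE.
  have [/set_mem/ltW Ut|_] := boolP (t \in U); first by rewrite mulr1.
  by rewrite mulr0 tent_ge0.
apply/eqP; rewrite eq_le measure_ge0 andbT.
by rewrite pmule_rle0 in le; rewrite ?lte_fin ?invr_gt0.
Qed.

End TentIntegral.

(** * The limit functional *)

Section WordKernel.
Context {R : realType}.
Local Notation G := (SL 3 R).
Local Notation normc := Normc.normc.
Variables (mu : {measure set (borel G) -> \bar R}).
Hypotheses (hmu : left_haar mu).
Implicit Types (phi : borel G -> R[i]).

(** The discrete word measure convolved with the bump; by left invariance its functional integrates
    [word_mean] against the bump. *)
Definition word_kernel (Q t M : nat) (u : borel G) : R[i] :=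
  fmean (fun a : 'I_Q => fmean (fun b : 'I_M => fmean (fun a' : 'I_Q =>
    (tent ((word Q t a b a')^-1 * (u : G))%g)%:C%C))).

Definition bounded_by phi (c : R) := measurable_funC phi /\ forall g, normc (phi g) <= c.

Lemma fmeanMr (T : finType) (F : T -> R[i]) (c : R[i]) :
  fmean F * c = fmean (fun t => F t * c).
Proof. by rewrite mulrC -fmeanZ; apply: eq_fmean => t; rewrite mulrC. Qed.

Lemma bounded_ge0 phi c : bounded_by phi c -> 0 <= c.
Proof. by move=> [_ h]; apply: le_trans (normc_ge0 (phi 1%g)) (h _). Qed.

Lemma normc_tent (u : G) z : normc ((tent u)%:C%C * z) = tent u * normc z.
Proof. by rewrite normcMl ger0_norm ?tent_ge0. Qed.

Lemma cintegrable_tent (h : G) phi c : bounded_by phi c ->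
  cintegrable mu (fun u : borel G => (tent (h * u)%g)%:C%C * phi u).
Proof.
move=> bp; have c0 := bounded_ge0 bp; have [mp hp] := bp.
apply: (@cintegrable_dom _ _ _ _ _ (fun u : borel G => c * tent (h * u)%g)).
- apply: measurable_funC_mul => //; apply: measurable_funC_real.
  exact: tent_measurable_translate.
- rewrite (_ : (fun u => _) = (fun u : borel G => c%:E * (tent (h * u)%g)%:E)%E) //.
  by apply: integrableZl => //; exact: tent_integrable_translate.
by move=> u; rewrite normc_tent mulrC ler_wpM2r ?tent_ge0//.
Qed.

Lemma integralC_tent_translate (w : G) phi c : bounded_by phi c ->
  integralC mu (fun u : borel G => (tent (w^-1 * u)%g)%:C%C * phi u) =
  integralC mu (fun u : borel G => (tent u)%:C%C * phi (w * u)%g).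
Proof.
move=> bp; have mF := cintegrable_measurable (cintegrable_tent (w^-1)%g bp).
rewrite -(integralC_translate hmu w mF); congr (integralC mu _).
by apply/funext => u; rewrite mulKg.
Qed.

Lemma bounded_translate (h : G) phi c : bounded_by phi c ->
  bounded_by (fun u : borel G => phi (h * u)%g) c.
Proof. by move=> [mp hp]; split=> //; exact: measurable_funC_translate. Qed.

Lemma cintegrable_tent1 phi c : bounded_by phi c ->
  cintegrable mu (fun u : borel G => (tent u)%:C%C * phi u).
Proof.
move=> /(cintegrable_tent 1%g); congr cintegrable; apply/funext => u.
by rewrite mul1g.
Qed.

Lemma bounded_fmean (T : finType) (F : T -> borel G -> R[i]) c : 0 <= c ->
  (forall t, bounded_by (F t) c) -> bounded_by (fun u => fmean (fun t => F t u)) c.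
Proof.
move=> c0 h; split; first by apply: measurable_funC_fmean => t; case: (h t).
by move=> g; apply: fmean_le => // t; case: (h t).
Qed.

Lemma bounded_word_mean Q t M phi c : bounded_by phi c ->
  bounded_by (word_mean Q t M phi) c.
Proof.
move=> bp; have c0 := bounded_ge0 bp.
apply: bounded_fmean => // a; apply: bounded_fmean => // b.
by apply: bounded_fmean => // a'; exact: bounded_translate.
Qed.

Lemma word_kernel_functional Q t M phi c : bounded_by phi c ->
  cintegrable mu (fun u => word_kernel Q t M u * phi u) /\
  L1_functional mu (word_kernel Q t M) phi =
  integralC mu (fun u : borel G => (tent u)%:C%C * word_mean Q t M phi u).
Proof.
move=> bp; rewrite /L1_functional.
pose w a b a' := word Q t a b a' : G.
pose K a b a' (u : borel G) := (tent ((w a b a')^-1 * u)%g)%:C%C * phi u.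
pose L a b a' (u : borel G) := (tent u)%:C%C * phi (w a b a' * u)%g.
have iK a b a' : cintegrable mu (K a b a') by exact: cintegrable_tent bp.
have iL a b a' : cintegrable mu (L a b a').
  exact: cintegrable_tent1 (bounded_translate _ bp).
have K1 (a : 'I_Q) (b : 'I_M) := integralC_fmean (fun a' : 'I_Q => iK a b a').
have K2 (a : 'I_Q) := integralC_fmean (fun b : 'I_M => (K1 a b).1).
have K3 := integralC_fmean (fun a : 'I_Q => (K2 a).1).
have L1 (a : 'I_Q) (b : 'I_M) := integralC_fmean (fun a' : 'I_Q => iL a b a').
have L2 (a : 'I_Q) := integralC_fmean (fun b : 'I_M => (L1 a b).1).
have L3 := integralC_fmean (fun a : 'I_Q => (L2 a).1).
have -> : (fun u => word_kernel Q t M u * phi u) =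
  (fun u => fmean (fun a : 'I_Q => fmean (fun b : 'I_M => fmean (fun a' : 'I_Q => K a b a' u)))).
  apply/funext => u; rewrite /word_kernel fmeanMr; apply: eq_fmean => a.
  by rewrite fmeanMr; apply: eq_fmean => b; rewrite fmeanMr.
have -> : (fun u : borel G => (tent u)%:C%C * word_mean Q t M phi u) =
  (fun u => fmean (fun a : 'I_Q => fmean (fun b : 'I_M => fmean (fun a' : 'I_Q => L a b a' u)))).
  apply/funext => u; rewrite /word_mean -fmeanZ; apply: eq_fmean => a.
  by rewrite -fmeanZ; apply: eq_fmean => b; rewrite -fmeanZ.
split; first exact: K3.1.
rewrite K3.2 L3.2; apply: eq_fmean => a; rewrite (K2 a).2 (L2 a).2; apply: eq_fmean => b.
rewrite (K1 a b).2 (L1 a b).2; apply: eq_fmean => a'.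
exact: integralC_tent_translate bp.
Qed.

Lemma tent_functional_diff phi psi c (D : R) : bounded_by phi c -> bounded_by psi c ->
  0 <= D -> (forall u, normc (phi u - psi u) <= D) ->
  normc (integralC mu (fun u : borel G => (tent u)%:C%C * phi u) -
         integralC mu (fun u : borel G => (tent u)%:C%C * psi u)) <=
    2 * (D * \int[mu]_u tent u).
Proof.
move=> bp bq D0 H; have i1 := cintegrable_tent1 bp; have i2 := cintegrable_tent1 bq.
rewrite addrC -mulN1r -(integralC_lin (-1) i2 i1).
have iD : mu.-integrable setT (fun u : borel G => (D * tent u)%:E).
  by apply: (integrableZl measurableT D (tent_integrable hmu)).
rewrite -RintegralZl//; last exact: tent_integrable.
apply: normc_integralC => //; first exact: cintegrable_lin.
move=> u; rewrite mulN1r addrC -mulrBr normc_tent mulrC ler_wpM2r ?tent_ge0//.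
Qed.

(** Writes a mean over a coarse mesh on a finer one, so that two meshes can be compared term by
    term. *)
Lemma fmean_divn (Q r : nat) (F : nat -> R[i]) : (0 < r)%N ->
  fmean (fun a : 'I_(Q * r) => F (a %/ r)%N) = fmean (fun a : 'I_Q => F a).
Proof.
move=> r0; rewrite /fmean !card_ord.
have -> : \sum_(a < Q * r) F (a %/ r)%N = r%:R * \sum_(a < Q) F a.
  elim: Q => [|Q ih]; first by rewrite mul0n !big_ord0 mulr0.
  rewrite big_ord_recr/= mulrDr -ih -!(big_mkord xpredT (fun a => F (a %/ r)%N)).
  rewrite mulSn addnC (big_cat_nat _ (n := (Q * r)%N))//=; last exact: leq_addr.
  congr (_ + _); rewrite -{1}[(Q * r)%N]add0n big_addn addnC addnK.
  rewrite (eq_big_nat _ _ (F2 := fun=> F Q)) => [|i /andP[_ ir]]; last first.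
    by rewrite [(i + _)%N]addnC divnMDl// divn_small// addn0.
  by rewrite sumr_const_nat subn0 mulr_natl.
rewrite mulrA natrM invfM -(rmorph_nat (real_complex R)) -rmorphM mulfVK//.
by rewrite pnatr_eq0 -lt0n.
Qed.

Definition lip_cst (t M : nat) : R :=
  (108 * (1 + (t * M)%:R)) * (216 * (1 + (t * M)%:R)).

(** Corresponding parameters of the two meshes differ by at most [1 / Q], independently of [r]: a
    mesh can be refined as far as divisibility demands at a cost known in advance. *)
Lemma word_kernel_refine Q r t M (u : borel G) : (0 < Q)%N -> (0 < r)%N ->
  normc (word_kernel (Q * r) t M u - word_kernel Q t M u) <=
   lip_cst t M / Q%:R * (`|SLval (u : G)| <= (216 * (1 + t * M))%:R)%R%:R.
Proof.
move=> Q0 r0.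
pose H a b a' (Q1 : nat) := (tent ((pword (a%:R / Q1%:R) (t * b)%:R (a'%:R / Q1%:R))^-1 * (u : G))%g)%:C%C : R[i].
have L0 : 0 <= lip_cst t M by rewrite !mulr_ge0 ?addr_ge0.
have -> : word_kernel Q t M u = fmean (fun a : 'I_(Q * r) => fmean (fun b : 'I_M =>
    fmean (fun a' : 'I_(Q * r) => H (a %/ r)%N b (a' %/ r)%N Q))).
  rewrite (@fmean_divn Q r (fun a => fmean (fun b : 'I_M =>
    fmean (fun a' : 'I_(Q * r) => H a b (a' %/ r)%N Q)))) //.
  apply: eq_fmean => a; apply: eq_fmean => b.
  by rewrite (@fmean_divn Q r (fun a' => H a b a' Q)).
have Q0' : 0 < Q%:R :> R by rewrite ltr0n.
have r0' : 0 < r%:R :> R by rewrite ltr0n.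
have one n m : (n < m)%N -> `|n%:R / m%:R| <= 1 :> R.
  move=> nm; rewrite ger0_norm// ler_pdivrMr ?mul1r ?ler_nat ?(ltnW nm)//.
  by rewrite ltr0n (leq_trans _ nm).
have close n : `|n%:R / (Q * r)%:R - (n %/ r)%:R / Q%:R| <= Q%:R^-1 :> R.
  have -> : n%:R / (Q * r)%:R - (n %/ r)%:R / Q%:R = (n %% r)%:R / r%:R / Q%:R :> R.
    rewrite {1}(divn_eq n r) natrD !natrM; field.
    by rewrite !gt_eqF.
  rewrite ger0_norm// -[leRHS]mul1r ler_wpM2r ?invr_ge0 ?(ltW Q0')//.
  by rewrite ler_pdivrMr// mul1r ler_nat ltnW// ltn_mod.
set rhs := (X in _ <= X); have rhs0 : 0 <= rhs by rewrite /rhs mulr_ge0// divr_ge0.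
rewrite -fmeanB; apply: fmean_le => // a; rewrite -fmeanB; apply: fmean_le => // b.
rewrite -fmeanB; apply: fmean_le => // a'.
have BE : (216 * (1 + t * M))%:R = 216 * (1 + (t * M)%:R) :> R by rewrite natrM (natrD _ 1%N).
rewrite -rmorphB normc_real /rhs BE.
apply: (@tent_pword_lip _ _ _ _ _ _ ((t * M)%:R) (Q%:R^-1) u); rewrite ?one//.
- by rewrite ltn_divLR.
- by rewrite ltn_divLR.
- by rewrite ger0_norm// ler_nat leq_mul2l (ltnW (ltn_ord b)) orbT.
Qed.

Lemma word_kernel_functional_refine Q r t M phi c : (0 < Q)%N -> (0 < r)%N ->
  bounded_by phi c ->
  normc (L1_functional mu (word_kernel (Q * r) t M) phi -
         L1_functional mu (word_kernel Q t M) phi) <=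
   2 * (lip_cst t M / Q%:R * c * fine (mu (far_box (216 * (1 + t * M))))).
Proof.
move=> Q0 r0 bp; have c0 := bounded_ge0 bp; have [mp hp] := bp.
have [i1 _] := word_kernel_functional (Q * r) t M bp.
have [i2 _] := word_kernel_functional Q t M bp.
rewrite addrC -mulN1r -(integralC_lin (-1) i2 i1) -(Rintegral_far_box hmu).
apply: normc_integralC; first exact: cintegrable_lin.
  exact: integrable_far_box.
move=> u; rewrite mulN1r addrC -mulrBl Normc.normcM mulrAC.
apply: ler_pM => //; try exact: normc_ge0.
exact: word_kernel_refine.
Qed.

Lemma word_kernel_Lp Q t M : Lp mu 1%:E (word_kernel Q t M).
Proof.
have b1 : bounded_by (fun=> 1) 1.
  by split; [exact: measurable_funC_cst|move=> g; rewrite Normc.normc1].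
have [i1 _] := word_kernel_functional Q t M b1.
have iK : cintegrable mu (word_kernel Q t M).
  by move: i1; congr cintegrable; apply/funext => u; rewrite mulr1.
have mK := cintegrable_measurable iK; split=> //.
rewrite /Lp_norm Lnorm1; have [iR iI] := iK.
have /integrableP[_] := integrableD measurableT (integrable_abse iR) (integrable_abse iI).
apply: le_lt_trans; apply: ge0_le_integral => //.
- by apply: measurableT_comp => //; apply/measurable_EFinP; exact: measurable_normc.
- apply: measurableT_comp => //; apply: emeasurable_funD.
    by apply: measurableT_comp => //; exact: (measurable_int mu iR).
  by apply: measurableT_comp => //; exact: (measurable_int mu iI).
move=> u _ /=; rewrite lee_fin [leLHS]ger0_norm ?normc_ge0//.
by apply: le_trans (normc_le_ReIm _) _; exact: ler_norm.
Qed.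

End WordKernel.

(** * Explicit bounds and continuity for multipliers, and limits with a rate *)

Section MultiplierBounds.
Context {R : realType}.
Local Notation normc := Normc.normc.

Lemma norm_rnorm (E : completeNormedModType R[i]) (x : E) : `|x| = (rnorm x)%:C%C.
Proof.
have := normr_ge0 x; rewrite /rnorm lecE => /andP[/eqP h _].
by case: (`|x|) h => a b /= ->.
Qed.

Lemma rnormZ (E : completeNormedModType R[i]) (c : R[i]) (x : E) :
  rnorm (c *: x) = normc c * rnorm x.
Proof. by rewrite /rnorm normrZ norm_normc Re_realM. Qed.

Lemma dual_norm_le (E : completeNormedModType R[i]) (l : E -> R[i]) (D : R) :
  (forall c x, l (c *: x) = c * l x) -> (dual_norm l <= D%:E)%E ->
  forall x, normc (l x) <= D * rnorm x.
Proof.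
move=> lZ lD x; have [x0|x0] := eqVneq (rnorm x) 0.
  have -> : x = 0 *: x.
    by rewrite scale0r; apply/normr0_eq0; rewrite norm_rnorm x0.
  by rewrite lZ mul0r Normc.normc0 rnormZ Normc.normc0 mul0r mulr0.
have xp : 0 < rnorm x by rewrite lt_neqAle eq_sym x0 rnorm_ge0.
have : ((normc (l ((rnorm x)^-1%:C%C *: x)))%:E <= D%:E)%E.
  apply: le_trans lD; apply: ereal_sup_ubound; exists ((rnorm x)^-1%:C%C *: x) => //=.
  by rewrite rnormZ normc_real ger0_norm ?invr_ge0 ?(ltW xp)// mulVf.
by rewrite lee_fin lZ normcMl ger0_norm ?invr_ge0 ?(ltW xp)// ler_pdivrMl// mulrC.
Qed.

Context {G : lcGroupType}.
Implicit Types (p : R) (phi : G -> R[i]).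

Lemma mult_bound_ge0 p phi A B : mult_bound p phi A B -> 0 <= A /\ 0 <= B.
Proof.
move=> [E [alpha [beta [_ B0 aA _]]]]; split=> //.
by apply/ltW/(le_lt_trans _ (aA 1%g)); exact: rnorm_ge0.
Qed.

(** [phi t] is [beta t] applied to the fixed vector [alpha 1], so the norm continuity of [beta]
    passes to [phi]. It is used to make multipliers Borel measurable. *)
Lemma mult_bound_continuous p phi A B : mult_bound p phi A B -> forall s (e : R), 0 < e ->
  \forall s' \near nbhs s, normc (phi s' - phi s) < e.
Proof.
move=> [E [alpha [beta [[_ _ [bc _] rep] _ _ _]]]] s e e0.
set x := alpha 1%g.
have phiE t : phi t = beta t x by rewrite -[t in LHS]mulg1 -invg1 rep.
pose e' := e / (rnorm x + 1).
have x1 : 0 < rnorm x + 1 by rewrite ltr_wpDl// rnorm_ge0.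
have e'0 : 0 < e' by rewrite divr_gt0.
have H : ereal_nbhs 0%E (fun u : \bar R => (u < e'%:E)%E).
  by apply: open_ereal_lt'; rewrite lte_fin.
apply: (@filterS G (nbhs s) (nbhs_filter s) _ _ _ (bc s _ H)) => s' /ltW h.
have hZ (c : R[i]) (y : E) : beta s' (c *: y) - beta s (c *: y) = c * (beta s' y - beta s y).
  have lz (t : G) : beta t (c *: y) = c * beta t y by rewrite linearZ.
  by rewrite !lz -mulrBr.
have := @dual_norm_le E (fun y => beta s' y - beta s y) e' hZ h x.
rewrite !phiE => /le_lt_trans; apply.
by rewrite /e' mulrAC ltr_pdivrMr// ltr_pM2l// ltrDl.
Qed.

Lemma rep_mult_bound p phi (E : completeNormedModType R[i]) (alpha : G -> E)
    (beta : G -> {linear E -> R[i]^o}) : Mpcb_rep p phi alpha beta ->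
  exists A B, mult_bound p phi A B /\
    ((A * B)%:E <= sup_norm alpha * dual_sup_norm beta + 1)%E.
Proof.
move=> rep; have [Esq [_ sa] [_ sb] _] := rep.
have al t : ((rnorm (alpha t))%:E <= sup_norm alpha)%E by apply: ereal_sup_ubound; exists t.
have be s : (dual_norm (beta s) <= dual_sup_norm beta)%E by apply: ereal_sup_ubound; exists s.
have b0 : (0 <= dual_sup_norm beta)%E.
  apply: le_trans (be 1%g).
  apply: (@le_trans _ _ (normc (beta 1%g 0))%:E); first by rewrite lee_fin normc_ge0.
  by apply: ereal_sup_ubound; exists 0 => //=; rewrite /rnorm normr0.
have a0 : (0 <= sup_norm alpha)%E by apply: le_trans (al 1%g); rewrite lee_fin rnorm_ge0.
have fa : sup_norm alpha \is a fin_num by rewrite ge0_fin_numE.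
have fb : dual_sup_norm beta \is a fin_num by rewrite ge0_fin_numE.
set a := fine (sup_norm alpha); set b := fine (dual_sup_norm beta).
have a0' : 0 <= a by rewrite fine_ge0.
have b0' : 0 <= b by rewrite fine_ge0.
have b1 : 0 < b + 1 by rewrite ltr_wpDl.
(* The margin [1 / (b + 1)] makes the bound on [alpha] strict and adds at most [1] to the
   product. *)
exists (a + (b + 1)^-1), b; split; last first.
  rewrite -(fineK fa) -(fineK fb) -EFinM -EFinD lee_fin -/a -/b mulrDl lerD2l.
  by rewrite ler_pdivrMl// mulr1 lerDl.
exists E, alpha, beta; split=> //.
  move=> t; apply: (@le_lt_trans _ _ a); last by rewrite ltrDl invr_gt0.
  by rewrite -lee_fin /a fineK.
move=> s x; apply: dual_norm_le; last by rewrite /b fineK.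
by move=> c y; rewrite linearZ.
Qed.

End MultiplierBounds.

Section GeometricLimit.
Context {R : realType}.
Local Notation normc := Normc.normc.

(** The intervals of radius [r n = 2 * K / 2 ^+ n] around [x n] are nested because
    [r n = r n.+1 + K / 2 ^+ n]; the supremum of their left ends lies in all of them, which yields
    the rate at once. *)
Lemma geometric_limit (x : nat -> R) (K : R) : 0 <= K ->
  (forall n, `|x n - x n.+1| <= K / 2 ^+ n) ->
  exists v, forall n, `|x n - v| <= 2 * K / 2 ^+ n.
Proof.
move=> K0 H; pose r n := 2 * K / 2 ^+ n : R.
have rS n : r n = r n.+1 + K / 2 ^+ n.
  by rewrite /r exprS; field; rewrite expf_neq0.
have r0 n : 0 <= r n by rewrite divr_ge0 ?mulr_ge0// exprn_ge0.
have up n k : x (n + k)%N + r (n + k)%N <= x n + r n.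
  elim: k => [|k ih]; first by rewrite addn0.
  apply: le_trans ih; rewrite addnS [in leRHS]rS.
  by have := H (n + k)%N; rewrite ler_norml => /andP[]; lra.
have dn n k : x n - r n <= x (n + k)%N - r (n + k)%N.
  elim: k => [|k ih]; first by rewrite addn0.
  apply: le_trans ih _; rewrite addnS [in leLHS]rS.
  by have := H (n + k)%N; rewrite ler_norml => /andP[]; lra.
have cross n m : x m - r m <= x n + r n.
  apply: (@le_trans _ _ (x (m + n)%N - r (m + n)%N)); first exact: dn.
  apply: (@le_trans _ _ (x (n + m)%N + r (n + m)%N)); last exact: up.
  by rewrite [(m + n)%N]addnC; have := r0 (n + m)%N; lra.
pose S := [set x m - r m | m in [set: nat]].
have Sub n : ubound S (x n + r n) by move=> _ [m _ <-]; exact: cross.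
have hS : has_sup S by split; [exists (x 0%N - r 0%N); exists 0%N|exists (x 0%N + r 0%N); exact: Sub].
exists (sup S) => n; rewrite -/(r n) ler_distlC.
apply/andP; split; last first.
  by apply: sup_le_ub => //; case: hS.
by apply: sup_upper_bound => //; exists n.
Qed.

Lemma geometric_limitC (x : nat -> R[i]) (K : R) : 0 <= K ->
  (forall n, normc (x n - x n.+1) <= K / 2 ^+ n) ->
  exists v, forall n, normc (x n - v) <= 4 * K / 2 ^+ n.
Proof.
move=> K0 H.
have ReB (u v : R[i]) : complex.Re (u - v) = complex.Re u - complex.Re v by case: u v => ? ? [].
have ImB (u v : R[i]) : complex.Im (u - v) = complex.Im u - complex.Im v by case: u v => ? ? [].
have [vr hr] := @geometric_limit (fun n => complex.Re (x n)) K K0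
  (fun n => le_trans (eq_ind _ (fun z => `|z| <= _) (Re_le_normc _) _ (ReB _ _)) (H n)).
have [vi hi] := @geometric_limit (fun n => complex.Im (x n)) K K0
  (fun n => le_trans (eq_ind _ (fun z => `|z| <= _) (Im_le_normc _) _ (ImB _ _)) (H n)).
exists (Complex vr vi) => n; apply: le_trans (normc_le_ReIm _) _.
rewrite ReB ImB /=; apply: le_trans (lerD (hr n) (hi n)) _.
by rewrite -mulrDl ler_wpM2r ?invr_ge0 ?exprn_ge0//; lra.
Qed.

End GeometricLimit.

Section WeakStarMean.
Context {R : realType}.
Local Notation G := (SL 3 R).
Local Notation normc := Normc.normc.
Variables (mu : {measure set (borel G) -> \bar R}) (p : R).
Hypothesis hmu : left_haar mu.

Lemma mult_bound_bounded (phi : G -> R[i]) A B :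
  mult_bound p phi A B -> bounded_by (phi : borel G -> R[i]) (A * B).
Proof.
move=> mb; have cont := mult_bound_continuous mb.
have cpart (f : R[i] -> R) : (forall z w, `|f z - f w| <= normc (z - w)) ->
    continuous (fun g : G => f (phi g)).
  move=> fl s; apply: (proj2 (@cvgrPdist_lt R R^o G (nbhs s) (nbhs_filter s) _ _)) => e e0.
  apply: (@filterS G (nbhs s) (nbhs_filter s) _ _ _ (cont s e e0)) => s' h.
  by apply: le_lt_trans h; rewrite normc_sub; exact: fl.
split.
  split; apply: continuous_borel_measurable.
    apply: cpart => z w; apply: le_trans (Re_le_normc _).
    by case: z w => ? ? [].
  apply: cpart => z w; apply: le_trans (Im_le_normc _).
  by case: z w => ? ? [].
move=> g; have [E [alpha [beta [[_ _ _ rep] B0 aA bB]]]] := mb.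
have -> : phi g = beta g (alpha 1%g) by rewrite -rep invg1 mulg1.
apply: le_trans (bB _ _) _; rewrite mulrC ler_wpM2r//; exact: ltW.
Qed.

Lemma tent_functional_le (phi : borel G -> R[i]) c (D : R) : bounded_by phi c ->
  0 <= D -> (forall u : G, `|SLval u| <= 2 -> normc (phi u) <= D) ->
  normc (integralC mu (fun u : borel G => (tent u)%:C%C * phi u)) <=
    2 * (D * \int[mu]_u tent u).
Proof.
move=> bp D0 H.
have iD : mu.-integrable setT (fun u : borel G => (D * tent u)%:E).
  by apply: (integrableZl measurableT D (tent_integrable hmu)).
rewrite -RintegralZl//; last exact: tent_integrable.
apply: normc_integralC => //; first exact: cintegrable_tent1 bp.
move=> u; rewrite normc_tent; have [->|t0] := eqVneq (tent u) 0; first by rewrite mul0r mulr0.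
by rewrite mulrC ler_wpM2r ?tent_ge0// H// tent_support.
Qed.

(** Among the [M] middle parameters only [b = 0] can keep the point near the identity, and its
    weight is [1 / M]; the others are at least [t], past the threshold of [pword_far]. *)
Lemma word_mean_vanishing Q t M (phi : G -> R[i]) c e r (u : G) :
  (forall g, normc (phi g) <= c) -> 0 <= e -> (0 < Q)%N -> (0 < M)%N ->
  (forall s : G, r < `|SLval s| -> normc (phi s) <= e) ->
  24 * r < t%:R -> `|SLval u| <= 2 ->
  normc (word_mean Q t M phi u) <= c / M%:R + e.
Proof.
move=> hc e0 Q0 M0 hr tr u2.
have c0 : 0 <= c by apply: le_trans (hc 1%g); exact: normc_ge0.
apply: fmean_le; first by rewrite addr_ge0// divr_ge0.
move=> a; apply: le_trans (normc_fmean _) _; rewrite card_ord.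
have M0' : 0 < M%:R :> R by rewrite ltr0n.
rewrite ler_pdivrMl//.
apply: (@le_trans _ _ (\sum_(b < M) ((b == 0%N :> nat)%:R * c + e))).
  apply: ler_sum => b _; apply: fmean_le; first by rewrite addr_ge0// mulr_ge0.
  move=> a'; have [->|b0] := eqVneq (b : nat) 0%N.
    by rewrite mul1r; apply: le_trans (hc _) _; rewrite lerDl.
  rewrite mul0r add0r; apply: hr.
  have := @pword_far R (a%:R / Q%:R) ((t * b)%:R) (a'%:R / Q%:R) u (ler0n _ _) u2.
  have : t%:R <= (t * b)%:R :> R by rewrite ler_nat leq_pmulr// lt0n.
  by rewrite /word /pword; lra.
rewrite big_split/= sumr_const card_ord -mulr_suml mulrDr.
rewrite mulrCA mulfV ?gt_eqF// mulr1 -[e *+ M]mulr_natl lerD2r.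
rewrite -[leRHS]mul1r ler_wpM2r//.
case: M M0 {M0'} => // M _.
by rewrite big_ord_recl/= big1 ?addr0.
Qed.

Lemma normc_chain (a b c d : R[i]) :
  normc (a - d) <= normc (a - b) + normc (b - c) + normc (c - d).
Proof.
rewrite -(subrKA c) -(subrKA b a) (le_trans (ler_normcD _ _))// lerD2r.
exact: ler_normcD.
Qed.

(** Both kernels are refined to one mesh [Qs], a multiple of [Q], of [Q'] and of the sizes required
    by the hub comparison for each pair. There the word means differ by at most
    [6 * (delta * A * B)]; the last two terms are the costs of refinement. *)
Lemma word_kernel_step (c : R) d phi (A B delta : R) m t M Q t' M' Q' :
  @heis_insertion R G p c d -> mult_bound p phi A B ->
  0 < delta -> delta <= 1 -> (0 < m)%N -> 12 / m%:R <= c * delta ^+ d ->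
  (m <= M)%N -> (m ^ 6 <= t)%N -> (t * M <= m ^ 8)%N ->
  (m <= M')%N -> (m ^ 6 <= t')%N -> (t' * M' <= m ^ 8)%N ->
  (0 < Q)%N -> (0 < Q')%N ->
  normc (L1_functional mu (word_kernel Q t M) phi -
         L1_functional mu (word_kernel Q' t' M') phi) <=
    12 * (delta * A * B) * \int[mu]_u tent u +
    2 * (lip_cst t M / Q%:R * (A * B) * fine (mu (far_box (216 * (1 + t * M))))) +
    2 * (lip_cst t' M' / Q'%:R * (A * B) * fine (mu (far_box (216 * (1 + t' * M'))))).
Proof.
move=> ins mb d0 d1 m0 md mM mt tM mM' mt' tM' Q0 Q0'.
have bp := mult_bound_bounded mb; have [A0 B0] := mult_bound_ge0 mb.
have t0 : (0 < t)%N by apply: leq_trans mt; rewrite expn_gt0 m0.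
have t0' : (0 < t')%N by apply: leq_trans mt'; rewrite expn_gt0 m0.
have pos := (fact_gt0 m, fact_gt0 M, fact_gt0 M').
pose r := (t' * M'`! * Q * Q')%N; pose r' := (t * M`! * Q * Q')%N.
have r0 : (0 < r)%N by rewrite /r !muln_gt0 t0' Q0 Q0' pos.
have r0' : (0 < r')%N by rewrite /r' !muln_gt0 t0 Q0 Q0' pos.
pose s := (m ^ 4 * m`! * t * M`! * t' * M'`! * Q')%N.
pose s' := (m ^ 4 * m`! * t * M`! * t' * M'`! * Q)%N.
have m40 : (0 < m ^ 4)%N by rewrite expn_gt0 m0.
have s0 : (0 < s)%N by rewrite /s; move: (m ^ 4)%N m40 => a a0; rewrite !muln_gt0 t0 t0' Q0' !pos a0.
have s0' : (0 < s')%N by rewrite /s'; move: (m ^ 4)%N m40 => a a0; rewrite !muln_gt0 t0 t0' Q0 !pos a0.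
have H := @word_mean_hub R p c d phi A B delta m t M r _ ins mb d0 d1 m0 mM mt tM r0 md A0 B0.
have H' := @word_mean_hub R p c d phi A B delta m t' M' r' _ ins mb d0 d1 m0 mM' mt' tM' r0' md A0 B0.
move: H H'; set Qs := (Q * s)%N.
have -> : (m ^ 4 * m`! * t * M`! * r = Qs)%N.
  by rewrite /Qs /s /r; move: (m ^ 4)%N (m`!) (M`!) (M'`!) => *; ring.
have -> : (m ^ 4 * m`! * t' * M'`! * r' = Qs)%N.
  by rewrite /Qs /s /r'; move: (m ^ 4)%N (m`!) (M`!) (M'`!) => *; ring.
have QE : Qs = (Q' * s')%N.
  by rewrite /Qs /s /s'; move: (m ^ 4)%N (m`!) (M`!) (M'`!) => *; ring.
move=> H H'.
have hd u : normc (word_mean Qs t M phi u - word_mean Qs t' M' phi u) <= 6 * (delta * A * B).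
  rewrite -[X in normc X](subrKA (hub_mean Qs m phi u)).
  apply: le_trans (ler_normcD _ _) _; rewrite [normc (hub_mean _ _ _ _ - _)]normc_sub.
  by apply: le_trans (lerD (H u) (H' u)) _; lra.
have D0 : 0 <= 6 * (delta * A * B) by rewrite !mulr_ge0// ltW.
have E3 := tent_functional_diff hmu (bounded_word_mean Qs t M bp)
  (bounded_word_mean Qs t' M' bp) D0 hd.
have E1 := word_kernel_functional_refine hmu t M Q0 s0 bp.
have E2 := word_kernel_functional_refine hmu t' M' Q0' s0' bp.
move: E1 E2 E3; rewrite -QE -/Qs.
rewrite -(word_kernel_functional hmu Qs t M bp).2 -(word_kernel_functional hmu Qs t' M' bp).2.
move=> E1 E2 E3.
apply: le_trans (normc_chain _ (L1_functional mu (word_kernel Qs t M) phi)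
  (L1_functional mu (word_kernel Qs t' M') phi) _) _.
rewrite normc_sub; apply: lerD E2; rewrite addrC; apply: lerD E1.
apply: le_trans E3 _; rewrite mulrA [12 * _]mulrC [2 * _]mulrC.
by move: (delta * A * B) (Rintegral _ _ _) => x y; lra.
Qed.

End WeakStarMean.

(** * Choice of scales *)

Section WeakStarMeanSequence.
Context {R : realType}.
Local Notation G := (SL 3 R).
Local Notation normc := Normc.normc.
Variables (mu : {measure set (borel G) -> \bar R}) (p : R).
Hypotheses (hmu : left_haar mu) (p1 : 1 < p).

(** Separates the choice of scales from the passage to the limit: geometric steps give convergence
    in the dual norm, the constant mass keeps the limit nonzero at [1], and vanishing functions are
    killed. *)
Record mean_sequence (F : nat -> borel G -> R[i]) (C : R) := MeanSequence {
  mean_Lp : forall n, Lp mu 1%:E (F n);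
  mean_cst : forall n, L1_functional mu (F n) (fun=> 1) = (\int[mu]_u tent u)%:C%C;
  mean_integrable : forall n phi c, bounded_by phi c ->
    cintegrable mu (fun u => F n u * phi u);
  mean_bound : forall n phi c, bounded_by phi c ->
    normc (L1_functional mu (F n) phi) <= 2 * (c * \int[mu]_u tent u);
  mean_step : forall n phi A B, mult_bound p phi A B ->
    normc (L1_functional mu (F n) phi - L1_functional mu (F n.+1) phi) <=
      C * (A * B) / 2 ^+ n;
  mean_vanishing : forall phi c, bounded_by (phi : borel G -> R[i]) c ->
    vanishing phi -> forall e : R, 0 < e -> exists N, forall n, (N <= n)%N ->
    normc (L1_functional mu (F n) phi) <= e }.

Lemma mean_sequence_exists : exists F C, 0 <= C /\ mean_sequence F C.
Proof.
have [c [d [c0 ins]]] := @heis_insertion_exists R G p p1.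
set I := \int[mu]_u tent u; have I0 : 0 < I := tent_integral_gt0 hmu.
(* [M] gains a factor [2 ^ D] per step while [delta] is halved, so [12 / M] remains below
   [c * delta ^+ d]; the successor makes [M] grow even if [d] is [0]. *)
pose D := d.+1.
(* The first summand gives [12 / c <= 2 ^ e0]. The second gives [2 ^ (7 D) <= M n], that is,
   [M n.+1 ^ 7 <= M n ^ 8]. *)
pose e0 := ((Num.truncn (12 / c)).+1 + 7 * D)%N.
(* The hub of scale [m = M n] serves both [(t n, M n)] and [(t n.+1, M n.+1)], which
   forces [m ^ 6 <= t] and [t * M <= m ^ 8] for both pairs. *)
pose M n := (2 ^ (D * n + e0))%N.
pose t n := (M n ^ 6)%N.
pose box n := fine (mu (far_box (216 * (1 + t n * M n)))).
(* With [t n] and [M n] fixed, the mesh is taken so fine that its refinement costs at most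
   [2 ^- n]. *)
pose Q n := (Num.truncn (2 * (lip_cst (t n) (M n) * box n) * 2 ^+ n)).+1.
have box0 n : 0 <= box n by rewrite fine_ge0// measure_ge0.
have lip0 n : 0 <= lip_cst (t n) (M n) :> R by rewrite !mulr_ge0 ?addr_ge0.
have Mpos n : (0 < M n)%N by rewrite expn_gt0.
have MS n : M n.+1 = (2 ^ D * M n)%N by rewrite /M -expnD mulnS addnA.
have tpos n : (0 < t n)%N by rewrite expn_gt0 Mpos.
have MleS n : (M n <= M n.+1)%N by rewrite MS leq_pmull// expn_gt0.
have Mbig n : (2 ^ (7 * D) <= M n)%N.
  by rewrite /M leq_exp2l// /e0 addnA addnC -[leqLHS]addn0 leq_add2l.
have tM n : (t n * M n <= M n ^ 8)%N.
  by rewrite /t -expnSr leq_pexp2l.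
have tMS n : (t n.+1 * M n.+1 <= M n ^ 8)%N.
  rewrite /t -expnSr MS expnMn -expnM mulnC [(D * 7)%N]mulnC.
  by rewrite [(M n ^ 8)%N]expnSr leq_mul2l Mbig orbT.
have tS n : (M n ^ 6 <= t n.+1)%N by rewrite /t leq_exp2r.
have small n : 12 / (M n)%:R <= c * (2 ^+ n)^-1 ^+ d.
  have h1 : 12 / c <= (2 ^ e0)%:R :> R.
    apply: ltW; apply: lt_le_trans (truncnS_gt _) _; rewrite ler_nat.
    apply: leq_trans (ltnW (ltn_expl _ (isT : (1 < 2)%N))) _.
    by rewrite leq_exp2l// /e0 leq_addr.
  have h2 : (2 ^+ n) ^+ d <= (2 ^ (D * n))%:R :> R.
    by rewrite -exprM natrX ler_weXn2l ?ler1n// mulnC leq_mul2r leqnSn orbT.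
  rewrite /M expnD natrM exprVn.
  rewrite ler_pdivrMr; last by rewrite mulr_gt0// ltr0n expn_gt0.
  have P0 : 0 < (2 ^+ n) ^+ d :> R by rewrite exprn_gt0// exprn_gt0.
  apply: (@le_trans _ _ (c * (2 ^ e0)%:R)).
    by rewrite mulrC -ler_pdivrMr.
  rewrite -mulrA ler_wpM2l ?(ltW c0)// mulrA -[leLHS]mul1r ler_wpM2r//.
  by rewrite mulrC ler_pdivlMr// mul1r.
pose F n := word_kernel (R := R) (Q n) (t n) (M n).
have nM n : (n < M n)%N.
  apply: leq_trans (ltn_expl n (isT : (1 < 2)%N)) _; rewrite /M leq_exp2l//.
  by rewrite /D mulSn -addnA leq_addr.
have nt n : (M n <= t n)%N by rewrite /t -[leqLHS]expn1 leq_pexp2l.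
have Qbig n : 2 * (lip_cst (t n) (M n) / (Q n)%:R * box n) <= (2 ^+ n)^-1.
  have Q0 : 0 < (Q n)%:R :> R by rewrite ltr0n.
  rewrite mulrAC mulrA ler_pdivrMr// ler_pdivlMl ?exprn_gt0//.
  by apply: ltW; rewrite mulrC; exact: truncnS_gt.
(* [12 * I] pays for the comparison through the hub, and [2] for the two refinements. *)
exists F, (2 + 12 * I); split; first by rewrite addr_ge0// mulr_ge0// ltW.
have b1 : bounded_by (fun=> 1 : R[i]) 1.
  by split; [exact: measurable_funC_cst|move=> g; rewrite Normc.normc1].
split.
- by move=> n; exact: word_kernel_Lp.
- move=> n; rewrite (word_kernel_functional hmu _ _ _ b1).2.
  have -> : word_mean (Q n) (t n) (M n) (fun=> 1 : R[i]) = (fun=> 1).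
    have mean1 k : (0 < k)%N -> fmean (fun _ : 'I_k => 1 : R[i]) = 1.
      by move=> k0; rewrite fmean_cst ?card_ord.
    apply/funext => u; rewrite /word_mean.
    under eq_fmean => a do under eq_fmean => b do rewrite mean1//.
    under eq_fmean => a do rewrite mean1//.
    by rewrite mean1.
  apply/eqP; rewrite eq_complex; apply/andP; split; apply/eqP => /=.
    by apply: eq_Rintegral => u _ /=; rewrite mulr1 mul0r subr0.
  rewrite (_ : Rintegral _ _ _ = \int[mu]_u (0 : R)); first by rewrite /Rintegral integral0.
  by apply: eq_Rintegral => u _ /=; rewrite mulr0 mul0r addr0.
- by move=> n phi c' bp; have [] := word_kernel_functional hmu (Q n) (t n) (M n) bp.
- move=> n phi c' bp; rewrite (word_kernel_functional hmu _ _ _ bp).2.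
  have bw := bounded_word_mean (Q n) (t n) (M n) bp.
  by apply: (tent_functional_le hmu bw (bounded_ge0 bp)) => u _; exact: bw.2.
- move=> n phi A B mb; have [A0 B0] := mult_bound_ge0 mb.
  have e0' : 0 < (2 ^+ n)^-1 :> R by rewrite invr_gt0 exprn_gt0.
  have e1 : (2 ^+ n)^-1 <= 1 :> R by rewrite invf_le1 ?exprn_gt0// exprn_ege1// ler1n.
  have := word_kernel_step hmu ins mb e0' e1 (Mpos n) (small n) (leqnn _) (leqnn _) (tM n)
    (MleS n) (tS n) (tMS n) (ltn0Sn _ : 0 < Q n)%N (ltn0Sn _ : 0 < Q n.+1)%N.
  move=> /le_trans; apply.
  have AB0 : 0 <= A * B by rewrite mulr_ge0.
  have q1 := ler_wpM2r AB0 (Qbig n); have q2 := ler_wpM2r AB0 (Qbig n.+1).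
  have q3 : (2 ^+ n.+1)^-1 * (A * B) <= (2 ^+ n)^-1 * (A * B).
    by rewrite ler_wpM2r// lef_pV2 ?posrE ?exprn_gt0// ler_weXn2l// ler1n.
  move: q1 q2 q3; rewrite -/(box n) -/(box n.+1) -/I.
  set a := (2 ^+ n)^-1; set b := (2 ^+ n.+1)^-1.
  set L := lip_cst _ _ / _; set L' := lip_cst _ _ / _.
  by move: (box n) (box n.+1) => x y q1 q2 q3; nra.
move=> phi c' bp van e ep; have c'0 := bounded_ge0 bp; have [_ hb] := bp.
(* Two errors of size [e1] arise, from the parameter [b = 0] and from the far values of [phi];
   integration against the bump multiplies them by [2 * I]. *)
pose e1 := e / (4 * I); have e10 : 0 < e1 by rewrite divr_gt0// mulr_gt0.
have [r hr] := van e1 e10.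
pose N := ((Num.truncn (24 * r)).+1 + (Num.truncn (c' / e1)).+1)%N.
exists N => n Nn.
rewrite (word_kernel_functional hmu _ _ _ bp).2.
have bw := bounded_word_mean (Q n) (t n) (M n) bp.
have NM : N%:R <= (M n)%:R :> R by rewrite ler_nat (leq_trans Nn)// ltnW.
have NE : 24 * r < N%:R /\ c' / e1 < N%:R.
  have := truncnS_gt (24 * r); have := truncnS_gt (c' / e1).
  have := ler0n R (Num.truncn (24 * r)).+1; have := ler0n R (Num.truncn (c' / e1)).+1.
  by rewrite /N natrD; lra.
have M0 : 0 < (M n)%:R :> R by rewrite ltr0n.
have Mt : (M n)%:R <= (t n)%:R :> R by rewrite ler_nat.
have tr : 24 * r < (t n)%:R by lra.
have cM : c' / (M n)%:R <= e1.
  by rewrite ler_pdivrMr// mulrC -ler_pdivrMr//; lra.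
have D0 : 0 <= c' / (M n)%:R + e1 by apply: addr_ge0; [exact: divr_ge0|exact: ltW].
apply: le_trans (tent_functional_le hmu bw D0 (fun u u2 => word_mean_vanishing hb (ltW e10)
  (ltn0Sn _ : 0 < Q n)%N (Mpos n) hr tr u2)) _.
apply: (@le_trans _ _ (2 * ((e1 + e1) * I))).
  by rewrite ler_wpM2l// ler_wpM2r ?lerD2r// ltW.
have -> : 2 * ((e1 + e1) * I) = e; last by [].
by rewrite /e1; field; rewrite gt_eqF.
Qed.

End WeakStarMeanSequence.

(** * The limit as an element of the predual *)

Section WeakStarLimit.
Context {R : realType}.
Local Notation G := (SL 3 R).
Local Notation normc := Normc.normc.
Variables (mu : {measure set (borel G) -> \bar R}) (p : R).
Hypothesis hmu : left_haar mu.
Variables (F : nat -> borel G -> R[i]) (C : R).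
Hypotheses (C0 : 0 <= C) (ms : mean_sequence mu p F C).
Local Notation L n := (L1_functional mu (F n)).

(** Boundedness, which includes measurability, guarantees that the integrals [L n phi] are
    genuine. *)
Definition mean_converges (phi : G -> R[i]) (v : R[i]) :=
  (exists c, bounded_by (phi : borel G -> R[i]) c) /\
  forall e : R, 0 < e -> exists N, forall n, (N <= n)%N -> normc (L n phi - v) <= e.

(** The default [0] makes the functional total; it is also the value expected on functions vanishing
    at infinity. *)
Definition mean_limit (phi : G -> R[i]) : R[i] := xget 0 [set v | mean_converges phi v].

Lemma normc_small_eq0 (z : R[i]) (K : R) : 0 <= K ->
  (forall e : R, 0 < e -> normc z <= K * e) -> z = 0.
Proof.
move=> K0 H; apply: Normc.eq0_normc; apply/eqP; rewrite eq_le normc_ge0 andbT.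
apply/ler_addgt0Pr => e e0; rewrite add0r.
have K1 : 0 < K + 1 by rewrite ltr_wpDl.
apply: le_trans (H (e / (K + 1)) (divr_gt0 e0 K1)) _.
by rewrite mulrCA ler_piMr ?(ltW e0)// ler_pdivrMr// mul1r lerDl.
Qed.

Lemma geometric_small (K e : R) : 0 < e ->
  exists N, forall n, (N <= n)%N -> K / 2 ^+ n < e.
Proof.
move=> e0; exists (Num.truncn (K / e)).+1 => n Nn.
have : K / e < 2 ^+ n.
  apply: lt_le_trans (truncnS_gt _) _.
  by rewrite -(natrX R 2 n) ler_nat (leq_trans Nn)// ltnW// ltn_expl.
by rewrite ltr_pdivrMr// ltr_pdivrMr ?exprn_gt0// mulrC.
Qed.

Lemma mean_limitE phi v : mean_converges phi v -> mean_limit phi = v.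
Proof.
move=> cv; apply: xget_subset1 => // x y [_ hx] [_ hy]; apply/eqP; rewrite -subr_eq0.
apply/eqP; apply: (@normc_small_eq0 _ 2) => // e e0.
have [N hN] := hx e e0; have [N' hN'] := hy e e0.
rewrite -(subrKA (L (maxn N N') phi)); apply: le_trans (ler_normcD _ _) _.
rewrite normc_sub mulr_natl mulr2n lerD//; first exact/hN/leq_maxl.
exact/hN'/leq_maxr.
Qed.

Lemma mean_limit_rate phi A B : mult_bound p phi A B ->
  mean_converges phi (mean_limit phi) /\
  forall n, normc (L n phi - mean_limit phi) <= 4 * (C * (A * B)) / 2 ^+ n.
Proof.
move=> mb; have [A0 B0] := mult_bound_ge0 mb.
have K0 : 0 <= C * (A * B) by rewrite !mulr_ge0.
have [v hv] := geometric_limitC K0 (fun n => mean_step ms n mb).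
have cv : mean_converges phi v.
  split; first by exists (A * B); exact: mult_bound_bounded mb.
  move=> e e0; have [N hN] := geometric_small (4 * (C * (A * B))) e0.
  by exists N => n /hN /ltW; exact: le_trans (hv n).
by rewrite (mean_limitE cv).
Qed.

Lemma Mpcb_mult_bound (phi : G -> R[i]) : Mpcb p phi -> exists A B, mult_bound p phi A B.
Proof.
by move=> [E [alpha [beta /rep_mult_bound [A [B [mb _]]]]]]; exists A, B.
Qed.

(** The infimum need not be attained, so a representation of product below [2] is taken; its strict
    form adds at most [1]. *)
Lemma Mpcb_unit_ball (phi : G -> R[i]) : (Mpcb_norm p phi <= 1)%E ->
  exists A B, mult_bound p phi A B /\ A * B <= 3.
Proof.
move=> n1; have : (Mpcb_norm p phi < 2%:E)%E by apply: le_lt_trans n1 _; rewrite lte_fin ltr1n.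
move=> /ereal_inf_lt[_ [E [alpha [beta [rep ->]]]] lt2].
have [A [B [mb AB]]] := rep_mult_bound rep; exists A, B; split=> //.
rewrite -lee_fin; apply: le_trans AB _.
apply: (@le_trans _ _ (2%:E + 1)%E); first by rewrite leeD2r// ltW.
by rewrite -EFinD lee_fin; lra.
Qed.

Lemma mean_limit_linear a (phi psi : G -> R[i]) : Mpcb p phi -> Mpcb p psi ->
  mean_limit (fun s => a * phi s + psi s) = a * mean_limit phi + mean_limit psi.
Proof.
move=> /Mpcb_mult_bound[A [B mb]] /Mpcb_mult_bound[A' [B' mb']].
have [[[c bp] h] _] := mean_limit_rate mb; have [[[c' bp'] h'] _] := mean_limit_rate mb'.
have a0 := normc_ge0 a.
apply: mean_limitE; split.
  exists (normc a * c + c'); split.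
    have [mp _] := bp; have [mp' _] := bp'.
    by apply: measurable_funC_add => //; apply: measurable_funC_mul => //; exact: measurable_funC_cst.
  move=> g; apply: le_trans (ler_normcD _ _) _; rewrite Normc.normcM.
  by rewrite lerD ?ler_wpM2l//; [case: bp|case: bp'].
move=> e e0; have a1 : 0 < normc a + 1 by rewrite ltr_wpDl.
pose d := e / (normc a + 1); have d0 : 0 < d by rewrite divr_gt0.
have [N hN] := h d d0; have [N' hN'] := h' d d0.
exists (maxn N N') => n; rewrite geq_max => /andP[n1 n2].
have -> : L n (fun s => a * phi s + psi s) = a * L n phi + L n psi.
  rewrite /L1_functional -(integralC_lin a (mean_integrable ms n bp) (mean_integrable ms n bp')).
  by congr (integralC mu _); apply/funext => u; rewrite mulrDr mulrCA.
rewrite opprD addrACA -mulrBr; apply: le_trans (ler_normcD _ _) _.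
rewrite Normc.normcM; apply: (@le_trans _ _ (normc a * d + d)).
  by rewrite lerD ?ler_wpM2l ?hN ?hN'.
by rewrite -[X in _ + X]mul1r -mulrDl /d mulrC divfK// gt_eqF.
Qed.

(** The rate of convergence is uniform on the unit ball of the multipliers, so the functionals of
    the integrable [F n] converge in dual norm and the limit lies in their closure; [12] is [4 * 3],
    with [3] from [Mpcb_unit_ball]. *)
Lemma mean_limit_Qpcb : @Qpcb R G mu p mean_limit.
Proof.
have dist n : (Mpcb_dual_norm p (fun phi => (mean_limit phi - L n phi)%R) <=
    (12 * C / 2 ^+ n)%:E)%E.
  apply: ge_ereal_sup => _ [phi [_ /Mpcb_unit_ball[A [B [mb AB]]]] <-].
  rewrite lee_fin normc_sub; apply: le_trans ((mean_limit_rate mb).2 n) _.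
  rewrite ler_wpM2r ?invr_ge0 ?exprn_ge0//.
  by have : C * (A * B) <= C * 3 by [rewrite ler_wpM2l]; lra.
split.
  split; first by move=> *; exact: mean_limit_linear.
  apply: (@le_lt_trans _ _ (12 * C + 2 * (3 * \int[mu]_u tent u))%:E); last exact: ltry.
  apply: ge_ereal_sup => _ [phi [_ /Mpcb_unit_ball[A [B [mb AB]]]] <-].
  have bp := mult_bound_bounded mb.
  rewrite lee_fin -[mean_limit phi](subrK (L 0%N phi)).
  apply: le_trans (ler_normcD _ _) (lerD _ _).
    rewrite normc_sub; apply: le_trans ((mean_limit_rate mb).2 0%N) _.
    by rewrite expr0 divr1; have : C * (A * B) <= C * 3 by [rewrite ler_wpM2l]; lra.
  apply: le_trans (mean_bound ms 0%N bp) _.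
  by rewrite ler_wpM2l// ler_wpM2r// ltW// tent_integral_gt0.
move=> e e0; have [n hn] := geometric_small (12 * C) e0.
exists (F n); first exact: (mean_Lp ms).
by apply: le_lt_trans (dist n) _; rewrite lte_fin hn.
Qed.

Lemma mean_limit1 : mean_limit (fun=> 1) = (\int[mu]_u tent u)%:C%C.
Proof.
apply: mean_limitE; split.
  by exists 1; split; [exact: measurable_funC_cst|move=> g; rewrite Normc.normc1].
by move=> e e0; exists 0%N => n _; rewrite (mean_cst ms) subrr Normc.normc0 ltW.
Qed.

Lemma mean_limit_vanishing (phi : G -> R[i]) : vanishing phi -> mean_limit phi = 0.
Proof.
(* If [phi] has no limit value, the default of [xget] is already [0]. *)
move=> van; rewrite /mean_limit; case: xgetP => // v _ [[c bp] h].
apply: (@normc_small_eq0 _ 2) => // e e0.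
have [N hN] := h e e0; have [N' hN'] := mean_vanishing ms bp van e0.
rewrite -(subrK (L (maxn N N') phi) v); apply: le_trans (ler_normcD _ _) _.
rewrite normc_sub mulr_natl mulr2n lerD//; first exact/hN/leq_maxl.
exact/hN'/leq_maxr.
Qed.

End WeakStarLimit.

Theorem theorem1p3 (R : realType) (p : R) (hp : 1 < p)
  (mu : {measure set (borel (SL 3 R)) -> \bar R}) (hmu : left_haar mu) :
  ~ p_AP mu p.
Proof.
move=> [J [ord [phi [[_ ord_refl _ _] phiA cvgphi]]]].
have [F [C [C0 ms]]] := mean_sequence_exists hmu hp.
have I0 := tent_integral_gt0 hmu.
have e0 : 0 < (\int[mu]_u tent u) / 2 by rewrite divr_gt0.
(* A single member of the net suffices: the functional is [0] on it and equals the integral of the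
   bump at [1], twice the tolerance. *)
have [i0 /(_ i0 (ord_refl i0))] := cvgphi _ (mean_limit_Qpcb hmu C0 ms) _ e0.
rewrite (mean_limit_vanishing ms (Ap_vanishing hmu hp (phiA i0))) (mean_limit1 ms).
by rewrite sub0r normc_opp normc_real gtr0_norm//; lra.
Qed.
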